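(* Let $F$ be a number field which is neither $\mathbb{Q}$ nor an imaginary quadratic field, let $\mathfrak{N}$ be a nonzero integral ideal of $F$, and let $p$ be a rational prime not dividing the order of $O_F^\times/E(\mathfrak{N})$. Then every Hecke eigensystem $\lambda:\mathbb{T}^0\to\overline{\mathbb{F}}_p$ occurring in $H^1(Y(\mathfrak{N}),\overline{\mathbb{F}}_p)$ also occurs in $H^0(Y(\mathfrak{N}),\overline{\mathbb{F}}_p)$, and conversely every Hecke eigensystem occurring in $H^0(Y(\mathfrak{N}),\overline{\mathbb{F}}_p)$ occurs in $H^1(Y(\mathfrak{N}),\overline{\mathbb{F}}_p)$.
   Context: Notation. $O_F$ is the ring of integers of $F$; $F_\mathbb{R}=F\otimes_\mathbb{Q}\mathbb{R}$, $F_{\mathbb{R},+}^\times$ its identity component of units, $U=\{x\in F_{\mathbb{R},+}^\times : |x_\tau|=1 \text{ for all infinite places } \tau\}$. For a finite prime $v$: $F_v,O_v,\kappa_v$, $N(v)=|\kappa_v|$. $K(\mathfrak{N})=\prod_{v\mid\mathfrak{N}}(1+\mathfrak{N}O_v)\times\prod_{v\nmid\mathfrak{N}}O_v^\times$, $Y(\mathfrak{N})=F^\times\backslash (F_\mathbb{R}^\times/U)\times \mathbb{A}_F^{(\infty),\times}/K(\mathfrak{N})$ ($\mathbb{A}_F^{(\infty)}$ finite adeles), $E(\mathfrak{N})=F^\times\cap F_{\mathbb{R},+}^\times\cap K(\mathfrak{N})$. Derived Hecke operators with coefficients $\mathbb{F}_p$: for a prime $v$ coprime to $p\mathfrak{N}$,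 let $\phi_{v,\mathfrak{N}}:Y(\mathfrak{N})\to\mathcal{B}\kappa_v^\times$ classify the principal $\kappa_v^\times$-bundle $Y(v\mathfrak{N})\to Y(\mathfrak{N})$; for $\alpha\in H^\bullet(O_v^\times,\mathbb{F}_p)\cong H^\bullet(\kappa_v^\times,\mathbb{F}_p)$ put $\langle\alpha\rangle=\phi_{v,\mathfrak{N}}^*\alpha$; for $z\in F_v^\times/O_v^\times$ let $z:Y(\mathfrak{N})\to Y(\mathfrak{N})$ be multiplication of the finite adelic component by $z$ at $v$; set $h_{z,\alpha}c=\langle\alpha\rangle\cup z^*c$. $\mathbb{T}^\bullet$ is the graded $\mathbb{F}_p$-subalgebra of $\mathrm{End}\,H^\bullet(Y(\mathfrak{N}),\mathbb{F}_p)$ generated by all $h_{z,\alpha}$; $\mathbb{T}^0$ is its degree-$0$ part, a commutative algebra. $\mathbb{T}^0$ acts on $H^j(Y(\mathfrak{N}),\overline{\mathbb{F}}_p)=H^j(Y(\mathfrak{N}),\mathbb{F}_p)\otimes\overline{\mathbb{F}}_p$. A Hecke eigensystem $\lambda:\mathbb{T}^0\to\overline{\mathbb{F}}_p$ (ring homomorphism) occurs in $H^j$ if there is a nonzero $c\in H^j(Y(\mathfrak{N}),\overline{\mathbb{F}}_p)$ with $hc=\lambda(h)c$ for all $h\in\mathbb{T}^0$. *)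

(* Defs.v *)
From HB Require Import structures.
From mathcomp Require Import all_boot all_order all_algebra all_field.
From mathcomp Require Import complex freeg.
From mathcomp Require Import all_classical all_reals topology normedtype.

Set Implicit Arguments.
Unset Strict Implicit.
Unset Printing Implicit Defensive.

Import Order.TTheory GRing.Theory Num.Theory.
Import numFieldNormedType.Exports.

Local Open Scope classical_set_scope.
Local Open Scope ring_scope.
Local Open Scope quotient_scope.


Section QuotientModule.
Variables (A : pzRingType) (V : lmodType A) (S : submodClosed V).

Definition submod_pred : {pred V} := [pred x | x \in S].
Let submod_pred_zmod : zmod_closed submod_pred.
Proof.
split=> [|u v]; rewrite !inE ?rpred0 // => Su Sv.
by rewrite rpredD // -scaleN1r rpredZ.
Qed.
HB.instance Definition _ :=
  GRing.isZmodClosed.Build V submod_pred submod_pred_zmod.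

Definition lmod_quot : Type := Quotient.quot submod_pred.
HB.instance Definition _ := GRing.Zmodule.on lmod_quot.
HB.instance Definition _ := Quotient.on lmod_quot.

Lemma lmod_quotP (u v : V) :
  reflect (\pi_lmod_quot u = \pi_lmod_quot v) (u - v \in S).
Proof. rewrite -[_ \in S]/(_ \in submod_pred) (Quotient.idealrBE submod_pred); exact: eqP. Qed.

Let piD (u v : V) :
  \pi_lmod_quot (u + v) = \pi_lmod_quot u + \pi_lmod_quot v :> lmod_quot.
Proof. exact: (raddfD (\pi_(Quotient.quot submod_pred))). Qed.

Definition lmod_quot_scale (a : A) (x : lmod_quot) : lmod_quot :=
  \pi_lmod_quot (a *: repr x).

Lemma lmod_quot_scaleE a v :
  lmod_quot_scale a (\pi_lmod_quot v) = \pi_lmod_quot (a *: v).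
Proof.
apply/lmod_quotP; rewrite -scalerBr rpredZ //.
by apply/lmod_quotP; rewrite reprK.
Qed.

Let scaleA a b x :
  lmod_quot_scale a (lmod_quot_scale b x) = lmod_quot_scale (a * b) x.
Proof. by rewrite -[x]reprK (lmod_quot_scaleE b) 2!lmod_quot_scaleE scalerA. Qed.

Let scale1 x : lmod_quot_scale 1 x = x.
Proof. by rewrite -[x]reprK !lmod_quot_scaleE scale1r. Qed.

Let scaleDr a x y :
  lmod_quot_scale a (x + y) = lmod_quot_scale a x + lmod_quot_scale a y.
Proof.
by rewrite -[x]reprK -[y]reprK -piD !lmod_quot_scaleE -piD scalerDr.
Qed.

Let scaleDl x a b :
  lmod_quot_scale (a + b) x = lmod_quot_scale a x + lmod_quot_scale b x.
Proof. by rewrite -[x]reprK !lmod_quot_scaleE -piD scalerDl. Qed.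

HB.instance Definition _ := GRing.Zmodule_isLmodule.Build A lmod_quot
  scaleA scale1 scaleDr scaleDl.

Lemma lmod_quot_pi_linear :
  linear (\pi_lmod_quot : V -> lmod_quot).
Proof. by move=> a u v; rewrite piD -(lmod_quot_scaleE a u). Qed.

End QuotientModule.

(* k (x)_A V, presented as the free k-module on the symbols a (x) v, where
   << a *g v >> stands for a (x) v, modulo the balanced bilinear relations. *)
Section Tensor.
Variables (A k : nzRingType) (iota : {rmorphism A -> k}) (V : lmodType A).

Inductive tensor_relation : {freeg V / k} -> Prop :=
| tensor_relD (a : k) (u v : V) :
    tensor_relation (<< a *g u + v >> - << a *g u >> - << a *g v >>)
| tensor_relZ (a : k) (b : A) (v : V) :
    tensor_relation (<< a *g b *: v >> - << a * iota b *g v >>).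

Definition tensor_rel : {pred {freeg V / k}} := [pred x | `[<
  forall P : {freeg V / k} -> bool, submod_closed P ->
    (forall r, tensor_relation r -> P r) -> P x >]].

Lemma tensor_rel_submod : submod_closed tensor_rel.
Proof.
split=> [|a u v /asboolP hu /asboolP hv]; apply/asboolP => P Ps Pr.
  exact: Ps.1.
by apply: Ps.2; [exact: hu|exact: hv].
Qed.
HB.instance Definition _ :=
  GRing.isSubmodClosed.Build k {freeg V / k} tensor_rel
    (GRing.submod_closed_semi tensor_rel_submod).

Definition tensor : lmodType k := lmod_quot tensor_rel.

Definition pure_tensor (a : k) (v : V) : tensor := \pi_tensor << a *g v >>.

(* id (x) h; it does not depend on the representatives when h is A-linear. *)
Definition tensor_map (h : V -> V) (x : tensor) : tensor :=
  fglift (fun v => pure_tensor 1 (h v)) (repr x).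
End Tensor.

Section SingularSimplices.
Variable R : realType.

Definition simplex (n : nat) : set 'rV[R]_n.+1 :=
  [set t | (forall i, 0 <= t ord0 i) /\ \sum_i t ord0 i = 1].
Arguments simplex n : clear implicits.

Definition simplex_fun m n (f : 'I_m.+1 -> 'I_n.+1)
    (t : 'rV[R]_m.+1) : 'rV[R]_n.+1 :=
  \row_j \sum_(i | f i == j) t ord0 i.

Lemma simplex_funP m n (f : 'I_m.+1 -> 'I_n.+1) (t : simplex m) :
  simplex_fun f (val t) \in simplex n.
Proof.
have /set_mem [t0 t1] := valP t; apply/mem_set; split=> [j|].
  by rewrite mxE sumr_ge0.
rewrite -t1 (partition_big f predT) //=.
by apply: eq_bigr => j _; rewrite mxE.
Qed.

Definition simplex_map_fun m n (f : 'I_m.+1 -> 'I_n.+1) (t : simplex m) :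
  simplex n := exist _ (simplex_fun f (val t)) (simplex_funP f t).

Lemma simplex_map_continuous m n (f : 'I_m.+1 -> 'I_n.+1) :
  continuous (simplex_map_fun f).
Proof.
apply/continuousP => _ [B oB <-].
suff cf : continuous (fun t : simplex m => simplex_fun f (val t)).
  by move/continuousP: cf => /(_ _ oB).
move=> t A [P hP sPA].
have cj j : continuous (fun s : simplex m => simplex_fun f (val s) ord0 j).
  rewrite (_ : (fun s : simplex m => _) =
    fun s : simplex m => \sum_(i | f i == j) (val s) ord0 i); last first.
    by apply/funext => s; rewrite mxE.
  have cD : continuous (fun z : R^o * R^o => z.1 + z.2).
    exact: add_continuous.
  refine (@continuous_big R _ _ _ _ cD _ _ _ _) => i _.
  move=> s; apply: (@continuous_comp _ _ _ (val : simplex m -> _)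
    (fun M : 'rV[R]_m.+1 => M ord0 i)).
    exact: initial_continuous.
  exact: coord_continuous.
have FF : Filter (nbhs t) by exact: nbhs_filter.
have h : \forall s \near t, forall j, P ord0 j (simplex_fun f (val s) ord0 j).
  apply: (@filter_forall _ _ _ (nbhs t)) => j; apply: (cj j t); exact: hP.
by apply: filterS h => s hs; apply: sPA => i j; rewrite (ord1 i).
Qed.

Definition simplex_map m n (f : 'I_m.+1 -> 'I_n.+1) :
    continuousType (simplex m) (simplex n) :=
  mkcts (@simplex_map_continuous m n f).

Lemma simplex_vertexP n (i : 'I_n.+1) :
  (delta_mx ord0 i : 'rV[R]_n.+1) \in simplex n.
Proof.
apply/mem_set; split=> [j|]; first by rewrite mxE ler0n.
rewrite (bigD1 i) //= mxE !eqxx big1 ?addr0 // => j /negPf ji.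
by rewrite mxE ji andbF.
Qed.

Definition simplex_vertex n (i : 'I_n.+1) : simplex n :=
  exist _ (delta_mx ord0 i) (simplex_vertexP i).

Definition singular (X : topologicalType) : Type :=
  {n : nat & continuousType (simplex n) X}.

Definition sing (X : topologicalType) n
    (s : continuousType (simplex n) X) : singular X := existT _ n s.

Definition sing_sub (X : topologicalType) m n (f : 'I_m.+1 -> 'I_n.+1)
    (s : continuousType (simplex n) X) : continuousType (simplex m) X :=
  s \o simplex_map f.

Definition sing_push (X Y : topologicalType) (f : continuousType X Y)
    (s : singular X) : singular Y := sing (f \o projT2 s).

End SingularSimplices.

Arguments simplex R n : clear implicits.
Arguments simplex_vertex R {n} i.

Definition face n (i : 'I_n.+2) : 'I_n.+1 -> 'I_n.+2 := fintype.lift i.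

Section SingularCohomology.
Variables (R : realType) (A : comNzRingType) (X : topologicalType).

(* Cochains of all degrees at once: a cochain is a function on the singular
   simplices of all dimensions, and is homogeneous of degree n when it vanishes
   on the simplices of dimension <> n. *)
Definition cochain : lmodType A := (singular R X -> A^o).

Definition coboundary (c : cochain) : cochain := fun s =>
  match s with
  | existT 0 _ => 0
  | existT n.+1 t =>
      \sum_(i < n.+2) (-1) ^+ i * c (sing (sing_sub (face i) t))
  end.

Definition front_face n (i : 'I_n.+1) (j : 'I_i.+1) : 'I_n.+1 := inord j.
Definition back_face n (i : 'I_n.+1) (j : 'I_(n - i).+1) : 'I_n.+1 :=
  inord (i + j).

Definition cup (a b : cochain) : cochain := fun s =>
  \sum_(i < (projT1 s).+1)
    a (sing (sing_sub (@front_face (projT1 s) i) (projT2 s))) *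
    b (sing (sing_sub (@back_face (projT1 s) i) (projT2 s))).

Definition homogeneous (n : nat) (c : cochain) : Prop :=
  forall s : singular R X, projT1 s <> n -> c s = 0.

Definition bounded_degree (c : cochain) : Prop :=
  exists N : nat, forall s : singular R X, (N <= projT1 s)%N -> c s = 0.

Lemma coboundary_linear : linear coboundary.
Proof.
move=> a c d; apply/funext => -[[|n] t] /=.
  by apply: esym; apply: (etrans (addr0 _)); exact: mulr0.
pose c' (i : 'I_n.+2) : A := c (sing (sing_sub (face i) t)).
pose d' (i : 'I_n.+2) : A := d (sing (sing_sub (face i) t)).
change (\sum_(i < n.+2) (-1) ^+ i * (a * c' i + d' i) =
  a * (\sum_(i < n.+2) (-1) ^+ i * c' i) + \sum_(i < n.+2) (-1) ^+ i * d' i).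
rewrite mulr_sumr -big_split; apply: eq_bigr => i _ /=.
by rewrite mulrDr mulrCA.
Qed.
HB.instance Definition _ :=
  GRing.isLinear.Build A cochain cochain *:%R coboundary coboundary_linear.

Lemma bounded_degree_lin a c d :
  bounded_degree c -> bounded_degree d -> bounded_degree (a *: c + d).
Proof.
move=> [M hM] [N hN]; exists (maxn M N) => s; rewrite geq_max => /andP[sM sN].
rewrite [LHS]/(a * c s + d s) hM // hN //.
by apply: (etrans (addr0 _)); exact: mulr0.
Qed.

Lemma bounded_degree0 : bounded_degree 0.
Proof. by exists 0%N. Qed.

Definition cocycle_pred : {pred cochain} :=
  [pred c | `[< bounded_degree c /\ coboundary c = 0 >]].

Lemma cocycle_submod : submod_closed cocycle_pred.
Proof.
split=> [|a c d /asboolP[bc zc] /asboolP[bd zd]]; apply/asboolP; split.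
- exact: bounded_degree0.
- exact: linear0.
- exact: bounded_degree_lin.
- by rewrite coboundary_linear zc zd scaler0 addr0.
Qed.
HB.instance Definition _ := GRing.isSubmodClosed.Build A cochain cocycle_pred
  (GRing.submod_closed_semi cocycle_submod).

Record cocycle : Type :=
  Cocycle { cocycle_val :> cochain; _ : cocycle_val \in cocycle_pred }.
HB.instance Definition _ := [isSub of cocycle for cocycle_val].
HB.instance Definition _ := [Choice of cocycle by <:].
HB.instance Definition _ := [SubChoice_isSubLmodule of cocycle by <:].

Definition coboundary_pred : {pred cocycle} :=
  [pred z : cocycle | `[< exists2 b, bounded_degree b &
                           cocycle_val z = coboundary b >]].

Lemma coboundary_submod : submod_closed coboundary_pred.
Proof.
split=> [|a c d /asboolP[b bb cb] /asboolP[e be de]]; apply/asboolP.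
  by exists 0; [exact: bounded_degree0 | rewrite linear0].
exists (a *: b + e); first exact: bounded_degree_lin.
by rewrite coboundary_linear -cb -de.
Qed.
HB.instance Definition _ := GRing.isSubmodClosed.Build A cocycle
  coboundary_pred (GRing.submod_closed_semi coboundary_submod).

(* Cocycles and coboundaries are restricted to finitely many degrees, so this is
   the direct sum (not the product) of the singular cohomology groups
   H^n(X, A), with n-th summand cohomology_deg n. *)
Definition cohomology : lmodType A := lmod_quot coboundary_pred.

Definition cohomology_class (z : cocycle) : cohomology := \pi_cohomology z.

Definition cohomology_deg (n : nat) : set cohomology :=
  [set x | exists2 z : cocycle, homogeneous n z & x = cohomology_class z].

End SingularCohomology.

Definition cochain_pullback (R : realType) (A : comNzRingType)
    (X Y : topologicalType) (f : continuousType X Y) (c : cochain R A Y) :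
  cochain R A X := fun s => c (sing_push f s).

(* For a number field, the normalized discrete valuations are the valuations
   attached to the nonzero prime ideals of the ring of integers (see prime_ideal
   below). The true value at 0 is +oo; vord0 is a convention which makes equal
   valuations equal as records, and ord_ge corrects for it. *)
Record finite_place (F : fieldType) : Type := FinitePlace {
  vord : F -> int;
  vord0 : vord 0 = 0;
  vordM : forall x y, x != 0 -> y != 0 -> vord (x * y) = vord x + vord y;
  vordD : forall x y, x != 0 -> y != 0 -> x + y != 0 ->
           Num.min (vord x) (vord y) <= vord (x + y);
  vord_onto : forall n : int, exists2 x, x != 0 & vord x = n
}.

HB.instance Definition _ (F : fieldType) := gen_eqMixin (finite_place F).
HB.instance Definition _ (F : fieldType) := gen_choiceMixin (finite_place F).

Section Completion.
Variables (F : fieldType) (v : finite_place F).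

Definition ord_ge (n : int) (x : F) : bool := (x == 0) || (n <= vord v x).

Lemma ord_ge0 n : ord_ge n 0. Proof. by rewrite /ord_ge eqxx. Qed.

Lemma vord1 : vord v 1 = 0.
Proof.
have /eqP := vordM v (oner_neq0 F) (oner_neq0 F).
by rewrite mulr1 -subr_eq subrr eq_sym => /eqP.
Qed.

Lemma vordN1 : vord v (-1) = 0.
Proof.
have n0 : (-1 : F) != 0 by rewrite oppr_eq0 oner_neq0.
have := vordM v n0 n0; rewrite mulrNN mulr1 vord1 => /esym/eqP.
by rewrite -mulr2n mulrn_eq0 /= => /eqP.
Qed.

Lemma vordV x : x != 0 -> vord v x^-1 = - vord v x.
Proof.
move=> x0; have xV : x^-1 != 0 by rewrite invr_eq0.
have := vordM v x0 xV; rewrite divff // vord1 => /esym/eqP.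
by rewrite addrC addr_eq0 => /eqP.
Qed.

Lemma ord_geD n x y : ord_ge n x -> ord_ge n y -> ord_ge n (x + y).
Proof.
rewrite /ord_ge; have [->|x0] := eqVneq x 0; first by rewrite add0r.
have [->|y0] := eqVneq y 0; first by rewrite addr0 (negPf x0).
have [//|s0] := eqVneq (x + y) 0 => /= nx ny.
by apply: le_trans (vordD v x0 y0 s0); rewrite le_min nx.
Qed.

Lemma ord_geM m n x y : ord_ge m x -> ord_ge n y -> ord_ge (m + n) (x * y).
Proof.
rewrite /ord_ge mulf_eq0; have [//|x0] := eqVneq x 0.
have [//|y0] := eqVneq y 0 => /= mx ny.
by rewrite vordM // lerD.
Qed.

Lemma ord_geN n x : ord_ge n (- x) = ord_ge n x.
Proof.
rewrite /ord_ge oppr_eq0; have [//|x0] := eqVneq x 0.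
by rewrite -mulN1r vordM ?oppr_eq0 ?oner_neq0 // vordN1 add0r.
Qed.

Lemma ord_geB n x y : ord_ge n x -> ord_ge n y -> ord_ge n (x - y).
Proof. by move=> hx hy; apply: ord_geD; rewrite ?ord_geN. Qed.

Lemma ord_geW m n x : m <= n -> ord_ge n x -> ord_ge m x.
Proof. by move=> mn /orP[x0|nx]; rewrite /ord_ge ?x0 // (le_trans mn nx) orbT. Qed.

Definition cauchy (s : nat -> F) : Prop :=
  forall n : int, exists M : nat, forall i j,
    (M <= i)%N -> (M <= j)%N -> ord_ge n (s i - s j).

Definition null (s : nat -> F) : Prop :=
  forall n : int, exists M : nat, forall i, (M <= i)%N -> ord_ge n (s i).

Lemma cauchy_bounded s : cauchy s ->
  exists (n : int) (M : nat), forall i, (M <= i)%N -> ord_ge n (s i).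
Proof.
move=> /(_ 0)[M hM]; exists (Num.min 0 (vord v (s M))), M => i Mi.
rewrite -(subrK (s M) (s i)); apply: ord_geD.
  by apply: ord_geW (hM _ _ Mi (leqnn M)); rewrite ge_min lexx.
by rewrite /ord_ge ge_min lexx !orbT.
Qed.

Definition cauchy_pred : {pred (nat -> F)} := [pred s | `[< cauchy s >]].

Lemma cauchy_subring : subring_closed cauchy_pred.
Proof.
split=> [|s t /asboolP cs /asboolP ct|s t /asboolP cs /asboolP ct];
  apply/asboolP => n.
- by exists 0%N => i j _ _; rewrite subrr ord_ge0.
- have [M hM] := cs n; have [N hN] := ct n; exists (maxn M N) => i j.
  rewrite !geq_max => /andP[Mi Ni] /andP[Mj Nj].
  rewrite (_ : _ - _ = (s i - s j) - (t i - t j)); last first.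
    change ((s i - t i) - (s j - t j) = (s i - s j) - (t i - t j)).
    by rewrite !opprD !opprK addrACA.
  by apply: ord_geB; [exact: hM|exact: hN].
- have [a [A hA]] := cauchy_bounded cs; have [b [B hB]] := cauchy_bounded ct.
  have [M hM] := cs (n - b); have [N hN] := ct (n - a).
  exists (maxn (maxn A B) (maxn M N)) => i j.
  rewrite !geq_max => /andP[/andP[Ai Bi] /andP[Mi Ni]].
  move=> /andP[/andP[Aj Bj] /andP[Mj Nj]].
  rewrite (_ : _ - _ = s i * (t i - t j) + (s i - s j) * t j); last first.
    change (s i * t i - s j * t j = s i * (t i - t j) + (s i - s j) * t j).
    by rewrite mulrBr mulrBl addrA subrK.
  apply: ord_geD.
    by rewrite -(subrKC a n); apply: ord_geM; [exact: hA|exact: hN].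
  by rewrite -(subrK b n); apply: ord_geM; [exact: hM|exact: hB].
Qed.
HB.instance Definition _ :=
  GRing.isSubringClosed.Build (nat -> F) cauchy_pred cauchy_subring.

Record cauchy_seq : Type :=
  CauchySeq { cauchy_val :> nat -> F; _ : cauchy_val \in cauchy_pred }.
HB.instance Definition _ := [isSub of cauchy_seq for cauchy_val].
HB.instance Definition _ := [Choice of cauchy_seq by <:].
HB.instance Definition _ := [SubChoice_isSubComNzRing of cauchy_seq by <:].

Lemma cauchy_seqP (s : cauchy_seq) : cauchy s.
Proof. by case: s => s /= /asboolP. Qed.

Definition null_pred : {pred cauchy_seq} :=
  [pred s : cauchy_seq | `[< null s >]].

Lemma null_ideal : idealr_closed null_pred.
Proof.
split=> [||a s t /asboolP hs /asboolP ht].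
- by apply/asboolP => n; exists 0%N => i _; exact: ord_ge0.
- apply/asboolP => /(_ 1) [M /(_ M (leqnn M))].
  by rewrite [cauchy_val _ _]/(1 : F) /ord_ge oner_eq0 /= vord1.
- apply/asboolP => n; have [b [B hB]] := cauchy_bounded (cauchy_seqP a).
  have [M hM] := hs (n - b); have [N hN] := ht n.
  exists (maxn B (maxn M N)) => i; rewrite !geq_max => /andP[Bi /andP[Mi Ni]].
  rewrite [cauchy_val _ _]/(a i * s i + t i); apply: ord_geD; last exact: hN.
  by rewrite -(subrKC b n); apply: ord_geM; [exact: hB|exact: hM].
Qed.
HB.instance Definition _ := isIdealr.Build cauchy_seq null_pred null_ideal.

Lemma const_seq_cauchy (a : F) : (fun=> a) \in cauchy_pred.
Proof. by apply/asboolP => n; exists 0%N => i j _ _; rewrite subrr ord_ge0. Qed.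
Definition const_seq (a : F) : cauchy_seq := CauchySeq (const_seq_cauchy a).

Definition completion : Type := Quotient.quot null_pred.
HB.instance Definition _ := GRing.ComNzRing.on completion.
HB.instance Definition _ := Quotient.on completion.

Lemma completionP (s t : cauchy_seq) :
  reflect (\pi_completion s = \pi_completion t) (s - t \in null_pred).
Proof. rewrite (Quotient.idealrBE null_pred); exact: eqP. Qed.

Lemma completion_piM (s t : cauchy_seq) :
  \pi_completion (s * t) = \pi_completion s * \pi_completion t :> completion.
Proof. exact: (rmorphM (\pi_(Quotient.quot null_pred))). Qed.

Lemma completion_pi1 : \pi_completion 1 = 1 :> completion.
Proof. exact: (rmorph1 (\pi_(Quotient.quot null_pred))). Qed.

Lemma completion_piD (s t : cauchy_seq) :
  \pi_completion (s + t) = \pi_completion s + \pi_completion t :> completion.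
Proof. exact: (raddfD (\pi_(Quotient.quot null_pred))). Qed.

Lemma completion_piN (s : cauchy_seq) :
  \pi_completion (- s) = - \pi_completion s :> completion.
Proof. exact: (raddfN (\pi_(Quotient.quot null_pred))). Qed.

Lemma completion_pi0 : \pi_completion 0 = 0 :> completion.
Proof. exact: (raddf0 (\pi_(Quotient.quot null_pred))). Qed.

Lemma cauchy_lower (s : cauchy_seq) : s \notin null_pred ->
  exists (n : int) (M : nat), forall i, (M <= i)%N ->
    s i != 0 /\ vord v (s i) <= n.
Proof.
move=> /asboolPn/existsNP[n /forallNP hn]; exists n.
have [M hM] := cauchy_seqP s n; exists M => i Mi.
suff : ~~ ord_ge n (s i) by rewrite negb_or -ltNge => /andP[-> /ltW].
apply/negP => si; apply: (hn M) => j Mj.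
by rewrite -(subrK (s i) (s j)); apply: ord_geD => //; exact: hM.
Qed.

Lemma cauchy_inv (s : cauchy_seq) : s \notin null_pred ->
  cauchy (fun i => (s i)^-1).
Proof.
move=> /cauchy_lower[b [B hB]] n; have [M hM] := cauchy_seqP s (n + b + b).
exists (maxn B M) => i j; rewrite !geq_max => /andP[Bi Mi] /andP[Bj Mj].
have [si bi] := hB i Bi; have [sj bj] := hB j Bj.
rewrite (_ : _ - _ = (s j - s i) * ((s i)^-1 * (s j)^-1)); last first.
  by rewrite mulrBl [_ * (_ * (s j)^-1)]mulrCA divff // mulr1 mulrA divff // mul1r.
have -> : n = (n + b + b) + (- b - b) by rewrite addrA addrK addrK.
apply: ord_geM; first exact: hM.
apply: ord_geM; apply/orP; right; rewrite vordV // lerN2 //.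
Qed.

Definition completion_inv (x : completion) : completion :=
  match pselect (exists y, y * x = 1) with
  | left e => projT1 (cid e)
  | right _ => 0
  end.

Lemma completion_mulVf (x : completion) : x != 0 -> completion_inv x * x = 1.
Proof.
move=> x0; rewrite /completion_inv; case: pselect => [e|[]].
  by case: cid.
have nx : repr x \notin null_pred.
  apply: contraNN x0 => hx; rewrite -[x]reprK -completion_pi0.
  by apply/eqP/completionP; rewrite subr0.
have /asboolP ci := cauchy_inv nx; exists (\pi_completion (CauchySeq ci)).
rewrite -{2}[x]reprK -completion_piM -completion_pi1; apply/completionP.
have [b [B hB]] := cauchy_lower nx.
apply/asboolP => n; exists B => i /hB[si _].
change (ord_ge n ((repr x i)^-1 * repr x i - 1)).
by rewrite mulVf // subrr ord_ge0.
Qed.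

Lemma completion_inv0 : completion_inv 0 = 0.
Proof.
rewrite /completion_inv; case: pselect => // e; exfalso; case: e => y.
by rewrite mulr0 => /esym/eqP; rewrite oner_eq0.
Qed.
HB.instance Definition _ := GRing.ComNzRing_isField.Build completion
  completion_mulVf completion_inv0.

Definition completion_emb (a : F) : completion := \pi_completion (const_seq a).

(* The elements of valuation >= n of the completion. *)
Definition completion_ge (n : int) : set completion :=
  [set x | exists2 s : cauchy_seq,
     (forall i, ord_ge n (s i)) & x = \pi_completion s].

Lemma completion_geD n x y :
  completion_ge n x -> completion_ge n y -> completion_ge n (x + y).
Proof.
move=> [s hs ->] [t ht ->]; exists (s + t) => [i|].
  exact: ord_geD (hs i) (ht i).
by rewrite completion_piD.
Qed.

Lemma completion_geM m n x y :
  completion_ge m x -> completion_ge n y -> completion_ge (m + n) (x * y).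
Proof.
move=> [s hs ->] [t ht ->]; exists (s * t) => [i|].
  exact: ord_geM (hs i) (ht i).
by rewrite completion_piM.
Qed.

Lemma completion_geN n x : completion_ge n x -> completion_ge n (- x).
Proof.
move=> [s hs ->]; exists (- s) => [i|]; last by rewrite completion_piN.
by rewrite [cauchy_val _ _]/(- s i) ord_geN.
Qed.

Lemma completion_ge_null n : completion_ge n 0.
Proof.
by exists 0 => [i|]; [exact: ord_ge0 | rewrite completion_pi0].
Qed.

Definition Ov : set completion := completion_ge 0.
Definition max_ideal : set completion := completion_ge 1.

Definition Ov_units : set completion :=
  [set x | [/\ x != 0, Ov x & Ov x^-1]].

Lemma Ov1 : Ov 1.
Proof.
exists 1 => [i|]; last by rewrite completion_pi1.
by rewrite [cauchy_val _ _]/(1 : F) /ord_ge vord1 lexx orbT.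
Qed.

Lemma OvM x y : Ov x -> Ov y -> Ov (x * y).
Proof. by move=> hx hy; rewrite /Ov -(addr0 0); exact: completion_geM. Qed.

Lemma Ov_units1 : Ov_units 1.
Proof. by split; rewrite ?invr1 ?oner_neq0 //; exact: Ov1. Qed.

Lemma Ov_unitsM x y : Ov_units x -> Ov_units y -> Ov_units (x * y).
Proof.
move=> [x0 Ox Oxi] [y0 Oy Oyi]; split; first by rewrite mulf_neq0.
  exact: OvM.
by rewrite invfM; exact: OvM.
Qed.

Lemma one_plus_max_ideal x : max_ideal (x - 1) -> Ov_units x.
Proof.
move=> [t ht tE]; pose s := 1 + t.
have xE : x = \pi_completion s.
  by rewrite completion_piD completion_pi1 -tE addrC subrK.
have s1 i : s i = 1 + t i by [].
have sn0 i : s i != 0.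
  rewrite s1 addr_eq0; apply/eqP => e; have := ht i.
  by rewrite -ord_geN -e /ord_ge oner_eq0 vord1.
have sge i : ord_ge 0 (s i).
  rewrite s1; apply: ord_geD; first by rewrite /ord_ge vord1 lexx orbT.
  by apply: ord_geW (ht i).
have ole i : vord v (s i) <= 0.
  rewrite leNgt; apply/negP => o; have: ord_ge 1 1.
    have -> : 1 = s i - t i by rewrite s1 addrK.
    by apply: ord_geB (ht i); rewrite /ord_ge -gtz0_ge1 o orbT.
  by rewrite /ord_ge oner_eq0 vord1.
have nx : s \notin null_pred.
  apply/negP => /asboolP /(_ 1)[M /(_ M (leqnn M))].
  by rewrite /ord_ge (negPf (sn0 M)) /= => /le_trans/(_ (ole M)).
have /asboolP ci := cauchy_inv nx; pose r := CauchySeq ci.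
have rs : \pi_completion r * x = 1.
  rewrite xE -completion_piM -completion_pi1; congr (\pi_completion _).
  apply/val_inj/funext => i.
  by change ((s i)^-1 * s i = 1); rewrite mulVf.
have x0 : x != 0.
  by apply/eqP => e; move: rs; rewrite e mulr0 => /esym/eqP; rewrite oner_eq0.
split=> //; first by rewrite xE; exists s.
have -> : x^-1 = \pi_completion r by rewrite -[RHS](mulfK x0) rs mul1r.
exists r => // i; rewrite [cauchy_val _ _]/((s i)^-1) /ord_ge.
by rewrite vordV // oppr_ge0 ole orbT.
Qed.

Lemma completion_emb_ge n a : ord_ge n a -> completion_ge n (completion_emb a).
Proof. by move=> h; exists (const_seq a). Qed.

Record Ov_unit : Type :=
  OvUnit { Ov_unit_val :> completion; _ : Ov_unit_val \in Ov_units }.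
HB.instance Definition _ := [isSub of Ov_unit for Ov_unit_val].
HB.instance Definition _ := [Choice of Ov_unit by <:].

Lemma Ov_unitP (u : Ov_unit) : Ov_units u.
Proof. by case: u => u /= /set_mem. Qed.

(* The quotient by this relation, residue_units, is the multiplicative group of
   the residue field of v. *)
Definition residue_equiv (u w : Ov_unit) : bool :=
  `[< max_ideal (Ov_unit_val u - Ov_unit_val w) >].

Lemma residue_equivP : equiv_class_of residue_equiv.
Proof.
split=> [u|u w|w u t].
- by apply/asboolP; rewrite subrr; exact: completion_ge_null.
- by apply/asboolP/asboolP => /completion_geN; rewrite opprB.
- move=> /asboolP h1 /asboolP h2; apply/asboolP.
  by have := completion_geD h1 h2; rewrite subrKA.
Qed.
Canonical residue_equiv_rel := EquivRelPack residue_equivP.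
Canonical residue_encModRel := defaultEncModRel residue_equiv.

Definition residue_units : Type := {eq_quot residue_equiv}.
HB.instance Definition _ := EqQuotient.on residue_units.
HB.instance Definition _ := Choice.on residue_units.

Lemma Ov_unit_mulP (u w : Ov_unit) :
  Ov_unit_val u * Ov_unit_val w \in Ov_units.
Proof. by apply/mem_set/Ov_unitsM; exact: Ov_unitP. Qed.

Definition residue_units_mul (x y : residue_units) : residue_units :=
  \pi_residue_units (OvUnit (Ov_unit_mulP (repr x) (repr y))).

End Completion.

Section Ideals.
Variable F : fieldType.

Definition ring_of_integers : set F :=
  [set x | integralOver (intr : int -> F) x].

Definition integer_units : set F :=
  [set x | [/\ x != 0, ring_of_integers x & ring_of_integers x^-1]].

Record nonzero_ideal (I : set F) : Prop := NonzeroIdeal {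
  ideal_sub : I `<=` ring_of_integers;
  ideal0 : I 0;
  idealD : forall x y, I x -> I y -> I (x + y);
  idealM : forall a x, ring_of_integers a -> I x -> I (a * x);
  ideal_neq0 : exists2 x, x != 0 & I x
}.

Definition principal_ideal (a : F) : set F :=
  [set a * x | x in ring_of_integers].

Definition ideal_mul (I J : set F) : set F :=
  [set x | exists (n : nat) (a b : 'I_n -> F),
     (forall i, I (a i) /\ J (b i)) /\ x = \sum_i a i * b i].

Definition prime_ideal (v : finite_place F) : set F :=
  [set x | ring_of_integers x /\ ord_ge v 1 x].

Definition divides (v : finite_place F) (I : set F) : Prop :=
  I `<=` prime_ideal v.

Definition local_ideal (v : finite_place F) (I : set F) : set (completion v) :=
  [set x | exists (n : nat) (a : 'I_n -> F) (y : 'I_n -> completion v),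
     (forall i, I (a i) /\ Ov (y i)) /\ x = \sum_i completion_emb v (a i) * y i].

(* The subgroup K(I) of the finite ideles. *)
Definition level (I : set F) : set (forall v : finite_place F, completion v) :=
  [set x | forall v, (divides v I -> local_ideal I (x v - 1)) /\
                     (~ divides v I -> Ov_units (x v))].

Lemma local_ideal_max v I : divides v I -> @local_ideal v I `<=` @max_ideal F v.
Proof.
move=> vI _ [n [a [y [hay ->]]]].
elim/big_ind: _ => [|x z hx hz|i _].
- exact: completion_ge_null.
- exact: completion_geD.
have [/vI[_ ai] yi] := hay i.
by rewrite /max_ideal -(addr0 1); apply: completion_geM yi; exact: completion_emb_ge.
Qed.

Lemma level_sub I J : I `<=` J -> level I `<=` level J.
Proof.
move=> IJ x hx v; have [h1 h2] := hx v; split=> vJ.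
  have [n [a [y [hay ->]]]] := h1 (subset_trans IJ vJ).
  by exists n, a, y; split=> // i; have [/IJ] := hay i.
have [vI|/h2//] := pselect (divides v I).
by apply: one_plus_max_ideal; apply: (local_ideal_max vI); exact: h1.
Qed.

Lemma nonzero_ideal_integers : nonzero_ideal ring_of_integers.
Proof.
split=> //; first exact: integral0.
- by move=> x y; exact: integral_add.
- by move=> x y; exact: integral_mul.
- by exists 1; [exact: oner_neq0|exact: integral1].
Qed.

Lemma nonzero_idealI I J :
  nonzero_ideal I -> nonzero_ideal J -> nonzero_ideal (I `&` J).
Proof.
move=> hI hJ; split.
- by move=> x [/(ideal_sub hI)].
- by split; exact: ideal0.
- by move=> x y [Ix Jx] [Iy Jy]; split; exact: idealD.
- by move=> a x Oa [Ix Jx]; split; exact: idealM.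
have [x x0 Ix] := ideal_neq0 hI; have [y y0 Jy] := ideal_neq0 hJ.
exists (x * y); rewrite ?mulf_neq0 //; split.
  by rewrite mulrC; apply: (idealM hI) => //; exact: (ideal_sub hJ).
by apply: (idealM hJ) => //; exact: (ideal_sub hI).
Qed.

End Ideals.

Section FiniteIdeles.
Variable F : fieldType.

(* The units of the ring of finite adeles. *)
Record finite_idele : Type := FiniteIdele {
  fidele_val :> forall v : finite_place F, completion v;
  fidele_neq0 : forall v, fidele_val v != 0;
  fidele_finite : finite_set [set v | ~ Ov_units (fidele_val v)]
}.
HB.instance Definition _ := gen_eqMixin finite_idele.
HB.instance Definition _ := gen_choiceMixin finite_idele.

(* The restricted product topology: the groups level M, for M a nonzero ideal,
   form a basis of neighbourhoods of 1. *)
Definition fidele_open (A : set finite_idele) : Prop :=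
  forall x, A x -> exists2 M : set F, nonzero_ideal M &
    forall y : finite_idele, level M (fun v => y v / x v) -> A y.

Lemma fidele_openT : fidele_open setT.
Proof. by move=> x _; exists (@ring_of_integers F) => //; exact: nonzero_ideal_integers. Qed.

Lemma fidele_openI : setI_closed fidele_open.
Proof.
move=> A B oA oB x [Ax Bx]; have [M hM MA] := oA x Ax; have [N hN NB] := oB x Bx.
exists (M `&` N); first exact: nonzero_idealI.
move=> y h; split; first by apply: MA; apply: level_sub h; exact: subIsetl.
by apply: NB; apply: level_sub h; exact: subIsetr.
Qed.

Lemma fidele_open_bigU (I : Type) (f : I -> set finite_idele) :
  (forall i, fidele_open (f i)) -> fidele_open (\bigcup_i f i).
Proof.
move=> of_ x [i _ fix_]; have [M hM h] := of_ i x fix_.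
by exists M => // y /h fiy; exists i.
Qed.

HB.instance Definition _ := isOpenTopological.Build finite_idele
  fidele_openT fidele_openI fidele_open_bigU.

Section Translation.
Variables (v : finite_place F) (z : completion v) (z0 : z != 0).

Definition fidele_trans_val (x : finite_idele) (w : finite_place F) :
  completion w := dfwith x v (z * x v) w.

Lemma fidele_trans_neq0 x w : fidele_trans_val x w != 0.
Proof.
rewrite /fidele_trans_val; case: dfwithP => [|j _]; last exact: fidele_neq0.
by rewrite mulf_neq0 // fidele_neq0.
Qed.

Lemma fidele_trans_finite x :
  finite_set [set w | ~ Ov_units (fidele_trans_val x w)].
Proof.
apply: (@sub_finite_set _ _ ([set w | ~ Ov_units (x w)] `|` [set v])).
  move=> w; rewrite /fidele_trans_val /=; case: dfwithP => [|j _]; last by left.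
  by move=> _; right.
by rewrite finite_setU; split; [exact: fidele_finite|exact: finite_set1].
Qed.

Definition fidele_trans (x : finite_idele) : finite_idele :=
  FiniteIdele (fidele_trans_neq0 x) (fidele_trans_finite x).

Lemma fidele_trans_ratio (x y : finite_idele) w :
  fidele_trans y w / fidele_trans x w = y w / x w.
Proof.
rewrite /= /fidele_trans_val; have [<-|vw] := eqVneq v w.
  by rewrite !dfwithin invfM mulrACA divff // mul1r.
by rewrite !dfwithout.
Qed.

Lemma fidele_trans_continuous : continuous fidele_trans.
Proof.
apply/continuousP => A; rewrite /open /= => oA x Azx; have [M hM h] := oA _ Azx.
exists M => // y hy; apply: h.
by rewrite (_ : (fun w => _) = (fun w => y w / x w)) //;
   apply/functional_extensionality_dep => w; exact: fidele_trans_ratio.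
Qed.

End Translation.

Lemma finite_idele_ext (x y : finite_idele) : (forall v, x v = y v) -> x = y.
Proof.
case: x y => x x0 xf [y y0 yf] /= xy.
have exy : x = y by apply/functional_extensionality_dep.
subst y; congr FiniteIdele; exact: Prop_irrelevance.
Qed.

Lemma fidele_transK v (z : completion v) (z0 : z != 0) (zi0 : z^-1 != 0) x :
  fidele_trans zi0 (fidele_trans z0 x) = x.
Proof.
apply: finite_idele_ext => w; rewrite /= /fidele_trans_val.
have [<-|vw] := eqVneq v w; last first.
  by rewrite dfwithout //= /fidele_trans_val dfwithout.
by rewrite dfwithin /= /fidele_trans_val dfwithin mulKf.
Qed.

Lemma fidele_transVK v (z : completion v) (z0 : z != 0) (zi0 : z^-1 != 0) x :
  fidele_trans z0 (fidele_trans zi0 x) = x.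
Proof.
apply: finite_idele_ext => w; rewrite /= /fidele_trans_val.
have [<-|vw] := eqVneq v w; last first.
  by rewrite dfwithout //= /fidele_trans_val dfwithout.
by rewrite dfwithin /= /fidele_trans_val dfwithin mulVKf.
Qed.

End FiniteIdeles.

Section RayClassSpace.
Variables (R : realType) (F : fieldExtType rat).

Definition complex_of : numClosedFieldType := R[i]%C.
Definition embedding : Type := {rmorphism F -> complex_of}.
Definition arch_space : topologicalType :=
  prod_topology (fun _ : embedding => complex_of).

(* The image of F (x)_Q R in the product of the copies of C indexed by the
   complex embeddings of F: the conjugation-equivariant families, that is, the
   product of the completions at the infinite places. *)
Definition F_R : set arch_space :=
  [set x | forall s t : embedding, (forall a, s a = (t a)^*) -> x s = (x t)^*].

Definition F_R_units : set arch_space :=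
  [set x | F_R x /\ forall t, x t != 0].

Definition F_R_plus : set arch_space :=
  connected_component F_R_units (fun=> 1).

(* The group U. *)
Definition compact_part : set arch_space :=
  [set x | F_R_plus x /\ forall t, `|x t| = 1].

Definition idele : topologicalType := (F_R_units * finite_idele F)%type.

Definition arch_part (x : idele) : arch_space := set_val x.1.
Definition finite_part (x : idele) : finite_idele F := x.2.

(* The double coset F^x x U K(N). *)
Definition idele_coset (N : set F) (x : idele) : set idele :=
  [set y : idele | exists (g : F) (u : arch_space) (k : forall v, completion v),
    [/\ g != 0, compact_part u, level N k,
        (forall t : embedding, arch_part y t = t g * arch_part x t * u t) &
        (forall v, finite_part y v = completion_emb v g * finite_part x v * k v)]].

Definition same_coset (N : set F) (x y : idele) : bool :=
  `[< idele_coset N x = idele_coset N y >].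

Lemma same_cosetP N : equiv_class_of (same_coset N).
Proof.
split=> [x|x y|y x z]; first exact/asboolP.
- by apply/asboolP/asboolP.
- by move=> /asboolP xy /asboolP yz; apply/asboolP; rewrite xy.
Qed.
Canonical same_coset_rel N := EquivRelPack (same_cosetP N).
Canonical same_coset_encModRel N := defaultEncModRel (same_coset N).

(* F^x \ (F_R^x / U) x A_f^x / K(N), as a quotient in one step. *)
Definition Y (N : set F) : topologicalType :=
  quotient_topology {eq_quot (same_coset N)}.

Definition Y_class (N : set F) (x : idele) : Y N :=
  \pi_(quotient_topology {eq_quot (same_coset N)}) x.
Definition Y_repr (N : set F) (y : Y N) : idele :=
  repr (y : quotient_topology {eq_quot (same_coset N)}).

Definition Y_proj (M N : set F) (y : Y M) : Y N := Y_class N (Y_repr y).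

Section Translation.
Variables (v : finite_place F) (z : completion v) (z0 : z != 0).

Definition idele_trans (x : idele) : idele :=
  (x.1, fidele_trans z0 (finite_part x)).

Lemma idele_trans_continuous : continuous idele_trans.
Proof.
move=> x A [[P Q] /= [hP hQ] sPQ].
have hQ' : nbhs (finite_part x) (fidele_trans z0 @^-1` Q).
  exact: (@fidele_trans_continuous _ _ _ z0 (finite_part x)).
by exists (P, fidele_trans z0 @^-1` Q) => // -[a b] [/= Pa Qb]; exact: sPQ.
Qed.

Lemma idele_coset_trans N x y :
  idele_coset N x y -> idele_coset N (idele_trans x) (idele_trans y).
Proof.
move=> [g [u [k [g0 Uu Nk e1 e2]]]]; exists g, u, k; split=> // w.
rewrite /= /fidele_trans_val; have [<-|vw] := eqVneq v w; last first.
  by rewrite !dfwithout.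
by rewrite !dfwithin e2 -!mulrA mulrCA.
Qed.

End Translation.

Lemma idele_transK v (z : completion v) (z0 : z != 0) (zi0 : z^-1 != 0) x :
  idele_trans zi0 (idele_trans z0 x) = x.
Proof.
by case: x => x1 x2; exact: (congr1 (pair x1) (fidele_transK z0 zi0 x2)).
Qed.

Lemma idele_transVK v (z : completion v) (z0 : z != 0) (zi0 : z^-1 != 0) x :
  idele_trans z0 (idele_trans zi0 x) = x.
Proof.
by case: x => x1 x2; exact: (congr1 (pair x1) (fidele_transVK z0 zi0 x2)).
Qed.

Lemma same_coset_trans v (z : completion v) (z0 : z != 0) N x y :
  idele_coset N x = idele_coset N y ->
  idele_coset N (idele_trans z0 x) `<=` idele_coset N (idele_trans z0 y).
Proof.
move=> xy t; have zi0 : z^-1 != 0 by rewrite invr_eq0.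
move=> /(idele_coset_trans zi0); rewrite idele_transK xy.
by move=> /(idele_coset_trans z0); rewrite idele_transVK.
Qed.

Section YTranslation.
Variables (v : finite_place F) (z : completion v) (z0 : z != 0).

Definition Y_trans_fun N (y : Y N) : Y N :=
  Y_class N (idele_trans z0 (Y_repr y)).

Lemma Y_trans_continuous N : continuous (@Y_trans_fun N).
Proof.
have h : continuous (fun x => Y_class N (idele_trans z0 x)).
  move=> x; apply: (@continuous_comp _ _ _ (idele_trans z0) (Y_class N)).
    exact: idele_trans_continuous.
  exact: pi_continuous.
apply: (repr_comp_continuous h) => x y /eqP/eqmodP/asboolP xy.
apply/eqP/eqmodP/asboolP; apply/seteqP; split; exact: same_coset_trans.
Qed.

Definition Y_trans N : continuousType (Y N) (Y N) :=
  mkcts (@Y_trans_continuous N).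
End YTranslation.

(* The group E(N). *)
Definition unit_group (N : set F) : set F :=
  [set g | [/\ g != 0, F_R_plus (fun t : embedding => t g) &
               level N (fun v => completion_emb v g)]].

Definition unit_quotient (N : set F) : set (set F) :=
  [set [set a * e | e in unit_group N] | a in @integer_units F].

End RayClassSpace.

Section DerivedHecke.
Variables (R : realType) (F : fieldExtType rat) (N : set F) (p : nat).

Local Notation YN := (Y R N).

Section Bracket.
Variable v : finite_place F.

Definition raised_level : set F := ideal_mul (prime_ideal v) N.

Lemma Ov_unit_neq0 (u : Ov_unit v) : Ov_unit_val u != 0.
Proof. by have [] := Ov_unitP u. Qed.

Definition residue_act (g : residue_units v) : Y R raised_level -> Y R raised_level :=
  Y_trans R (Ov_unit_neq0 (repr g)) raised_level.

Definition edge n (i j : 'I_n.+1) : 'I_2 -> 'I_n.+1 :=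
  fun k => if k == ord0 then i else j.

(* A classifying map Y(N) -> B(kappa_v^x) of the bundle Y(vN) -> Y(N), in
   simplicial form: a map from the singular set of Y(N) to the nerve of
   kappa_v^x is given by a function g on paths which is multiplicative on
   2-simplices, and it classifies the bundle when g is the holonomy with respect
   to some set-theoretic section s: the lift of a path e starting from
   s (e 0) ends at g e . s (e 1). When kappa_v^x acts freely on Y(vN), the
   holonomy is unique and multiplicativity on 2-simplices is automatic. *)
Definition classifying_map
    (g : continuousType (simplex R 1) YN -> residue_units v) : Prop :=
  (exists2 s : YN -> Y R raised_level,
     (forall y, Y_proj N (s y) = y) &
     forall e : continuousType (simplex R 1) YN,
       exists e' : continuousType (simplex R 1) (Y R raised_level),
         [/\ forall t, Y_proj N (e' t) = e t,
             e' (simplex_vertex R ord0) = s (e (simplex_vertex R ord0)) &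
             e' (simplex_vertex R ord_max) =
               residue_act (g e) (s (e (simplex_vertex R ord_max)))]) /\
  (forall t : continuousType (simplex R 2) YN,
     g (sing_sub (edge ord0 ord_max) t) =
     residue_units_mul (g (sing_sub (edge ord0 1) t))
                       (g (sing_sub (edge 1 ord_max) t))).

(* Homogeneous cochains, in all degrees at once; the classes of the
   group_cocycles make up the direct sum of the H^n(kappa_v^x, F_p). *)
Definition group_cochain : Type :=
  {n : nat & 'I_n.+1 -> residue_units v} -> 'F_p.

Record group_cocycle (a : group_cochain) : Prop := GroupCocycle {
  group_cochain_bounded :
    exists m : nat, forall n (x : 'I_n.+1 -> residue_units v),
      (m <= n)%N -> a (existT _ n x) = 0;
  group_cochain_invariant :
    forall n (x : 'I_n.+1 -> residue_units v) (g : residue_units v),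
      a (existT _ n (fun i => residue_units_mul g (x i))) = a (existT _ n x);
  group_cochain_closed :
    forall n (x : 'I_n.+2 -> residue_units v),
      \sum_(i < n.+2) (-1) ^+ i * a (existT _ n (x \o face i)) = 0
}.

(* The pullback of a by the classifying map given by g; the holonomies along the
   edges 0i of a simplex are the homogeneous coordinates of its image. *)
Definition bracket (g : continuousType (simplex R 1) YN -> residue_units v)
    (a : group_cochain) : cochain R 'F_p YN :=
  fun s => a (existT _ (projT1 s)
    (fun i => g (sing_sub (edge ord0 i) (projT2 s)))).

End Bracket.

Local Notation H := (cohomology R 'F_p YN).

(* h is the operator c |-> <a> \cup z^* c. Translation by z only depends on z
   modulo O_v^x. *)
Definition derived_hecke (v : finite_place F) (z : completion v) (z0 : z != 0)
    (a : group_cochain v) (h : H -> H) : Prop :=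
  exists2 g : continuousType (simplex R 1) YN -> residue_units v,
    classifying_map g &
    forall c : cocycle R 'F_p YN, exists2 c' : cocycle R 'F_p YN,
      h (cohomology_class c) = cohomology_class c' &
      cocycle_val c' =
        cup (bracket g a) (cochain_pullback (Y_trans R z0 N) (cocycle_val c)).

(* The graded algebra T generated by the derived Hecke operators, and (below) its
   part of degree 0. *)
Inductive hecke_algebra : (H -> H) -> Prop :=
| hecke_gen (v : finite_place F) (z : completion v) (z0 : z != 0)
    (a : group_cochain v) (h : H -> H) :
    ~ divides v (ideal_mul (principal_ideal p%:R) N) ->
    group_cocycle a -> derived_hecke z0 a h -> hecke_algebra h
| hecke_one : hecke_algebra idfun
| hecke_add h h' :
    hecke_algebra h -> hecke_algebra h' -> hecke_algebra (h \+ h')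
| hecke_scale (b : 'F_p) h : hecke_algebra h -> hecke_algebra (b \*: h)
| hecke_comp h h' :
    hecke_algebra h -> hecke_algebra h' -> hecke_algebra (h \o h').

Definition hecke_algebra0 (h : H -> H) : Prop :=
  hecke_algebra h /\
  forall j x, cohomology_deg j x -> cohomology_deg j (h x).

Variables (k : closedFieldType) (iota : {rmorphism 'F_p -> k}).

(* A ring homomorphism from T^0 to k; the values of lambda outside T^0 are
   irrelevant. *)
Record hecke_eigensystem (lambda : (H -> H) -> k) : Prop := HeckeEigensystem {
  eigensystem1 : lambda idfun = 1;
  eigensystemD : forall h h', hecke_algebra0 h -> hecke_algebra0 h' ->
    lambda (h \+ h') = lambda h + lambda h';
  eigensystemM : forall h h', hecke_algebra0 h -> hecke_algebra0 h' ->
    lambda (h \o h') = lambda h * lambda h'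
}.

(* H^j (x) k inside H^* (x) k. *)
Definition cohomology_ext (j : nat) : set (tensor iota H) :=
  [set c | exists (n : nat) (a : 'I_n -> k) (x : 'I_n -> H),
     (forall i, cohomology_deg j (x i)) /\ c = \sum_i pure_tensor iota (a i) (x i)].

Definition occurs_in (lambda : (H -> H) -> k) (j : nat) : Prop :=
  exists c : tensor iota H, [/\ cohomology_ext j c, c != 0 &
    forall h, hecke_algebra0 h -> tensor_map h c = lambda h *: c].

End DerivedHecke.

Definition imaginary_quadratic (R : realType) (F : fieldExtType rat) : Prop :=
  \dim {:F} = 2%N /\ ~ inhabited {rmorphism F -> R}.

(* Main.v *)
(* By Dirichlet's argument, which needs F to be neither Q nor imaginary
   quadratic, the logarithms of E(N) form a nonzero lattice. A linear functional
   that is integral on it and takes the value 1 induces a map theta from Y(N) to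
   R/Z, and every point of Y(N) lies on a loop along which theta has winding
   number 1.

   A Hecke operator equals, up to terms raising the degree, a linear combination
   of translations by finite ideles. So it suffices to transfer simultaneous
   eigenvectors of these translations between H^0 and H^1; classes in H^0 are
   detected by points and classes in H^1 by loops.

   From H^0 to H^1, multiply by the class of the winding number of theta: the
   winding number of a loop does not change under translation, and a nonzero class
   stays nonzero because of the loops above.

   From H^1 to H^0, pick a loop gamma on which the class c does not vanish, and
   take the function which is c(b gamma) on the component b gamma, for b in the
   group generated by the translations, and 0 on the other components. It is well
   defined since a translation preserving the component is multiplication by an
   element of the connected archimedean group, hence does not change c(gamma). *)
From HB Require Import structures.
Require Import Defs.
From mathcomp Require Import all_boot all_order all_algebra all_field.
From mathcomp Require Import complex freeg.
From mathcomp Require Import all_classical all_reals topology normedtype.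
From mathcomp Require Import exp.
From mathcomp Require Import ring lra zify.
Set Implicit Arguments.
Unset Strict Implicit.
Unset Printing Implicit Defensive.
Import Order.TTheory GRing.Theory Num.Theory.
Import numFieldNormedType.Exports.
Local Open Scope classical_set_scope.
Local Open Scope ring_scope.
Local Open Scope quotient_scope.

(** * Integral functionals on lattices *)

(** A winding number that is only nonzero could vanish modulo p, so the functional must take the
    value 1 on the logarithms of E(N), not merely integral values. Discreteness of these logarithms
    rests on E(N) consisting of algebraic integers, whereas its elements are described by conditions
    at abstract discrete valuations. The bridge is that a non-integral element of F is negative at
    some valuation, obtained from a maximal subring given by Zorn's lemma. The components of Y(N)
    are never identified with tori: it suffices that the archimedean units act continuously and that
    the cosets of their identity component are open and closed. The map theta is handled as a real
    function continuous modulo integers; its lifts over simplices yield an integral cocycle. Derived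
    operators come from inhomogeneous group cocycles, so the reduction to translations runs through
    the filtration of cohomology by degree; the scalar by which an operator acts on eigenvectors
    depends only on the eigenvalues of the translations, and is therefore the same in both degrees.
    Over k, nonvanishing of a tensor is tested by functionals with values in F_p. *)

(** Each interval (-B, B) is cut into K pieces of length 2B/K, which gives K^m boxes, so two of the
    points share a box. The conclusion is multiplied by K to avoid a division. *)
Lemma pigeonhole_box (R : archiRealFieldType) (T : finType) (m K : nat)
    (f : 'I_m -> T -> R) (B : R) :
  (0 < K)%N -> 0 < B -> (forall i t, `|f i t| < B) -> (K ^ m < #|T|)%N ->
  exists x y, x != y /\ forall i, `|f i x - f i y| * K%:R <= B * 2.
Proof.
move=> K0 B0 fB KT.
pose u i t := (f i t + B) * K%:R / (B * 2).
have B2 : 0 < B * 2 by rewrite mulr_gt0.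
have u0 i t : 0 <= u i t.
  rewrite /u divr_ge0 ?mulr_ge0 ?ler0n ?ltW //.
  by have := fB i t; rewrite ltr_norml => /andP[h _]; lra.
have uK i t : u i t < K%:R.
  rewrite /u ltr_pdivrMr // mulrC ltr_pM2l ?ltr0n //.
  by have := fB i t; rewrite ltr_norml => /andP[_ h]; lra.
have tK i t : (Num.truncn (u i t) < K)%N.
  by rewrite -(ltr_nat R); apply: le_lt_trans (uK i t); rewrite Num.Theory.truncn_le.
pose c t : {ffun 'I_m -> 'I_K} := [ffun i => Ordinal (tK i t)].
have [x [y [xy cxy]]] : exists x y, x != y /\ c x = c y.
  apply: contrapT => h; have : (#|T| <= #|{ffun 'I_m -> 'I_K}|)%N.
    apply: (@leq_card _ _ c) => x y cxy; apply: contrapT => /eqP xy.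
    by apply: h; exists x, y.
  by rewrite card_ffun !card_ord leqNgt KT.
exists x, y; split=> // i; have /ffunP/(_ i) := cxy.
rewrite !ffunE => -[e].
have /andP[h1 h2] := truncn_itv (u0 i x); have /andP[h3 h4] := truncn_itv (u0 i y).
rewrite e in h1 h2.
have uE t : u i t * (B * 2) = (f i t + B) * K%:R by rewrite divfK ?gt_eqF.
have dE : (f i x - f i y) * K%:R = (u i x - u i y) * (B * 2).
  by rewrite [RHS]mulrBl !uE; ring.
rewrite -(ger0_norm (ler0n R K)) -normrM dE normrM (gtr0_norm B2) ler_piMl ?ltW //.
rewrite -natr1 in h2; rewrite -natr1 in h4.
by rewrite ltr_norml; apply/andP; split; lra.
Qed.

Section IntegralFunctional.
Variables (R : archiRealFieldType) (n : nat) (L : set 'rV[R]_n).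
Hypotheses (L0 : L 0) (LB : forall x y, L x -> L y -> L (x - y)).
Hypothesis L_discrete : forall B : R, exists M : nat, forall x : 'I_M.+1 -> 'rV[R]_n,
  (forall i, L (x i) /\ forall j, `|x i 0 j| <= B) -> ~ injective x.

Let LN x : L x -> L (- x).
Proof. by move=> Lx; rewrite -sub0r; exact: LB. Qed.

Let LD x y : L x -> L y -> L (x + y).
Proof. by move=> Lx /LN Ly; rewrite -[y]opprK; exact: LB. Qed.

Let LMn x m : L x -> L (x *+ m).
Proof. by move=> Lx; elim: m => [|m IH]; rewrite ?mulr0n // mulrS; exact: LD. Qed.

Let LMz x (m : int) : L x -> L (m%:~R *: x).
Proof.
move=> Lx; case: m => m; first by rewrite -pmulrn scaler_nat; exact: LMn.
by rewrite NegzE mulrNz scaleNr -pmulrn scaler_nat; apply/LN/LMn.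
Qed.

Let Lsum (I : finType) (x : I -> 'rV[R]_n) : (forall i, L (x i)) -> L (\sum_i x i).
Proof. by move=> Lx; elim/big_ind: _. Qed.

(** The functional is the first coordinate with respect to a maximal independent family in L. For y
    in L, the multiples ky with k at most M, reduced modulo integral combinations of the family,
    stay in a bounded box; by discreteness two of them agree, so the coordinate of y has a
    denominator at most M, and M! serves as q. *)
Lemma integral_span x : L x -> x != 0 ->
  exists2 l : 'cV[R]_n, (exists2 y, L y & (y *m l) 0 0 != 0) &
    exists2 q : nat, (0 < q)%N & forall y, L y -> exists m : int,
      q%:R * (y *m l) 0 0 = m%:~R.
Proof.
move=> Lx x0.
pose P r := `[< exists A : 'M[R]_(r, n), row_free A /\ forall i, L (row i A) >].
have P1 : P 1%N.
  apply/asboolP; exists x; split; last by move=> i; rewrite (ord1 i) row_id.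
  by rewrite -row_leq_rank lt0n mxrank_eq0.
have Pn r : P r -> (r <= n)%N.
  by move=> /asboolP[A [/eqP + _]] => {1}<-; exact: rank_leq_col.
case: (ex_maxnP (ex_intro P _ P1) Pn) => -[|r] Pr rmax; first by have := rmax _ P1.
have /asboolP[A [Af LA]] := Pr; pose c := pinvmx A.
have Ac : A *m c = 1%:M by exact: mulmxVp.
(* If y were outside the row space of A, appending it would contradict the maximality of r; hence c
   computes the coordinates of every lattice vector. *)
have cA y : L y -> y *m c *m A = y.
  move=> Ly; apply: mulmxKpV; apply/negPn/negP => yA.
  have : P (r.+1 + 1)%N.
    apply/asboolP; exists (col_mx A y); split.
      rewrite -row_leq_rank -addsmxE addn1 -[X in (X < _)%N](eqP Af).
      rewrite ltn_neqAle mxrankS ?addsmxSl // andbT.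
      apply: contraNneq yA => /esym; move=> e.
      have : (A + y <= A)%MS by rewrite -(geq_leqif (mxrank_leqif_sup (addsmxSl A y))) e.
      by rewrite addsmx_sub => /andP[].
    move=> i; rewrite -(fintype.splitK i); case: (fintype.split i) => j /=.
      by rewrite rowKu.
    by rewrite rowKd (ord1 j) row_id.
  by move=> /rmax; rewrite addn1 ltnn.
exists (col 0 c).
  exists (row 0 A); first exact: LA.
  by rewrite -row_mul colE mulmxA Ac mul1mx !mxE eqxx oner_eq0.
pose B := \sum_i \sum_j `|A i j|.
have [M hM] := L_discrete B; exists M`!; first exact: fact_gt0.
move=> y Ly; pose t := y *m c.
have t0E : (y *m col 0 c) 0 0 = t 0 0 by rewrite colE mulmxA -colE mxE.
rewrite t0E.
pose fl k i := Num.floor (k%:R * t 0 i).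
pose z (k : 'I_M.+1) := y *+ k - \sum_i (fl k i)%:~R *: row i A.
have yE : y = \sum_i t 0 i *: row i A by rewrite -{1}(cA _ Ly) mulmx_sum_row.
have zE k : z k = \sum_i (k%:R * t 0 i - (fl k i)%:~R) *: row i A.
  rewrite /z {1}yE -sumrMnl -sumrB; apply: eq_bigr => i _.
  by rewrite scalerBl mulr_natl scalerMnl.
have /contrapT : ~ ~ exists i j : 'I_M.+1, i != j /\ z i = z j.
  move=> h; apply: (hM z) => [k|i j zij]; last first.
    by apply: contrapT => /eqP ij; apply: h; exists i, j.
  split=> [|j].
    apply: LB; first exact: LMn.
    by apply: Lsum => i; exact: LMz.
  rewrite zE summxE; apply: le_trans (ler_norm_sum _ _ _) _.
  apply: ler_sum => i _; rewrite mxE [row i A 0 j]mxE normrM.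
  apply: (@le_trans _ _ `|A i j|); last first.
    by rewrite (bigD1 j) //= lerDl sumr_ge0.
  have /andP[f1 f2] := Num.Theory.floor_itv (k%:R * t 0 i).
  rewrite intrD in f2.
  by rewrite ler_piMl // ler_norml; apply/andP; split; lra.
move=> [i [j [ij zij]]].
wlog {ij} ij : i j zij / (i < j)%N.
  move=> w; case: (ltngtP i j) => [|ji|/val_inj e]; first exact: w.
    by apply: (w j i).
  by rewrite e eqxx in ij.
have zcE k : (z k *m c) 0 0 = k%:R * t 0 0 - (fl k 0)%:~R.
  have dE a i0 : (a *: row i0 A *m c) 0 0 = a * (i0 == 0)%:R.
    by rewrite -scalemxAl -row_mul Ac mxE [in LHS]mxE [in LHS]mxE.
  rewrite zE mulmx_suml summxE (bigD1 0) //= dE mulr1 big1 ?addr0 //.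
  by move=> i0 /negPf i00; rewrite dE i00 mulr0.
have e : i%:R * t 0 0 - (fl i 0)%:~R = j%:R * t 0 0 - (fl j 0)%:~R.
  by rewrite -!zcE zij.
have jiM : (j - i %| M`!)%N.
  by apply: dvdn_fact; rewrite subn_gt0 ij /= (leq_trans (leq_subr _ _)) // -ltnS.
exists ((M`! %/ (j - i))%:Z * (fl j 0 - fl i 0)).
rewrite -{1}(divnK jiM) natrM -mulrA intrM -pmulrn; congr (_ * _).
rewrite natrB ?(ltnW ij) // intrB mulrBl.
by apply/eqP; rewrite subr_eq addrAC eq_sym subr_eq; apply/eqP; move: e; lra.
Qed.

(** The least positive integer g among the values of an integral functional divides all the others,
    by Euclidean division; dividing the functional by g makes 1 a value. *)
Lemma integral_functional x : L x -> x != 0 ->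
  exists2 l : 'cV[R]_n, (exists2 y, L y & (y *m l) 0 0 = 1) &
    forall y, L y -> exists m : int, (y *m l) 0 0 = m%:~R.
Proof.
move=> Lx x0; have [l1 [y1 Ly1 y1l] [q q0 hq]] := integral_span Lx x0.
pose l := q%:R *: l1.
have lE y : (y *m l) 0 0 = q%:R * (y *m l1) 0 0 by rewrite -scalemxAr mxE.
have hl y : L y -> exists m : int, (y *m l) 0 0 = m%:~R.
  by move=> /hq[m hm]; exists m; rewrite lE.
pose P k := `[< (0 < k)%N /\ exists2 y, L y & (y *m l) 0 0 = k%:R >].
have exP : exists k, P k.
  have [m hm] := hl _ Ly1.
  have m0 : m != 0.
    by rewrite -(intr_eq0 R) -hm lE mulf_neq0 // pnatr_eq0 -lt0n.
  exists `|m|%N; apply/asboolP; split; first by rewrite absz_gt0.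
  case: (lerP 0 m) => m00.
    by exists y1 => //; rewrite hm pmulrn gez0_abs.
  exists (- y1); first exact: LN.
  by rewrite mulNmx mxE hm pmulrn ltz0_abs // mulrNz.
case: (ex_minnP exP) => g /asboolP[g0 [y Ly yg]] gmin.
have g0' : g%:R != 0 :> R by rewrite pnatr_eq0 -lt0n.
exists (g%:R^-1 *: l).
  by exists y => //; rewrite -scalemxAr mxE yg mulVf.
move=> w Lw; have [m hm] := hl _ Lw.
have := divz_eq m g; set a := (m %/ g)%Z; set b := (m %% g)%Z => mE.
have b0 : 0 <= b by rewrite modz_ge0 // -lt0n.
have bg : b < g by rewrite ltz_pmod // ltz_nat.
have Lb : L (w - a%:~R *: y) by apply: LB => //; exact: LMz.
have bE : ((w - a%:~R *: y) *m l) 0 0 = b%:~R.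
  rewrite mulmxBl -scalemxAl [LHS]mxE [X in _ + X]mxE [X in _ - X]mxE hm yg.
  by rewrite {1}mE intrD intrM -pmulrn addrC addKr.
have b00 : b = 0.
  apply/eqP; rewrite eq_le b0 andbT leNgt; apply/negP => bp.
  have /gmin : P `|b|%N.
    apply/asboolP; split; first by rewrite absz_gt0 gt_eqF.
    by exists (w - a%:~R *: y) => //; rewrite bE pmulrn gez0_abs.
  by rewrite leqNgt -ltz_nat gez0_abs // bg.
exists a; rewrite -scalemxAr mxE hm mE b00 addr0 intrM -pmulrn.
by rewrite mulrC mulfK.
Qed.
End IntegralFunctional.

(** * Complex embeddings *)

Section NumberFieldEmbeddings.
Variables (R : realType) (F : fieldExtType rat).
Local Notation C := (complex_of R).
Local Notation evF q x := (map_poly (in_alg F) q).[x].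
Local Notation pZtoQ := (map_poly (intr : int -> rat)).

Lemma intr_fieldext_inj : injective (intr : int -> F).
Proof.
move=> i j; rewrite -!(rmorph_int (in_alg F)) => /fmorph_inj; exact: intr_inj.
Qed.

Lemma integral_multiple (x : F) : exists2 m : int, m != 0 & ring_of_integers (m%:~R * x).
Proof.
have [p [p0 px]] : exists p : {poly rat}, p != 0 /\ root (map_poly (in_alg F) p) x.
  have /polyOver1P[p pE] := minPolyOver (1%AS : {subfield F}) x.
  exists p; split; last by rewrite -pE root_minPoly.
  by rewrite -(map_poly_eq0 (in_alg F)) -pE monic_neq0 ?monic_minPoly.
have [P [b b0 pE]] := rat_poly_scale p.
have PE : pZtoQ P = b%:~R *: p by rewrite pE scalerA divff ?scale1r // intr_eq0.
have Px : \sum_(i < size P) (P`_i)%:~R * x ^+ i = 0.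
  have : (map_poly (in_alg F) (pZtoQ P)).[x] = 0.
    by rewrite PE linearZ hornerZ (eqP px) mulr0.
  rewrite -map_poly_comp (eq_map_poly (g := intr)); last first.
    by move=> i; exact: (rmorph_int (in_alg F)).
  rewrite horner_coef size_map_inj_poly ?rmorph0 //; last exact: intr_fieldext_inj.
  by move=> h; rewrite -[RHS]h; apply: eq_bigr => i _; rewrite coef_map.
have P0 : P != 0.
  have : pZtoQ P != 0 by rewrite PE scale_poly_eq0 negb_or intr_eq0 b0 p0.
  by apply: contraNneq => ->; rewrite rmorph0.
pose a := lead_coef P; pose d := (size P).-1.
have sP : size P = d.+1 by rewrite prednK // lt0n size_poly_eq0.
exists a; first by rewrite lead_coef_eq0.
(* This is a^(d-1) P(X/a), where a is the leading coefficient of P and d its degree: a monic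
   integral polynomial with root a x. *)
pose q := \poly_(i < d.+1) (if i == d then 1 else P`_i * a ^+ (d - i).-1).
have sq : size q = d.+1 by rewrite size_poly_eq // eqxx oner_neq0.
exists q.
  by rewrite monicE lead_coefE sq coef_poly ltnSn eqxx.
have [d0|d0] := posnP d.
  move: Px; rewrite sP d0 big_ord1 expr0 mulr1 -[RHS](mulr0z 1).
  move=> /intr_fieldext_inj/eqP P00; exfalso.
  by move: P0; rewrite -lead_coef_eq0 lead_coefE -/d d0 P00.
apply/eqP; rewrite horner_coef size_map_inj_poly ?rmorph0 //; last exact: intr_fieldext_inj.
transitivity (a%:~R ^+ d.-1 * \sum_(i < size P) (P`_i)%:~R * x ^+ i); last first.
  by rewrite Px mulr0.
rewrite sq sP mulr_sumr; apply: eq_bigr => i _.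
rewrite coef_map coef_poly ltn_ord; case: eqP => [->|/eqP id].
  rewrite mul1r exprMn mulrA; congr (_ * _).
  by rewrite -{1}(prednK d0) exprSr /a lead_coefE.
have {}id : (i < d)%N by rewrite ltn_neqAle id -ltnS ltn_ord.
rewrite [X in X * _]/= intrM rmorphXn exprMn /= -mulrA [RHS]mulrCA; congr (_ * _).
rewrite mulrA -exprD; congr (_ ^+ _ * _); lia.
Qed.

(** A generator given by the primitive element theorem is multiplied by a nonzero integer to become
    integral, which does not change the field that it generates; [p] is its minimal polynomial. *)
Lemma primitive_integer : exists (th : F) (p : {poly rat}),
  [/\ ring_of_integers th, p \is monic, size p = (\dim {:F}).+1 & separable_poly p] /\
  [/\ evF p th = 0, (forall q, evF q th = 0 -> p %| q) &
      forall x, exists q, evF q th = x].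
Proof.
have pch : [pchar F] =i pred0 by move=> q; rewrite pchar_lalg pchar_num.
pose th0 := separable_generator 1%AS ({:F}%AS : {subfield F}).
have full0 : <<1; th0>>%VS = {:F}%VS.
  apply/esym; apply: eq_adjoin_separable_generator; last exact: sub1v.
  by apply/separableP => y _; exact: pcharf0_separable.
have [m m0 mth] := integral_multiple th0.
pose th := m%:~R * th0.
have full : <<1; th>>%VS = {:F}%VS.
  apply/eqP; rewrite eqEsubv subvf /= -full0 sub_adjoin1v.
  have -> : th0 = (m%:~R : rat)^-1 *: th.
    rewrite /th -(rmorph_int (in_alg F)) /= mulr_algl scalerA mulVf ?scale1r //.
    by rewrite intr_eq0.
  by apply: memvZ; exact: memv_adjoin.
have /polyOver1P[p pE] := minPolyOver (1%AS : {subfield F}) th.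
exists th, p; split; split=> //.
- by rewrite -(map_monic (in_alg F)) -pE monic_minPoly.
- rewrite -(size_map_poly (in_alg F)) -pE size_minPoly; congr _.+1.
  by have := dim_Fadjoin 1%AS th; rewrite full dimv1 muln1 => ->.
- rewrite -(separable_map (in_alg F)) -pE; exact: pcharf0_separable.
- by rewrite -pE; apply/eqP; rewrite -/(root _ _) root_minPoly.
- move=> q q0; rewrite -(dvdp_map (in_alg F)) -pE; apply: minPoly_dvdp.
    by apply/polyOver1P; exists q.
  by rewrite /root q0.
- move=> x; have : x \in <<1%AS; th>>%VS by rewrite full memvf.
  by move=> /Fadjoin_polyP[_ /polyOver1P[q ->] ->]; exists q.
Qed.

(** Since F is Q[X]/(p), the value at r does not depend on the polynomial chosen to represent an
    element of F. *)
Lemma root_embedding (th : F) (p : {poly rat}) (r : C) :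
  (forall q, evF q th = 0 -> p %| q) -> (forall x, exists q, evF q th = x) ->
  root (map_poly ratr p) r ->
  exists s : embedding R F, forall q, s (evF q th) = (map_poly ratr q).[r].
Proof.
move=> pmin pgen pr.
have wd q q' : evF q th = evF q' th -> (map_poly ratr q).[r] = (map_poly ratr q').[r] :> C.
  move=> e; apply/eqP; rewrite -subr_eq0 -hornerN -hornerD -rmorphB.
  have /pmin /dvdpP[u ->] : evF (q - q') th = 0.
    by rewrite rmorphB hornerD hornerN e subrr.
  by rewrite rmorphM hornerM (eqP pr) mulr0.
pose g x := projT1 (cid (pgen x)).
have gE x : evF (g x) th = x by rewrite /g; case: cid.
pose s x : C := (map_poly ratr (g x)).[r].
have sE q : s (evF q th) = (map_poly ratr q).[r] by apply: wd; rewrite gE.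
have sB : zmod_morphism s.
  move=> x y; rewrite -{1}[x]gE -{1}[y]gE -hornerN -hornerD -rmorphB sE.
  by rewrite rmorphB hornerD hornerN.
have sM : monoid_morphism s.
  split.
    by have := sE 1; rewrite !rmorph1 !hornerC.
  by move=> x y; rewrite -{1}[x]gE -{1}[y]gE -hornerM -rmorphM sE rmorphM hornerM.
pose s' : {rmorphism F -> C} := HB.pack s
  (GRing.isZmodMorphism.Build F C s sB) (GRing.isMonoidMorphism.Build F C s sM).
by exists s'.
Qed.

Local Notation n := (\dim {:F}).

(** The basis consists of the powers of an integral primitive element, so the matrix of conjugates
    is a Vandermonde matrix on the distinct roots of the minimal polynomial. Embeddings are records,
    so the list is complete up to pointwise equality. *)
Lemma embeddings_basis : exists (s : 'I_n -> embedding R F) (w : 'I_n -> F),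
  [/\ (forall j, ring_of_integers (w j)),
      (\matrix_(j, i) s i (w j) : 'M[C]_n) \in unitmx,
      (forall x, exists q : 'I_n -> rat, x = \sum_j q j *: w j),
      (forall t : embedding R F, exists i, t =1 s i) &
      injective (fun i x => s i x)].
Proof.
have [th [p [[Oth pm sp psep] [pth pmin pgen]]]] := primitive_integer.
have [rs rsE] := closed_field_poly_normal (map_poly ratr p : {poly C}).
rewrite lead_coef_map (monicP pm) rmorph1 scale1r in rsE.
have srs : size rs = n.
  by have := congr1 (fun q : {poly C} => size q) rsE; rewrite size_map_poly sp size_prod_XsubC => -[].
have urs : uniq rs by rewrite -separable_prod_XsubC -rsE separable_map.
have rsP r : (r \in rs) = root (map_poly ratr p) r by rewrite rsE root_prod_XsubC.
have /choice[s sE] : forall i : 'I_n, exists s : embedding R F,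
    forall q, s (evF q th) = (map_poly ratr q).[rs`_i].
  move=> i; apply: root_embedding pmin pgen _.
  by rewrite -rsP mem_nth // srs.
have sth i : s i th = rs`_i.
  by have := sE i 'X; rewrite !map_polyX !hornerX.
have inj : injective (fun (i : 'I_n) => rs`_i).
  move=> i j /= e; apply/val_inj; have /uniqP := urs; move/(_ 0 i j); apply=> //=.
    by rewrite inE srs.
  by rewrite inE srs.
exists s, (fun j => th ^+ j); split.
- move=> j; elim: (val j) => [|k IH]; rewrite ?expr0 ?exprS; first exact: integral1.
  exact: integral_mul.
- have -> : (\matrix_(j, i) s i (th ^+ j) : 'M[C]_n) =
      Vandermonde n (\row_(i < n) rs`_i).
    by apply/matrixP => j i; rewrite !mxE rmorphXn /= sth.
  rewrite unitmxE det_Vandermonde unitfE; apply/prodf_neq0 => i _.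
  apply/prodf_neq0 => j ij; rewrite !mxE subr_eq0; apply/eqP => /inj e.
  by rewrite e ltnn in ij.
- move=> x; have [q qE] := pgen x.
  exists (fun j => (q %% p)`_j).
  have sq : (size (q %% p)%R <= n)%N by rewrite -ltnS -sp ltn_modp monic_neq0.
  rewrite -qE {1}(divp_eq q p) rmorphD rmorphM hornerD hornerM pth mulr0 add0r.
  rewrite (horner_coef_wide _ (n := n)) ?size_map_poly //.
  by apply: eq_bigr => j _; rewrite coef_map /= mulr_algl.
- move=> t; have : root (map_poly ratr p) (t th).
    have -> : map_poly ratr p = map_poly (t \o in_alg F) p :> {poly C}.
      by apply: eq_map_poly => a /=; rewrite -[_%:A]/(in_alg F a) -(fmorph_eq_rat (t \o in_alg F)).
    by rewrite map_poly_comp /root horner_map pth rmorph0.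
  rewrite -rsP; case/(nthP (0 : C)) => i; rewrite srs => ilt iE; exists (Ordinal ilt) => x.
  have [q <-] := pgen x; rewrite sE /= iE -horner_map -map_poly_comp.
  by congr (_.[_]); apply: eq_map_poly => a; rewrite /= -(fmorph_eq_rat (t \o in_alg F)).
- by move=> i j /(congr1 (fun f => f th)); rewrite !sth => /inj.
Qed.
End NumberFieldEmbeddings.

(** * Units of infinite order *)

(** The integral equation descends to Q and is carried over to [algC], where rational algebraic
    integers are known to be integers. *)
Lemma rat_integral (K : numFieldType) (q : rat) :
  integralOver (intr : int -> K) (ratr q) -> exists z : int, q = z%:~R.
Proof.
move=> [p pm pq].
have e (L : numFieldType) : map_poly (intr : int -> L) p = map_poly ratr (map_poly (intr : int -> rat) p).
  by rewrite -map_poly_comp; apply: eq_map_poly => i /=; rewrite ratr_int.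
rewrite e fmorph_root in pq.
have : ratr q \in (Num.int : {pred algC}).
  apply: Cint_rat_Aint; first exact: Crat_rat.
  apply: (root_monic_Aint (p := map_poly intr p)).
  - by rewrite e fmorph_root.
  - by rewrite monic_map.
  - by apply/polyOverP => i; rewrite coef_map /= intr_int.
move=> /intrP[z zE]; exists z.
apply: (fmorph_inj (ratr : {rmorphism rat -> algC})); rewrite [LHS]zE.
by apply/esym; exact: (ratr_int algC).
Qed.

Lemma integral_rmorphE (F K : fieldType) (s : {rmorphism F -> K}) (x : F) :
  integralOver (intr : int -> F) x <-> integralOver (intr : int -> K) (s x).
Proof.
have e (p : {poly int}) : map_poly (intr : int -> K) p = map_poly s (map_poly (intr : int -> F) p).
  by rewrite -map_poly_comp; apply: eq_map_poly => i; rewrite /= rmorph_int.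
by split=> -[p pm px]; exists p => //; move: px; rewrite e fmorph_root.
Qed.

Section ComplexAbs.
Variable R : realType.
Local Notation C := (complex_of R).

(** The norm of [complex_of R] takes values in the complex field itself; this version is
    real-valued, so that bounds and logarithms can be taken in R. *)
Definition cabs (z : C) : R := Normc.normc z.

Lemma cabsE (z : C) : `|z| = (cabs z)%:C%C.
Proof. by case: z => a b; rewrite normc_def. Qed.

Lemma cabsM x y : cabs (x * y) = cabs x * cabs y. Proof. exact: Normc.normcM. Qed.
Lemma cabs1 : cabs 1 = 1. Proof. exact: Normc.normc1. Qed.
Lemma cabsV x : cabs x^-1 = (cabs x)^-1. Proof. exact: Normc.normcV. Qed.
Lemma cabsD x y : cabs (x + y) <= cabs x + cabs y. Proof. exact: le_normcD. Qed.
Lemma cabsN x : cabs (- x) = cabs x. Proof. exact: normcN. Qed.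
Lemma cabs_ge0 x : 0 <= cabs x.
Proof. by case: x => a b; exact: sqrtr_ge0. Qed.
Lemma cabs_eq0 x : (cabs x == 0) = (x == 0).
Proof.
apply/eqP/eqP => [/Normc.eq0_normc //|->]; exact: Normc.normc0.
Qed.
Lemma cabs_gt0 x : (0 < cabs x) = (x != 0).
Proof. by rewrite lt_neqAle cabs_ge0 andbT eq_sym cabs_eq0. Qed.
Lemma cabsJ x : cabs x^* = cabs x.
Proof. by case: x => a b; rewrite /cabs /= sqrrN. Qed.
Lemma cabs_prod (I : Type) (r : seq I) (P : pred I) (f : I -> C) :
  cabs (\prod_(i <- r | P i) f i) = \prod_(i <- r | P i) cabs (f i).
Proof. exact: (big_morph cabs cabsM cabs1). Qed.
Lemma cabs_sum (I : Type) (r : seq I) (P : pred I) (f : I -> C) :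
  cabs (\sum_(i <- r | P i) f i) <= \sum_(i <- r | P i) cabs (f i).
Proof.
elim/big_ind2: _ => [|x1 x2 y1 y2 h1 h2|//].
  by have /eqP -> : cabs 0 == 0 by rewrite cabs_eq0.
by apply: le_trans (cabsD _ _) _; exact: lerD.
Qed.
Lemma cabs_int (z : int) : cabs z%:~R = `|z|%:~R.
Proof.
apply: (complexI (R := R)); rewrite -cabsE; rewrite -(ger0_norm (normr_ge0 z)).
by rewrite -!intr_norm normr_id rmorph_int.
Qed.
Lemma cabs_ge_Re (x : C) : `|complex.Re x| <= cabs x.
Proof. by have := normc_ge_Re x; rewrite cabsE lecR. Qed.
Lemma cabs_ge_Im (x : C) : `|complex.Im x| <= cabs x.
Proof.
case: x => a b /=; rewrite /cabs /= -(sqrtr_sqr b) ler_wsqrtr // lerDr sqr_ge0 //.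
Qed.
Lemma cabs_le_ReIm (x : C) : cabs x <= `|complex.Re x| + `|complex.Im x|.
Proof.
case: x => a b /=; rewrite /cabs /= -[leRHS]ger0_norm ?addr_ge0 // -sqrtr_sqr.
rewrite ler_wsqrtr // sqrrD !real_normK ?num_real // lerD2r lerDl.
by rewrite mulrn_wge0 // mulr_ge0.
Qed.
End ComplexAbs.

(** * Norms, integers of bounded size and a unit of infinite order *)

Section Units.
Variables (R : realType) (F : fieldExtType rat).
Local Notation C := (complex_of R).
Local Notation n := (\dim {:F}).
Variables (s : 'I_n -> embedding R F) (w : 'I_n -> F).
Hypotheses (w_int : forall j, ring_of_integers (w j))
  (sw_unit : (\matrix_(j, i) s i (w j) : 'M[C]_n) \in unitmx)
  (w_span : forall x, exists q : 'I_n -> rat, x = \sum_j q j *: w j)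
  (s_all : forall t : embedding R F, exists i, t =1 s i)
  (s_inj : injective (fun i x => s i x)).

Let emb_scale (t : embedding R F) (q : rat) x : t (q *: x) = ratr q * t x.
Proof.
by rewrite -mulr_algl rmorphM; congr (_ * _); exact: (fmorph_eq_rat (t \o in_alg F)).
Qed.

Let dim_gt0 : (0 < n)%N.
Proof.
by rewrite lt0n dimv_eq0 -subv0; apply/negP => /subvP/(_ 1 (memvf _)); rewrite memv0 oner_eq0.
Qed.

(** The product of the conjugates is the determinant of multiplication by x in the rational basis w,
    because the matrix of conjugates diagonalises this multiplication. *)
Lemma norm_rat x : exists q : rat, \prod_i s i x = ratr q.
Proof.
have /choice[M ME] : forall j, exists q : 'I_n -> rat, x * w j = \sum_k q k *: w k.
  by move=> j; exact: w_span.
pose Mm := \matrix_(j, k) M j k : 'M[rat]_n.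
pose V := \matrix_(j, i) s i (w j) : 'M[C]_n.
exists (\det Mm).
have : map_mx ratr Mm *m V = V *m diag_mx (\row_i s i x).
  apply/matrixP => j i; rewrite mul_mx_diag !mxE mulrC -rmorphM ME rmorph_sum.
  by apply: eq_bigr => k _; rewrite !mxE emb_scale.
move=> /(congr1 determinant); rewrite !det_mulmx det_diag mulrC => /mulrI.
rewrite -det_map_mx; move/(_ _); rewrite -unitmxE => /(_ sw_unit) ->.
by apply: eq_bigr => i _; rewrite mxE.
Qed.

Lemma norm_int x : ring_of_integers x -> exists z : int, \prod_i s i x = z%:~R.
Proof.
move=> Ox; have [q qE] := norm_rat x.
have [z zE] : exists z : int, q = z%:~R.
  apply: (@rat_integral C); rewrite -qE; elim/big_ind: _ => [|a b|i _].
  - exact: integral1.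
  - exact: integral_mul.
  - exact: (proj1 (integral_rmorphE (s i) x) Ox).
by exists z; rewrite qE zE ratr_int.
Qed.

Lemma norm_ge1 x : ring_of_integers x -> x != 0 -> 1 <= \prod_i cabs (s i x).
Proof.
move=> Ox x0; have [z zE] := norm_int Ox.
rewrite -cabs_prod zE cabs_int -[1]/(1%:~R) ler_int -gtz0_ge1 normr_gt0.
rewrite -(intr_eq0 C) -zE; apply/prodf_neq0 => i _; by rewrite fmorph_eq0.
Qed.

(** Under one embedding the norm divided by x becomes the product of the other conjugates of x,
    which are integral. *)
Lemma norm_quotient x (z : int) : ring_of_integers x -> x != 0 ->
  \prod_i s i x = z%:~R -> ring_of_integers (z%:~R / x).
Proof.
move=> Ox x0 zE; pose i0 := Ordinal dim_gt0; apply: (proj2 (integral_rmorphE (s i0) _)).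
rewrite fmorph_div rmorph_int -zE (bigD1 i0) //= mulrAC divff ?fmorph_eq0 // mul1r.
elim/big_ind: _ => [|a b|i _].
- exact: integral1.
- exact: integral_mul.
- exact: (proj1 (integral_rmorphE (s i) x) Ox).
Qed.

Lemma conj_index : exists c : 'I_n -> 'I_n, forall i x, s (c i) x = (s i x)^*.
Proof.
have /choice[c cE] : forall i, exists j, forall x, s j x = (s i x)^*.
  move=> i; have [j jE] := s_all (Num.conj \o s i : {rmorphism F -> C}).
  by exists j => x; rewrite -jE.
by exists c.
Qed.

(** Two elements with nearly equal conjugates have a difference all of whose conjugates are smaller
    than 1, hence of norm smaller than 1, which is impossible for a nonzero integer. *)
Lemma bounded_integers (B : R) : exists M : nat, forall x : 'I_M.+1 -> F,
  (forall k, ring_of_integers (x k) /\ forall i, cabs (s i (x k)) <= B) ->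
  ~ injective x.
Proof.
pose B' := `|B| + 1.
have B'0 : 0 < B' by rewrite ltr_wpDl.
(* The box principle bounds the real and the imaginary part of each conjugate of the difference by
   2B'/K, so each conjugate is at most 4B'/K < 1. *)
pose K := (Num.truncn (4 * B')).+1.
have KB : 4 * B' < K%:R by rewrite truncnS_gt.
exists (K ^ (n + n))%N => x xP xinj.
pose f (i : 'I_(n + n)) k := match fintype.split i with
  | inl j => complex.Re (s j (x k)) | inr j => complex.Im (s j (x k)) end.
have fB i k : `|f i k| < B'.
  rewrite /f; have BB : B < B' by rewrite (le_lt_trans (ler_norm B)) // ltrDl.
  case: (fintype.split i) => j; apply: le_lt_trans (BB);
    apply: le_trans ((xP k).2 j); [exact: cabs_ge_Re|exact: cabs_ge_Im].
have [] := @pigeonhole_box R 'I_(K ^ (n + n)).+1 (n + n) K f B' isT B'0 fB.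
  by rewrite card_ord.
move=> k [l [kl h]]; pose y := x k - x l.
have y0 : y != 0 by rewrite subr_eq0 (inj_eq xinj).
have Oy : ring_of_integers y by apply: integral_sub; [have [] := xP k|have [] := xP l].
have := norm_ge1 Oy y0; apply/negP; rewrite -ltNge.
have small i : cabs (s i y) < 1.
  have hr := h (lshift n i); have hi := h (rshift n i).
  rewrite /f /= (unsplitK (inl i)) in hr; rewrite /f /= (unsplitK (inr i)) in hi.
  have K0 : 0 < K%:R :> R by rewrite ltr0n.
  rewrite -(ltr_pM2r K0) mul1r; apply: le_lt_trans KB.
  apply: le_trans (_ : (`|complex.Re (s i y)| + `|complex.Im (s i y)|) * K%:R <= _).
    by rewrite ler_wpM2r ?cabs_le_ReIm // ltW.
  rewrite /y rmorphB !raddfB mulrDl /=.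
  lra.
rewrite (bigD1 (Ordinal dim_gt0)) //=.
apply: le_lt_trans (small (Ordinal dim_gt0)); rewrite ler_piMr ?cabs_ge0 //.
by apply: prodr_ile1 => i _; rewrite cabs_ge0 ltW.
Qed.

Section SmallElements.
Variables (c : 'I_n -> 'I_n) (i0 i1 : 'I_n).
Hypotheses (cE : forall i x, s (c i) x = (s i x)^*) (i10 : i1 != i0) (i1c : i1 != c i0).

Let cK i : c (c i) = i.
Proof. by apply: s_inj; apply/funext => x; rewrite !cE conjCK. Qed.

Let A : R := 1 + \sum_i \sum_j cabs (s i (w j)).
Let A0 : 0 < A.
Proof. by rewrite ltr_wpDr // sumr_ge0 // => i _; rewrite sumr_ge0 // => j _; exact: cabs_ge0. Qed.

Let combination (a : 'I_n -> int) : F := \sum_j (a j)%:~R * w j.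

Let combination_bound i (a : 'I_n -> int) (B : nat) : (0 < B)%N ->
  (forall j, `|a j| <= B%:Z) -> cabs (s i (combination a)) < A * B%:R.
Proof.
move=> B0 aB; rewrite rmorph_sum; apply: le_lt_trans (cabs_sum _ _ _) _.
apply: le_lt_trans (_ : (\sum_j cabs (s i (w j))) * B%:R < _).
  rewrite mulr_suml; apply: ler_sum => j _.
  rewrite rmorphM rmorph_int cabsM cabs_int mulrC ler_wpM2l ?cabs_ge0 //.
  by rewrite -[B%:R]/(B%:Z%:~R) ler_int.
rewrite ltr_pM2r ?ltr0n // /A.
pose X k := \sum_j cabs (s k (w j)).
have X0 k : 0 <= X k by rewrite sumr_ge0 // => j _; exact: cabs_ge0.
have : X i <= \sum_k X k by rewrite (bigD1 i) //= lerDl sumr_ge0.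
by rewrite /X; lra.
Qed.

Let combination_neq0 (a : 'I_n -> int) j : a j != 0 -> combination a != 0.
Proof.
move=> aj; apply/eqP => a0; move: aj; apply/negP; rewrite negbK.
pose v : 'rV[C]_n := \row_j (a j)%:~R.
have : v *m (\matrix_(j, i) s i (w j)) = 0.
  apply/rowP => i; rewrite !mxE; transitivity (s i (combination a)).
    by rewrite rmorph_sum; apply: eq_bigr => k _; rewrite !mxE rmorphM rmorph_int.
  by rewrite a0 rmorph0.
move=> /(congr1 (mulmx^~ (invmx (\matrix_(j, i) s i (w j))))).
by rewrite mulmxK // mul0mx => /rowP/(_ j); rewrite !mxE => /eqP; rewrite intr_eq0.
Qed.

Let combination_int a : ring_of_integers (combination a).
Proof.
rewrite /combination; elim/big_ind: _ => [|x y|j _].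
- exact: integral0.
- exact: integral_add.
- apply: integral_mul; last exact: w_int.
  exact: (integral_id (intr : {rmorphism int -> F})).
Qed.

(* The free place is i0: the box principle makes all the conjugates away from i0
   and its complex conjugate smaller than 1/q, while the norm remains bounded. *)
Lemma small_integers (e : R) : 0 < e -> exists a : 'I_n -> int,
  [/\ combination a != 0, \prod_i cabs (s i (combination a)) <= (A * 4) ^+ n &
      cabs (s i1 (combination a)) < e].
Proof.
move=> e0; pose S := [pred i : 'I_n | (i != i0) && (i != c i0)].
have ScI i : i \in S -> c i \in S.
  by move=> /andP[h1 h2]; rewrite inE !(can_eq cK) -(inj_eq (can_inj cK)) cK h1 h2.
set d := #|S|.
have dn : (d < n)%N.
  rewrite -[X in (_ < X)%N]card_ord; apply: proper_card; apply/properP; split.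
    exact/fintype.subsetP.
  by exists i0 => //; rewrite inE eqxx.
(* With B = q^d and K = q^n, the coefficient vectors with entries between 0 and B outnumber the K^d
   = B^n boxes. The conjugates at S are then at most 4AB/K <= 4A/q < e, because d < n; the others
   are at most 4AB, so the norm is at most (4A)^n B^n / K^d = (4A)^n. *)
pose q := (Num.truncn (A * 4 / e)).+1.
have qe : A * 4 / e < q%:R by rewrite truncnS_gt.
pose B := (q ^ d)%N; pose K := (q ^ n)%N.
have B0 : (0 < B)%N by rewrite expn_gt0.
have K0 : (0 < K)%N by rewrite expn_gt0.
pose T := {ffun 'I_n -> 'I_B.+1}.
(* Of two conjugate embeddings one contributes its real part and the other its imaginary part; a
   real embedding contributes its real part. Thus S accounts for exactly d real coordinates. *)
pose z (i : 'I_n) (x : C) := if (i <= c i)%N then complex.Re x else complex.Im x.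
pose x (t : T) := combination (fun j => (t j)%:Z).
have xB i t : cabs (s i (x t)) < A * B%:R.
  by apply: combination_bound => // j; rewrite ger0_norm // lez_nat -ltnS.
have [|||t [u [tu h]]] := @pigeonhole_box R T d K
    (fun k t => z (enum_val k) (s (enum_val k) (x t))) (A * B%:R) K0.
- by rewrite mulr_gt0 // ltr0n.
- move=> k t; apply: le_lt_trans (xB (enum_val k) t); rewrite /z.
  by case: ifP => _; [exact: cabs_ge_Re|exact: cabs_ge_Im].
- rewrite card_ffun !card_ord /K -expnM mulnC expnM ltn_exp2r //.
exists (fun j => (t j)%:Z - (u j)%:Z); set y := combination _.
have yE : y = x t - x u.
  by rewrite -sumrB; apply: eq_bigr => j _; rewrite intrB mulrBl.
have K0' : 0 < K%:R :> R by rewrite ltr0n.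
have zE i : i \in S -> `|z i (s i y)| * K%:R <= A * B%:R * 2.
  move=> iS; have := h (enum_rank_in iS i); rewrite enum_rankK_in // yE rmorphB /z.
  by case: ifP => _; rewrite raddfB.
have small i : i \in S -> cabs (s i y) * K%:R <= A * 4 * B%:R.
  move=> iS; apply: le_trans (_ : (`|complex.Re (s i y)| + `|complex.Im (s i y)|) * K%:R <= _).
    by rewrite ler_pM2r // cabs_le_ReIm.
  have h1 := zE i iS; have h2 := zE (c i) (ScI i iS); move: h1 h2.
  rewrite /z cK cE; have ReJ (v : C) : complex.Re v^* = complex.Re v by case: v.
  have ImJ (v : C) : complex.Im v^* = - complex.Im v by case: v.
  rewrite ReJ ImJ; have [ici|ici|ici] := ltngtP i (c i); rewrite ?normrN => h1 h2.
  - by rewrite mulrDl; lra.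
  - by rewrite mulrDl; lra.
  - have ei : c i = i by apply/val_inj.
    have : complex.Im (s i y) = - complex.Im (s i y) by rewrite -ImJ -cE ei.
    move=> /eqP; rewrite -addr_eq0 -mulr2n mulrn_eq0 /= => /eqP ->.
    have AB0 : 0 < A * B%:R by rewrite mulr_gt0 // ltr0n.
    by rewrite normr0 addr0; apply: le_trans h1 _; lra.
have large i : cabs (s i y) <= A * 4 * B%:R.
  apply: le_trans (ltW (combination_bound i B0 _)) _; last first.
    have AB0 : 0 < A * B%:R by rewrite mulr_gt0 // ltr0n.
    lra.
  move=> j; have := ltn_ord (t j); have := ltn_ord (u j); clear; lia.
split.
- have [j tuj] : exists j, t j != u j.
    apply: contrapT => /forallNP e'; move: tu; apply/negP; rewrite negbK.
    by apply/eqP/ffunP => j; apply/eqP/negPn/negP; exact: e'.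
  by apply: (@combination_neq0 _ j); rewrite subr_eq0; apply: contraNneq tuj => -[/val_inj ->].
- have : (\prod_i cabs (s i y)) * K%:R ^+ d <= (A * 4 * B%:R) ^+ n.
    rewrite -prodr_const [X in _ * X]big_mkcond -big_split /=.
    rewrite -[X in _ ^+ X](card_ord n) -prodr_const; apply: ler_prod => i _.
    by case: ifP => [/small ->|_]; rewrite ?mulr1 ?large andbT ?mulr_ge0 ?cabs_ge0 ?ler0n.
  have -> : K%:R ^+ d = B%:R ^+ n :> R.
    by rewrite -!natrX /K /B -!expnM mulnC.
  by rewrite [X in _ <= X]exprMn ler_pM2r // exprn_gt0 // ltr0n.
- have i1S : i1 \in S by rewrite inE i10 i1c.
  rewrite -(ltr_pM2r K0'); apply: le_lt_trans (small _ i1S) _.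
  rewrite /K -(subnK (ltnW dn)) expnD -/B natrM mulrA ltr_pM2r ?ltr0n //.
  rewrite ltr_pdivrMr // in qe; rewrite [e * _]mulrC; apply: lt_le_trans qe _.
  by rewrite ler_pM2r // ler_nat -[leqLHS]expn1 leq_pexp2l // subn_gt0.
Qed.

(** Among infinitely many integers x_k of bounded norm, two have the same norm N and congruent
    coefficients modulo N. Then x_k = x_l + N u, so x_k / x_l = 1 + (N / x_l) u is integral, and so
    is its inverse by symmetry. The absolute values at i1 are made strictly decreasing, so that of
    the quotient is not 1. *)
Lemma nontorsion_unit : exists2 e : F, integer_units e & cabs (s i1 e) != 1.
Proof.
have /choice[h hP] : forall r : R, exists a, 0 < r ->
    [/\ combination a != 0, \prod_i cabs (s i (combination a)) <= (A * 4) ^+ n &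
      cabs (s i1 (combination a)) < r].
  move=> r; have [/small_integers[a aP]|_] := boolP (0 < r); first by exists a.
  by exists (fun=> 0).
(* [b k.+1] is the absolute value at i1 of an element chosen to be smaller than [b k] there. *)
pose b := fun k => iter k (fun r => cabs (s i1 (combination (h r)))) 1.
have b0 k : 0 < b k.
  elim: k => [|k IH]; first exact: ltr01.
  by have [x0 _ _] := hP _ IH; rewrite /= cabs_gt0 fmorph_eq0.
have bS k : b k.+1 < b k by have [] := hP _ (b0 k).
have bdec k l : (k < l)%N -> b l < b k.
  elim: l => // l IH; rewrite ltnS leq_eqVlt => /predU1P[->//|/IH].
  exact: lt_trans.
pose x k := combination (h (b k)).
have xb k : cabs (s i1 (x k)) = b k.+1 by [].
have x0 k : x k != 0 by have [] := hP _ (b0 k).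
have /choice[N NE] : forall k, exists z : int, \prod_i s i (x k) = z%:~R.
  by move=> k; apply: norm_int; exact: combination_int.
have N0 k : N k != 0.
  by rewrite -(intr_eq0 C) -NE; apply/prodf_neq0 => i _; rewrite fmorph_eq0 x0.
pose M := (Num.truncn ((A * 4) ^+ n)).+1.
have NM k : (`|N k|%N < M)%N.
  rewrite -(ltr_nat R); apply: le_lt_trans (truncnS_gt _).
  have [_ + _] := hP _ (b0 k); rewrite -/(x k) -cabs_prod NE cabs_int.
  by rewrite -abszE.
have rM k j : (`|(h (b k) j %% N k)%Z|%N < M)%N.
  apply: ltn_trans (NM k); rewrite -ltz_nat gez0_abs ?modz_ge0 //.
  by rewrite abszE ltz_mod.
pose T : finType := (bool * 'I_M * {ffun 'I_n -> 'I_M})%type.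
pose cl k : T := (N k < 0, Ordinal (NM k), [ffun j => Ordinal (rM k j)]).
have clP k l : cl k = cl l -> ring_of_integers (x k / x l).
  move=> [sN aN /ffunP rN].
  have NN : N k = N l by rewrite [LHS]intEsign [RHS]intEsign sN aN.
  pose u j := (h (b k) j %/ N k)%Z - (h (b l) j %/ N k)%Z.
  have -> : x k = x l + (N l)%:~R * combination u.
    rewrite /x /combination mulr_sumr -big_split; apply: eq_bigr => j _ /=.
    rewrite mulrA -mulrDl; congr (_ * _); rewrite -intrM -intrD; congr _%:~R.
    have := rN j; rewrite !ffunE => -[] /eqP.
    rewrite -eqz_nat !gez0_abs ?modz_ge0 // => /eqP rj.
    have ek := divz_eq (h (b k) j) (N k); have el := divz_eq (h (b l) j) (N l).
    by rewrite [LHS]ek {1}el rj /u NN; ring.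
  rewrite mulrDl divff // mulrAC; apply: integral_add; first exact: integral1.
  apply: integral_mul; last exact: combination_int.
  exact: norm_quotient (combination_int _) (x0 l) (NE l).
have [k [l [kl cE']]] : exists k l : 'I_#|T|.+1, k != l /\ cl k = cl l.
  apply: contrapT => nh; have : (#|'I_#|T|.+1| <= #|T|)%N.
    apply: (@leq_card _ _ (fun k : 'I_#|T|.+1 => cl k)) => k l ckl.
    by apply: contrapT => /eqP kl; apply: nh; exists k, l.
  by rewrite card_ord ltnn.
exists (x k / x l).
  split; first by rewrite mulf_neq0 ?invr_eq0.
    exact: clP.
  by rewrite invf_div; apply: clP.
rewrite rmorphM fmorphV cabsM cabsV !xb; apply/eqP => /divr1_eq.
have bl : b l.+1 != 0 by rewrite gt_eqF.
move: kl; rewrite neq_ltn => /orP[kl|kl] e.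
- have := bdec k.+1 l.+1 kl; rewrite e ltxx //.
- have := bdec l.+1 k.+1 kl; rewrite e ltxx //.
Qed.
End SmallElements.

(** Three embeddings always leave one outside the conjugate pair of i0. In degree 2 there is a real
    embedding, which is its own conjugate, and the other embedding can be taken. *)
Lemma two_places (c : 'I_n -> 'I_n) : (forall i x, s (c i) x = (s i x)^*) ->
  n <> 1%N -> ~ imaginary_quadratic R F -> exists i0 i1, i1 != i0 /\ i1 != c i0.
Proof.
move=> cE n1 niq; have [n3|n3] := leqP 3 n.
  pose o k (k3 : (k < 3)%N) : 'I_n := Ordinal (leq_trans k3 n3).
  exists (o 0%N isT); have [e|ne] := eqVneq (o 1%N isT) (c (o 0%N isT)).
    by exists (o 2%N isT); rewrite -e.
  by exists (o 1%N isT); split.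
have n2 : n = 2%N by move: dim_gt0 n1 n3; clear; lia.
have [rho] : inhabited {rmorphism F -> R} by apply: contrapT => h; apply: niq.
have [i0 i0E] := s_all (real_complex R \o rho : {rmorphism F -> C}).
have ci0 : c i0 = i0.
  by apply: s_inj; apply/funext => x; rewrite cE -i0E; exact: conjc_real.
exists i0; rewrite ci0; have o2 k : (k < 2)%N -> (k < n)%N by rewrite n2.
have [e|ne] := eqVneq (Ordinal (o2 0%N isT)) i0.
  by exists (Ordinal (o2 1%N isT)); rewrite -e.
by exists (Ordinal (o2 0%N isT)).
Qed.
End Units.

Section UnitTheorem.
Variables (R : realType) (F : fieldExtType rat).
Local Notation n := (\dim {:F}).

Theorem exists_nontorsion_unit : n <> 1%N -> ~ imaginary_quadratic R F ->
  exists2 e : F, integer_units e & exists t : embedding R F, cabs (t e) != 1.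
Proof.
move=> n1 niq; have [s [w [w1 w2 w3 w4 w5]]] := embeddings_basis R F.
have [c cE] := conj_index w4.
have [i0 [i1 [i10 i1c]]] := two_places w4 w5 cE n1 niq.
have [e e1 e2] := nontorsion_unit w1 w2 w3 w5 cE i10 i1c.
by exists e => //; exists (s i1).
Qed.

Lemma finite_embeddings : exists s : 'I_n -> embedding R F,
  (forall t : embedding R F, exists i, t =1 s i) /\
  forall B : R, exists M : nat, forall x : 'I_M.+1 -> F,
  (forall k, ring_of_integers (x k) /\ forall i, cabs (s i (x k)) <= B) ->
  ~ injective x.
Proof.
have [s [w [w1 w2 w3 w4 w5]]] := embeddings_basis R F.
by exists s; split => // B; exact: bounded_integers w2 w3 _.
Qed.
End UnitTheorem.

(** * Integrality and finite places *)

Section ValuationRing.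
Variable F : fieldType.

Definition is_subring (A : set F) : Prop :=
  [/\ A 1, forall x y, A x -> A y -> A (x - y) & forall x y, A x -> A y -> A (x * y)].

Section Subring.
Variables (A : set F) (hA : is_subring A).

Lemma subring1 : A 1. Proof. by case: hA. Qed.
Lemma subringB x y : A x -> A y -> A (x - y). Proof. by case: hA => _ h _; exact: h. Qed.
Lemma subringM x y : A x -> A y -> A (x * y). Proof. by case: hA => _ _; exact. Qed.
Lemma subring0 : A 0. Proof. by rewrite -(subrr 1); apply: subringB; exact: subring1. Qed.
Lemma subringN x : A x -> A (- x).
Proof. by rewrite -sub0r => Ax; apply: subringB => //; exact: subring0. Qed.
Lemma subringD x y : A x -> A y -> A (x + y).
Proof. by move=> Ax Ay; rewrite -[y]opprK; apply: subringB => //; exact: subringN. Qed.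
Lemma subringX x m : A x -> A (x ^+ m).
Proof.
by move=> Ax; elim: m => [|m IH]; rewrite ?expr0 ?exprS; [exact: subring1|exact: subringM].
Qed.
Lemma subring_nat m : A m%:R.
Proof.
by elim: m => [|m IH]; [exact: subring0|rewrite -natr1; apply: subringD => //; exact: subring1].
Qed.
Lemma subring_sum (I : Type) (r : seq I) (P : pred I) (f : I -> F) :
  (forall i, P i -> A (f i)) -> A (\sum_(i <- r | P i) f i).
Proof.
by move=> h; elim/big_ind: _ => //; [exact: subring0|exact: subringD].
Qed.
Definition adjoin (z : F) : set F := [set t | exists2 p : {poly F}, forall i, A p`_i & t = p.[z]].

Lemma adjoin_subring z : is_subring (adjoin z).
Proof.
split.
- exists 1; last by rewrite hornerC.
  by move=> i; rewrite coef1; case: eqP => _; [exact: subring1|exact: subring0].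
- move=> _ _ [p pA ->] [q qA ->]; exists (p - q); last by rewrite hornerD hornerN.
  by move=> i; rewrite coefB; exact: subringB.
- move=> _ _ [p pA ->] [q qA ->]; exists (p * q); last by rewrite hornerM.
  by move=> i; rewrite coefM; apply: subring_sum => j _; exact: subringM.
Qed.

Lemma sub_adjoin z : A `<=` adjoin z.
Proof.
move=> a Aa; exists a%:P; last by rewrite hornerC.
by move=> i; rewrite coefC; case: eqP => // _; exact: subring0.
Qed.

Lemma mem_adjoin z : adjoin z z.
Proof.
exists 'X; last by rewrite hornerX.
by move=> i; rewrite coefX; case: eqP => _; [exact: subring1|exact: subring0].
Qed.
End Subring.

(** Zorn's lemma for the subrings that contain B and avoid x; by maximality, every strictly larger
    subring contains x. *)
Lemma maximal_subring (B : set F) (x : F) : is_subring B -> ~ B x ->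
  exists A, [/\ is_subring A, B `<=` A, ~ A x &
    forall z, ~ A z -> adjoin A z x].
Proof.
move=> hB Bx.
pose P (A : set F) := A = set0 \/ [/\ is_subring A, B `<=` A & ~ A x].
have [|A [PA Amax]] := @Zorn_bigcup F P.
  move=> G GP tot; have [G0|/existsNP[X0 /not_implyP[GX0 X00]]] := pselect (forall X, G X -> X = set0).
    by left; apply/seteqP; split => // z [X /G0 ->].
  right; have X0P X : G X -> X <> set0 -> [/\ is_subring X, B `<=` X & ~ X x].
    by move=> /GP[].
  have ne (X : set F) z : X z -> X <> set0 by move=> Xz e; rewrite e in Xz.
  have [hX0 BX0 _] := X0P _ GX0 X00.
  have two a b : (\bigcup_(X in G) X) a -> (\bigcup_(X in G) X) b ->
      exists X, [/\ G X, X a, X b & is_subring X].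
    move=> [X GX Xa] [Y GY Yb]; have [XY|YX] := tot _ _ GX GY.
      by exists Y; split => //; [exact: XY|have [] := X0P _ GY (ne _ _ Yb)].
    by exists X; split => //; [exact: YX|have [] := X0P _ GX (ne _ _ Xa)].
  split; [split|by move=> z /BX0 Xz; exists X0|].
  - by exists X0 => //; exact: subring1.
  - by move=> a b ha /(two _ _ ha)[X [GX Xa Xb hX]]; exists X => //; exact: subringB.
  - by move=> a b ha /(two _ _ ha)[X [GX Xa Xb hX]]; exists X => //; exact: subringM.
  - by move=> [X GX Xx]; have [_ _] := X0P _ GX (ne _ _ Xx); apply.
have PB : P B by right; split.
case: PA => [A0|[hA BA Ax]].
  exfalso; apply: (Amax B) => //; rewrite A0; split => // /(_ _ (subring1 hB)).
  by [].
exists A; split => // z Az; apply: contrapT => nx.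
apply: (Amax (adjoin A z)).
  split; first exact: sub_adjoin.
  by move=> /(_ z (mem_adjoin hA z)).
right; split => //; first exact: adjoin_subring.
by apply: subset_trans BA _; exact: sub_adjoin.
Qed.

Section Maximal.
Variables (A : set F) (x : F).
Hypotheses (hA : is_subring A) (Ax : ~ A x) (Axi : A x^-1)
  (Amax : forall z, ~ A z -> adjoin A z x).

Let x0 : x != 0.
Proof. by apply/eqP => e; apply: Ax; rewrite e; exact: subring0. Qed.

(** Put u = 1 - a/x. Otherwise x would be a polynomial in 1/u over A, and u^m x would lie in A for
    some m. But u^m = 1 - b/x with b in A, so u^m x = x - b, and x itself would lie in A. *)
Lemma maximal_one_sub a : A a -> A (1 - a / x)^-1.
Proof.
move=> Aa; apply: contrapT => nu; set u := 1 - a / x in nu.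
have u0 : u != 0 by apply/eqP => e; apply: nu; rewrite e invr0; exact: subring0.
have [p pA xE] := Amax nu.
have Au : A u by apply: subringB => //; [exact: subring1|exact: subringM].
pose m := size p.
have Ab : A (u ^+ m * x).
  rewrite xE horner_coef mulr_sumr; apply: subring_sum => // i _.
  rewrite mulrCA; apply: subringM => //; rewrite exprVn -expfB //; exact: subringX.
have [b Ab' bE] : exists2 b, A b & u ^+ m = 1 - b / x.
  elim: m {Ab} => [|m [b Ab bE]]; first by exists 0; [exact: subring0|rewrite mul0r subr0].
  exists (a + b - a * b / x).
    by apply: subringB => //; [exact: subringD|apply: subringM => //; exact: subringM].
  by rewrite exprS bE /u; field.
apply: Ax; rewrite -[x](subrK b); apply: subringD => //.
by move: Ab; rewrite bE mulrBl mul1r divfK.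
Qed.

Let P z m := `[< exists p : {poly F}, [/\ (forall i, A p`_i), (size p <= m.+1)%N & p.[z] = x] >].

Let P_exists z : ~ A z -> exists m, P z m.
Proof. by move=> /Amax[p pA pE]; exists (size p); apply/asboolP; exists p. Qed.

Let P0 z : ~ P z 0%N.
Proof.
move=> /asboolP[p [pA sp pE]]; apply: Ax; rewrite -pE horner_coef.
apply: subring_sum => // i _; apply: subringM => //.
have : (i < 1)%N by apply: leq_trans (ltn_ord i) sp.
by case: (val i) => // _; rewrite expr0; exact: subring1.
Qed.

(** The constant term of the expression of x in 1/z is absorbed, because 1 - q_0/x is a unit of A.
    This leaves x as a combination of z^-1, ..., z^-(k+1); as k <= m, it rewrites z^(m+1) through
    lower powers of z and removes the top term of the expression of x in z. *)
Let descent z m k : z != 0 -> (k <= m)%N -> P z m.+1 -> P z^-1 k.+1 -> P z m.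
Proof.
move=> z0 km /asboolP[p [pA sp pE]] /asboolP[q [qA sq qE]].
pose u := 1 - q`_0 / x.
have u0 : u != 0.
  rewrite subr_eq0; apply/eqP => e; apply: Ax.
  by rewrite -(mul1r x) e divfK.
have Au : A u^-1 by exact: maximal_one_sub.
pose r i := q`_i.+1 / u.
have rE : x = \sum_(i < k.+1) r i * z ^- i.+1.
  have : u * x = \sum_(i < k.+1) q`_i.+1 * z ^- i.+1.
    rewrite /u mulrBl mul1r divfK // -[in LHS]qE (horner_coef_wide _ sq) big_ord_recl.
    rewrite expr0 mulr1 addrAC subrr add0r.
    by apply: eq_bigr => i _; rewrite exprVn.
  move=> /(congr1 (fun t => u^-1 * t)); rewrite mulKf // => ->.
  rewrite mulr_sumr; apply: eq_bigr => i _.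
  by rewrite /r mulrA [u^-1 * _]mulrC.
apply/asboolP; exists (\poly_(i < m.+1) (p`_i + p`_m.+1 * r (m - i)%N / x *+ (m - i < k.+1))).
split.
- move=> i; rewrite coef_poly; case: ifP => _; last exact: subring0.
  apply: subringD => //; case: (_ < _)%N; last by rewrite mulr0n; exact: subring0.
  by rewrite mulr1n; do 3?[apply: subringM => //].
- exact: size_poly.
rewrite horner_poly -[RHS]pE (horner_coef_wide _ sp) [RHS]big_ord_recr /=.
transitivity (\sum_(i < m.+1) p`_i * z ^+ i +
  \sum_(i < m.+1) p`_m.+1 / x * (r (m - i)%N *+ (m - i < k.+1)) * z ^+ i).
  rewrite -big_split; apply: eq_bigr => i _ /=; rewrite mulrDl; congr (_ + _ * _).
  by case: (_ < _)%N; rewrite ?mulr0n ?mulr1n ?mulr0 // mulrAC.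
congr (_ + _).
have -> : z ^+ m.+1 = x^-1 * \sum_(i < k.+1) r i * z ^+ (m - i).
  rewrite -[LHS](mulKf x0) {2}rE mulr_suml; congr (_ * _).
  apply: eq_bigr => i _; rewrite -mulrA; congr (_ * _).
  rewrite mulrC -expfB_cond ?(negPf z0) // ?subSS // ltnS.
  by apply: leq_trans km; rewrite -ltnS.
rewrite (reindex_inj rev_ord_inj) /= mulrA mulr_sumr.
rewrite (big_ord_widen m.+1 (fun i => p`_m.+1 / x * (r i * z ^+ (m - i)))) //.
rewrite [RHS]big_mkcond; apply: eq_bigr => i _ /=.
have im : (i <= m)%N by rewrite -ltnS ltn_ord.
rewrite subSS (subKn im) -mulrA.
by case: (_ < _)%N; rewrite ?mulr0n ?mulr1n ?mul0r ?mulr0.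
Qed.

(** If z and 1/z are both outside A, take expressions of x of least degree in each of them; the
    longer one can be shortened by [descent]. *)
Lemma maximal_valuation z : z != 0 -> A z \/ A z^-1.
Proof.
move=> z0; apply: contrapT => /not_orP[Az Azi].
have zi0 : z^-1 != 0 by rewrite invr_eq0.
case: (ex_minnP (P_exists Az)) => m Pm mmin.
case: (ex_minnP (P_exists Azi)) => k Pk kmin.
case: m => [|m] in Pm mmin *; first exact: P0 Pm.
case: k => [|k] in Pk kmin *; first exact: P0 Pk.
have [km|/ltnW mk] := leqP k m.
  by have := mmin _ (descent z0 km Pm Pk); rewrite ltnn.
have := kmin _ (descent zi0 mk Pk _); rewrite invrK => /(_ Pm).
by rewrite ltnn.
Qed.
End Maximal.
End ValuationRing.

(** * The discrete valuation of a valuation ring in a number field *)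

Section DiscreteValuation.
Variables (F : fieldExtType rat) (A : set F) (x : F).
Hypotheses (hA : is_subring A) (val : forall z, z != 0 -> A z \/ A z^-1)
  (Ax : ~ A x).

Let x0 : x != 0.
Proof. by apply/eqP => e; apply: Ax; rewrite e; exact: subring0. Qed.

Definition vunit (z : F) : Prop := [/\ z != 0, A z & A z^-1].

Let vunit1 : vunit 1.
Proof. by split; rewrite ?invr1 ?oner_neq0 //; exact: subring1. Qed.

Let vunitM a b : vunit a -> vunit b -> vunit (a * b).
Proof.
by move=> [a0 h1 h2] [b0 h3 h4]; split; rewrite ?mulf_neq0 ?invfM //; exact: subringM.
Qed.

Let vunitV a : vunit a -> vunit a^-1.
Proof. by move=> [a0 h1 h2]; split; rewrite ?invr_eq0 ?invrK. Qed.

Let vunitX a m : vunit a -> vunit (a ^+ m).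
Proof. by move=> ua; elim: m => [|m IH]; rewrite ?expr0 ?exprS //; exact: vunitM. Qed.

Let vunitN a : vunit a -> vunit (- a).
Proof.
by move=> [a0 h1 h2]; split; rewrite ?oppr_eq0 ?invrN //; exact: subringN.
Qed.

Let nonunitD a b : A a -> ~ vunit a -> A b -> ~ vunit b -> ~ vunit (a + b).
Proof.
have half a' b' : a' != 0 -> b' != 0 -> A a' -> A b' -> ~ vunit b' -> A (a' / b') -> ~ vunit (a' + b').
  move=> a0 b0 Aa Ab nb ab [s0 As Asi]; apply: nb; split => //.
  have -> : b'^-1 = (a' / b' + 1) * (a' + b')^-1.
    by rewrite -(divff b0) -mulrDl mulrAC divff // mul1r.
  by apply: subringM => //; apply: subringD => //; exact: subring1.
move=> Aa na Ab nb; have [->|a0] := eqVneq a 0; first by rewrite add0r.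
have [->|b0] := eqVneq b 0; first by rewrite addr0.
have ab0 : a / b != 0 by rewrite mulf_neq0 ?invr_eq0.
have [|h] := val ab0; first exact: half.
by rewrite addrC; apply: half => //; rewrite -invf_div.
Qed.

Let nonunit_addl a b : A a -> ~ vunit a -> vunit b -> vunit (a + b).
Proof.
move=> Aa na ub; have [b0 Ab Abi] := ub; apply: contrapT => nu.
have : ~ vunit (a + b - a).
  apply: nonunitD => //; [exact: subringD|exact: subringN|].
  by move=> /vunitN; rewrite opprK.
by rewrite addrAC subrr add0r.
Qed.

(** The ultrametric principle: terms of pairwise different values cannot cancel, so the sum has the
    value of its dominant term. In particular it is nonzero. *)
Let dominant (r : seq F) : r != [::] -> (forall a, a \in r -> a != 0) ->
  pairwise (fun a b => ~~ `[< vunit (a / b) >]) r -> 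
  exists2 d, d != 0 & vunit ((\sum_(a <- r) a) / d).
Proof.
suff h : r != [::] -> (forall a, a \in r -> a != 0) ->
  pairwise (fun a b => ~~ `[< vunit (a / b) >]) r -> 
  exists2 d, d \in r & vunit ((\sum_(a <- r) a) / d).
  by move=> r0 rn0 pr; have [d dr du] := h r0 rn0 pr; exists d => //; exact: rn0.
elim: r => // a r IH _ rn0 /= /andP[ar pr].
have a0 : a != 0 by apply: rn0; rewrite mem_head.
have [->|r0] := eqVneq r [::].
  by exists a; rewrite ?mem_head // big_seq1 divff.
have [d dr du] := IH r0 (fun b br => rn0 b (mem_behead (s := a :: r) br)) pr.
have d0 : d != 0 by apply: rn0; rewrite inE dr orbT.
have nad : ~ vunit (a / d) by have /asboolPn := allP ar _ dr.
have ad0 : a / d != 0 by rewrite mulf_neq0 ?invr_eq0.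
have [h|h] := val ad0.
  by exists d; rewrite ?inE ?dr ?orbT // big_cons mulrDl; exact: nonunit_addl.
exists a; rewrite ?mem_head // big_cons mulrDl divff // addrC.
have -> : (\sum_(b <- r) b) / a = ((\sum_(b <- r) b) / d) * (a / d)^-1.
  by rewrite invf_div mulrA divfK.
have [_ Asd _] := du; apply: nonunit_addl vunit1; first exact: subringM.
move=> /(vunitM (vunitV du)); rewrite mulKf; last by have [] := du.
by move=> /vunitV; rewrite invrK.
Qed.

Let int_unit_mul (a b : nat) : A (a * b)%:R^-1 -> a%:R != 0 :> F -> A b%:R^-1.
Proof.
move=> h a0; have -> : b%:R^-1 = a%:R * (a * b)%:R^-1 :> F.
  by rewrite natrM invfM mulrA divff // mul1r.
by apply: subringM => //; exact: subring_nat.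
Qed.

Let natr_neq0 m : (0 < m)%N -> m%:R != 0 :> F.
Proof.
move=> m0; have -> : m%:R = in_alg F m%:R by rewrite rmorph_nat.
by rewrite fmorph_eq0 pnatr_eq0 -lt0n.
Qed.

(** The terms of the minimal equation of z have sum 0, so by [dominant] two of them, of degrees i <
    j, differ by a unit; hence z^(j-i) is rational up to a unit. *)
Let rational_power z : z != 0 -> exists m t,
  [/\ (0 < m)%N, (m <= \dim {:F})%N, t != 0 & vunit (z ^+ m / in_alg F t)].
Proof.
move=> z0; have /polyOver1P[p pE] := minPolyOver (1%AS : {subfield F}) z.
have p0 : p != 0 by rewrite -(map_poly_eq0 (in_alg F)) -pE monic_neq0 ?monic_minPoly.
have sp : (size p <= (\dim {:F}).+1)%N.
  rewrite -(size_map_poly (in_alg F)) -pE size_minPoly ltnS.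
  by have := dim_Fadjoin 1%AS z; rewrite dimv1 muln1 => <-; apply: dimvS; exact: subvf.
pose T i := in_alg F p`_i * z ^+ i.
pose js := [seq i <- iota 0 (size p) | p`_i != 0].
have T0 i : p`_i != 0 -> T i != 0.
  by move=> pi; rewrite mulf_neq0 ?expf_neq0 // fmorph_eq0.
have jsP i : i \in js -> p`_i != 0 by rewrite mem_filter => /andP[].
have jsn : js != [::].
  apply/eqP => e; have : (size p).-1 \in js.
    rewrite mem_filter -lead_coefE lead_coef_eq0 p0 mem_iota /= add0n.
    by rewrite prednK // lt0n size_poly_eq0.
  by rewrite e.
have Tsum : \sum_(i <- js) T i = 0.
  have : (map_poly (in_alg F) p).[z] = 0.
    by rewrite -pE; apply/eqP; rewrite -/(root _ _) root_minPoly.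
  rewrite horner_coef size_map_poly => e; rewrite big_filter big_mkcond /= -[RHS]e.
  rewrite -(big_mkord predT (fun i => (map_poly (in_alg F) p)`_i * z ^+ i)) /index_iota subn0.
  apply: eq_bigr => i _; rewrite coef_map /T; case: eqP => //= ->.
  by rewrite scale0r mul0r.
have [i [j [ij pi pj uij]]] : exists i j, [/\ (i < j)%N, i \in js, j \in js & vunit (T i / T j)].
  apply: contrapT => nh.
  have [|||d d0] := @dominant (map T js).
  - by rewrite -size_eq0 size_map size_eq0.
  - by move=> _ /mapP[i /jsP/T0 h ->].
  - rewrite pairwise_map; apply: (@sub_in_pairwise _ (mem js) ltn).
    + move=> i j ijs jjs ij /=; apply/asboolPn => u; apply: nh; exists i, j; split=> //.
    + exact/allP.
    + by rewrite -sorted_pairwise ?sorted_filter ?iota_ltn_sorted //; exact: ltn_trans.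
  by rewrite big_map Tsum mul0r => -[]; rewrite eqxx.
have jn : (j <= \dim {:F})%N.
  move: pj; rewrite mem_filter mem_iota => /andP[_ /andP[_]]; rewrite add0n => h.
  by rewrite -ltnS (leq_trans h).
exists (j - i)%N, (p`_i / p`_j); split.
- by rewrite subn_gt0.
- by apply: leq_trans jn; exact: leq_subr.
- by apply: mulf_neq0; rewrite ?invr_eq0; exact: jsP.
have -> : z ^+ (j - i) / in_alg F (p`_i / p`_j) = (T i / T j)^-1.
  by rewrite invf_div /T fmorph_div expfB // !invfM invrK /=; ring.
exact: vunitV.
Qed.

Let vunit_int : (forall p, (0 < p)%N -> A p%:R^-1) -> forall t : rat, t != 0 -> vunit (in_alg F t).
Proof.
move=> h t t0.
have hz (m : int) : m != 0 -> vunit m%:~R.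
  have hn (k : nat) : (0 < k)%N -> vunit k%:R.
    by move=> k0; split; [exact: natr_neq0|exact: subring_nat|exact: h].
  case: m => m; first by rewrite -lt0n; exact: hn.
  by move=> _; rewrite NegzE mulrNz; apply/vunitN/hn.
rewrite -[t]divq_num_den fmorph_div !rmorph_int; apply: vunitM; last apply: vunitV; apply: hz.
  by rewrite numq_eq0.
exact: denq_neq0.
Qed.

Let root_closed z m : (0 < m)%N -> A (z ^+ m) -> A z.
Proof.
move=> m0 Azm; have [->|z0] := eqVneq z 0; first exact: subring0.
have [//|Azi] := val z0.
have -> : z = z ^+ m * z^-1 ^+ m.-1.
  by rewrite -{1}(prednK m0) exprS exprVn mulfK ?expf_neq0.
by apply: subringM => //; exact: subringX.
Qed.

Let exists_nonunit : exists p, (0 < p)%N && ~~ `[< A p%:R^-1 >].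
Proof.
apply: contrapT => h; have xi0 : x^-1 != 0 by rewrite invr_eq0.
have [m [t [m0 _ t0 u]]] := rational_power xi0.
have ut : vunit (in_alg F t).
  apply: vunit_int t0 => p p0; apply: contrapT => np; apply: h; exists p.
  by rewrite p0; apply/asboolPn.
have [_ _] := vunitM u ut; rewrite divfK; last by case: ut.
by rewrite -exprVn invrK => /(root_closed m0).
Qed.

(** This is the residue characteristic of A. *)
Let p := ex_minn exists_nonunit.
Let p_gt0 : (0 < p)%N. Proof. by rewrite /p; case: ex_minnP => q /andP[]. Qed.
Let pV : ~ A p%:R^-1. Proof. by rewrite /p; case: ex_minnP => q /andP[_ /asboolPn]. Qed.
Let p_min k : (0 < k)%N -> (k < p)%N -> A k%:R^-1.
Proof.
rewrite /p; case: ex_minnP => q _ qmin k0; apply: contraTP => nk.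
by rewrite -leqNgt; apply: qmin; rewrite k0; apply/asboolPn.
Qed.

(** The remainder of k modulo p is a unit by minimality of p, and k differs from it by a multiple of
    p. When that multiple is nonzero it is not a unit, and adding a nonunit to a unit of a local
    ring gives a unit. *)
Let vunit_coprime k : ~~ (p %| k)%N -> vunit k%:R.
Proof.
move=> pk; have r0 : (0 < k %% p)%N by rewrite lt0n.
have ur : vunit (k %% p)%:R.
  split; [exact: natr_neq0|exact: subring_nat|apply: p_min => //].
  by rewrite ltn_mod.
have [k0|q0] := posnP (k %/ p)%N.
  by move: ur; rewrite {2}(divn_eq k p) k0.
rewrite (divn_eq k p) natrD; apply: nonunit_addl ur; first exact: subring_nat.
by move=> [_ _ /int_unit_mul h]; apply: pV; apply: h; exact: natr_neq0.
Qed.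

Local Notation pi := (p%:R : F).
Let pi0 : pi != 0. Proof. exact: natr_neq0. Qed.

Let vunit_nat k : (0 < k)%N -> exists e : int, vunit (k%:R / pi ^ e).
Proof.
elim/ltn_ind: k => k IH k0; have [/dvdnP[q qE]|pk] := boolP (p %| k)%N; last first.
  by exists 0; rewrite expr0z divr1; exact: vunit_coprime.
have q0 : (0 < q)%N by move: k0; rewrite qE muln_gt0 => /andP[].
have p1 : (1 < p)%N.
  rewrite ltn_neqAle p_gt0 andbT; apply/eqP => e; apply: pV.
  by rewrite -e invr1; exact: subring1.
have [|e ue] := IH q _ q0; first by rewrite qE ltn_Pmulr.
exists (e + 1); rewrite qE natrM expfzDr // expr1z invfM mulrACA divff // mulr1.
exact: ue.
Qed.

Let vunit_rat t : t != 0 -> exists e : int, vunit (in_alg F t / pi ^ e).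
Proof.
have hz (m : int) : m != 0 -> exists e : int, vunit (m%:~R / pi ^ e).
  case: m => m; first by rewrite -lt0n; exact: vunit_nat.
  move=> _; have [e ue] := @vunit_nat m.+1 isT; exists e.
  by rewrite NegzE mulrNz mulNr; exact: vunitN.
move=> t0; have [|e ue] := hz (numq t); first by rewrite numq_eq0.
have [f uf] := hz (denq t) (denq_neq0 t).
exists (e - f); rewrite -[t]divq_num_den fmorph_div !rmorph_int.
have -> : (numq t)%:~R / (denq t)%:~R / pi ^ (e - f) =
    ((numq t)%:~R / pi ^ e) / ((denq t)%:~R / pi ^ f) :> F.
  rewrite expfzDr // -invr_expz !invfM !invrK !mulrA; congr (_ * _).
  by rewrite -!mulrA; congr (_ * _); rewrite mulrC.
by apply: vunitM => //; exact: vunitV.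
Qed.

(** A common multiple of the exponents given by [rational_power], so that z^N is a power of p up to
    a unit for every nonzero z. *)
Let N := (\dim {:F})`!.

Let exists_vord z : exists k : int, (z = 0 -> k = 0) /\ (z != 0 -> vunit (z ^+ N / pi ^ k)).
Proof.
have [->|z0] := eqVneq z 0; first by exists 0.
have [m [t [m0 mn t0 u]]] := rational_power z0.
have [e ue] := vunit_rat t0; have mN : (m %| N)%N by apply: dvdn_fact; rewrite m0.
exists (e * (N %/ m)%N); split=> [z00|_]; first by rewrite z00 eqxx in z0.
have -> : z ^+ N / pi ^ (e * (N %/ m)%N) = (z ^+ m / in_alg F t * (in_alg F t / pi ^ e)) ^+ (N %/ m)%N.
  rewrite mulrA divfK ?fmorph_eq0 // exprMn -exprM mulnC divnK //; congr (_ * _).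
  by rewrite exprVn -exprz_exp.
by apply: vunitX; exact: vunitM.
Qed.

Let vo z := projT1 (cid (exists_vord z)).
Let vo0 : vo 0 = 0. Proof. by rewrite /vo; case: cid => k /= [h _]; exact: h. Qed.
Let voP z : z != 0 -> vunit (z ^+ N / pi ^ vo z).
Proof. by rewrite /vo; case: cid => k /= []. Qed.

Let pi_ge0 (k : int) : A (pi ^ k) -> 0 <= k.
Proof.
case: k => // k; rewrite NegzE => h; exfalso; apply: pV.
have -> : pi^-1 = pi ^+ k * pi ^ (- k.+1%:Z).
  by rewrite -invr_expz -exprnP exprS invfM mulrCA divff ?mulr1 // expf_neq0.
by apply: subringM => //; apply: subringX => //; exact: subring_nat.
Qed.

Let pi_ge0' (k : int) : 0 <= k -> A (pi ^ k).
Proof. by case: k => // k _; apply: subringX => //; exact: subring_nat. Qed.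

Let vo_eq z k : z != 0 -> vunit (z ^+ N / pi ^ k) -> vo z = k.
Proof.
move=> z0 /(vunitM (vunitV (voP z0))).
have -> : (z ^+ N / pi ^ vo z)^-1 * (z ^+ N / pi ^ k) = pi ^ (vo z - k).
  by rewrite expfzDr // -invr_expz invf_div -mulrA mulKf ?expf_neq0.
move=> [_ h1]; rewrite invr_expz opprB => h2.
have h3 := pi_ge0 h1; have h4 := pi_ge0 h2.
by apply/eqP; rewrite eq_le -subr_ge0 h4 -subr_ge0 h3.
Qed.

Let voM y z : y != 0 -> z != 0 -> vo (y * z) = vo y + vo z.
Proof.
move=> y0 z0; apply: vo_eq; first by rewrite mulf_neq0.
have := vunitM (voP y0) (voP z0).
by rewrite mulrACA -exprMn expfzDr // invfM.
Qed.

Let N0 : (0 < N)%N. Proof. exact: fact_gt0. Qed.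

Let vo_ge0 z : z != 0 -> A z <-> 0 <= vo z.
Proof.
move=> z0; have [un0 Au Aui] := voP z0; have pv0 : pi ^ vo z != 0 by rewrite expfz_neq0.
split=> [Az|h].
  apply: pi_ge0; have -> : pi ^ vo z = z ^+ N * (z ^+ N / pi ^ vo z)^-1.
    by rewrite invf_div mulrC divfK ?expf_neq0.
  by apply: subringM => //; exact: subringX.
apply: (root_closed N0); rewrite -(divfK pv0 (z ^+ N)).
by apply: subringM => //; exact: pi_ge0'.
Qed.

Let voV z : z != 0 -> vo z^-1 = - vo z.
Proof.
move=> z0; apply: vo_eq; first by rewrite invr_eq0.
by rewrite exprVn -invr_expz -invfM; apply/vunitV/voP.
Qed.

Let voD y z : y != 0 -> z != 0 -> y + z != 0 -> Num.min (vo y) (vo z) <= vo (y + z).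
Proof.
have half a b : a != 0 -> b != 0 -> a + b != 0 -> vo a <= vo b -> vo a <= vo (a + b).
  move=> a0 b0 s0 ab; have sE : a + b = a * (1 + b / a).
    by rewrite mulrDr mulr1 mulrCA divff // mulr1.
  have t0 : 1 + b / a != 0 by apply: contraNneq s0 => e; rewrite sE e mulr0.
  rewrite sE voM // lerDl; apply/vo_ge0 => //.
  apply: subringD => //; first exact: subring1.
  apply/vo_ge0; rewrite ?mulf_neq0 ?invr_eq0 // voM ?invr_eq0 // voV //.
  by rewrite subr_ge0.
move=> y0 z0 s0; rewrite ge_min; have [h|/ltW h] := leP (vo y) (vo z).
  by rewrite half.
by rewrite addrC half ?orbT // addrC.
Qed.

Let voX z (m : int) : z != 0 -> vo (z ^ m) = vo z * m.
Proof.
move=> z0; have hn (k : nat) : vo (z ^+ k) = vo z * k%:Z.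
  elim: k => [|k IH].
    by rewrite mulr0; apply: vo_eq; rewrite ?expr0 ?oner_neq0 // expr1n expr0z divr1.
  by rewrite exprS voM ?expf_neq0 // IH -[k.+1]addn1 PoszD mulrDr mulr1 addrC.
case: m => m; first exact: hn.
by rewrite NegzE -invr_expz voV ?expfz_neq0 // hn mulrN.
Qed.

(** The values vo z, defined by z^N = p^(vo z) up to a unit, form a subgroup of Z that contains N.
    Dividing by its positive generator g gives a valuation onto Z. *)
Lemma valuation_place : exists v : finite_place F, vord v x < 0.
Proof.
have vpi : vo pi = N%:Z.
  by apply: vo_eq => //; rewrite -exprnP divff ?expf_neq0.
have exg : exists g, (0 < g)%N && `[< exists2 z, z != 0 & vo z = g%:Z >].
  by exists N; rewrite N0; apply/asboolP; exists pi.
case: (ex_minnP exg) => g /andP[g0 /asboolP[z z0 zg]] gmin.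
have gZ0 : g%:Z != 0 by rewrite eqz_nat -lt0n.
have dv y : y != 0 -> vo y = (vo y %/ g)%Z * g%:Z.
  move=> y0; have := divz_eq (vo y) g; set r := (vo y %% g)%Z => e.
  suff r0 : r = 0 by rewrite {1}e r0 addr0.
  have r_ge0 : 0 <= r by rewrite modz_ge0.
  have r_lt : r < g by rewrite ltz_pmod // ltz_nat.
  apply/eqP; rewrite eq_le r_ge0 andbT leNgt; apply/negP => r_gt0.
  pose t := y * z ^ (- (vo y %/ g)%Z).
  have t0 : t != 0 by rewrite mulf_neq0 // expfz_neq0.
  have tr : vo t = `|r|%N.
    by rewrite voM ?expfz_neq0 // voX // zg mulrN gez0_abs // {1}e [g%:Z * _]mulrC addrAC subrr add0r.
  have := gmin `|r|%N; rewrite absz_gt0 gt_eqF //= => h.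
  have : (g <= `|r|)%N by apply: h; apply/asboolP; exists t.
  by rewrite leqNgt -ltz_nat gez0_abs // r_lt.
pose v y := (vo y %/ g)%Z.
have v0 : v 0 = 0 by rewrite /v vo0 div0z.
have g_gt0 : 0 < g%:Z by rewrite ltz_nat.
have vM a b : a != 0 -> b != 0 -> v (a * b) = v a + v b.
  move=> a0 b0; apply: (mulIf gZ0); rewrite mulrDl -!dv ?mulf_neq0 //; exact: voM.
have vD a b : a != 0 -> b != 0 -> a + b != 0 -> Num.min (v a) (v b) <= v (a + b).
  move=> a0 b0 s0; rewrite -(ler_pM2r g_gt0) -(dv _ s0); apply: le_trans (voD a0 b0 s0).
  rewrite minEle; case: ifP => h; rewrite -dv //; rewrite le_min lexx ?andbT /=.
    by rewrite (dv a) // (dv b) // ler_pM2r.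
  by rewrite (dv a) // (dv b) // ler_pM2r // ltW // ltNge h.
have v_onto (m : int) : exists2 y, y != 0 & v y = m.
  exists (z ^ m); first by rewrite expfz_neq0.
  by apply: (mulIf gZ0); rewrite -dv ?expfz_neq0 // voX // zg mulrC.
exists (FinitePlace v0 vM vD v_onto) => /=.
rewrite -(pmulr_llt0 _ g_gt0) -dv // ltNge; apply/negP => /vo_ge0.
by move=> /(_ x0).
Qed.
End DiscreteValuation.

(** A non-integral x is outside Z[1/x], and a maximal subring that contains Z[1/x] and avoids x is a
    valuation ring whose valuation is negative at x. This is what recognises the elements that are
    units at every place as units of the ring of integers. *)
Theorem exists_negative_place (F : fieldExtType rat) (x : F) :
  ~ ring_of_integers x -> exists v : finite_place F, vord v x < 0.
Proof.
move=> Ox; have x0 : x != 0 by apply: contra_not_neq Ox => ->; exact: integral0.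
pose B : set F := [set t | exists p : {poly int}, t = (map_poly intr p).[x^-1]].
have hB : is_subring B.
  split.
  - by exists 1; rewrite rmorph1 hornerC.
  - by move=> _ _ [p ->] [q ->]; exists (p - q); rewrite rmorphB hornerD hornerN.
  - by move=> _ _ [p ->] [q ->]; exists (p * q); rewrite rmorphM hornerM.
have Bx : ~ B x.
  move=> [p pE]; apply: Ox; pose d := size p.
  (* Multiplying x = p(1/x) by x^(d-1) gives this monic equation. *)
  exists ('X^d - \poly_(i < d) p`_(d.-1 - i)).
    by rewrite monicE lead_coefDl ?lead_coefXn // size_polyN size_polyXn ltnS size_poly.
  rewrite /root rmorphB /= map_polyXn hornerD hornerN hornerXn subr_eq0; apply/eqP.
  have d0 : (0 < d)%N.
    rewrite lt0n size_poly_eq0; apply: contraNneq x0 => p0.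
    by rewrite pE p0 rmorph0 horner0.
  rewrite -{1}(prednK d0) exprSr {2}pE (horner_coef_wide _ (size_poly _ _)) mulr_sumr.
  rewrite (horner_coef_wide _ (n := d)); last first.
    by apply: leq_trans (size_poly _ _) _; exact: size_poly.
  rewrite (reindex_inj rev_ord_inj) /=; apply: eq_bigr => i _.
  have di : (d - i.+1 <= d.-1)%N by have := ltn_ord i; lia.
  rewrite !coef_map_id0 ?rmorph0 // coef_poly ltn_ord exprVn mulrCA -expfB_cond ?(negPf x0) //.
  have -> : (size p - i.+1 = d.-1 - i)%N by rewrite /d; have := ltn_ord i; lia.
  by rewrite subKn //; have := ltn_ord i; rewrite -/d; lia.
have [A [hA BA Ax Amax]] := maximal_subring hB Bx.
have Axi : A x^-1 by apply: BA; exists 'X; rewrite map_polyX hornerX.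
apply: (@valuation_place F A x hA _ Ax) => z z0.
exact: (maximal_valuation hA Ax Axi Amax z0).
Qed.

(** * Tensor products *)

Section TensorTheory.
Variables (A k : nzRingType) (iota : {rmorphism A -> k}) (V : lmodType A).
Local Notation pure := (@pure_tensor A k iota V).

Lemma freegUZ (c a : k) (v : V) : c *: << a *g v >> = << c * a *g v >>.
Proof. by apply/eqP/freeg_eqP => x; rewrite coeffZ !coeffU mulrA. Qed.

Lemma fglift_linear (M : lmodType k) (f : V -> M) : linear (fglift f).
Proof.
have fB D1 D2 : fglift f (D1 - D2) = fglift f D1 - fglift f D2 := lift_is_additive f D1 D2.
have f0 : fglift f 0 = 0 by rewrite -(subrr 0) fB subrr.
have fD D1 D2 : fglift f (D1 + D2) = fglift f D1 + fglift f D2.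
  by rewrite -{1}[D2]opprK -[- D2]sub0r !fB f0 sub0r opprK.
have fs (I : Type) (r : seq I) (P : pred I) E :
    fglift f (\sum_(i <- r | P i) E i) = \sum_(i <- r | P i) fglift f (E i).
  exact: (big_morph (fglift f) fD f0).
move=> c D E; rewrite fD; congr (_ + _); rewrite -[D]freeg_sumE scaler_sumr !fs scaler_sumr.
by apply: eq_bigr => v _; rewrite freegUZ !liftU scalerA.
Qed.

Lemma tensor_pi_linear :
  linear (\pi_(tensor iota V) : {freeg V / k} -> tensor iota V).
Proof. exact: lmod_quot_pi_linear. Qed.

Lemma tensor_piP (x y : {freeg V / k}) :
  reflect (\pi_(tensor iota V) x = \pi_(tensor iota V) y) (x - y \in @tensor_rel A k iota V).
Proof. exact: lmod_quotP. Qed.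

Let piD x y : \pi_(tensor iota V) (x + y) = \pi_(tensor iota V) x + \pi_(tensor iota V) y.
Proof. by have := tensor_pi_linear 1 x y; rewrite !scale1r. Qed.

Lemma pure_tensorZl c a v : c *: pure a v = pure (c * a) v.
Proof.
have pi0 : \pi_(tensor iota V) 0 = 0 by apply: (addrI (\pi_(tensor iota V) 0)); rewrite -piD !addr0.
by have := tensor_pi_linear c << a *g v >> 0; rewrite pi0 !addr0 freegUZ => <-.
Qed.

Lemma pure_tensorDl a b v : pure (a + b) v = pure a v + pure b v.
Proof. by rewrite /pure_tensor -piD freegUD. Qed.

Let tensor_relP r : tensor_relation iota r -> r \in @tensor_rel A k iota V.
Proof. by move=> hr; apply/asboolP => P _; exact. Qed.

Lemma pure_tensorDr a u v : pure a (u + v) = pure a u + pure a v.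
Proof.
rewrite /pure_tensor -piD; apply/tensor_piP; rewrite opprD addrA.
by apply: tensor_relP; exact: tensor_relD.
Qed.

Lemma pure_tensorZr a b v : pure a (b *: v) = pure (a * iota b) v.
Proof. by apply/tensor_piP; apply: tensor_relP; exact: tensor_relZ. Qed.

Lemma pure_tensor_suml (I : Type) (r : seq I) (P : pred I) (a : I -> k) v :
  pure (\sum_(i <- r | P i) a i) v = \sum_(i <- r | P i) pure (a i) v.
Proof.
apply: (big_morph (pure^~ v) (fun a b => pure_tensorDl a b v)).
by apply: (addrI (pure 0 v)); rewrite -pure_tensorDl !addr0.
Qed.

Section Lift.
Variables (M : lmodType k) (f : V -> M).
Hypotheses (fD : {morph f : u v / u + v}) (fZ : forall b v, f (b *: v) = iota b *: f v).

Definition tensor_lift (x : tensor iota V) : M := fglift f (repr x).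

Let fglift_rel x : x \in @tensor_rel A k iota V -> fglift f x = 0.
Proof.
move=> /asboolP/(_ (fun x => fglift f x == 0)) h; apply/eqP/h.
  split; last first.
    by move=> c u v /eqP hu /eqP hv; apply/eqP; rewrite fglift_linear hu hv scaler0 addr0.
  by apply/eqP; have := fglift_linear f (-1) 0 0; rewrite scaler0 addr0 scaleN1r addNr.
have fB D1 D2 : fglift f (D1 - D2) = fglift f D1 - fglift f D2 := lift_is_additive f D1 D2.
move=> _ [a u v|a b v]; apply/eqP; rewrite !fB !liftU.
  by rewrite fD scalerDr addrAC addrK subrr.
by rewrite fZ scalerA subrr.
Qed.

Lemma tensor_lift_pi x : tensor_lift (\pi_(tensor iota V) x) = fglift f x.
Proof.
apply/eqP; rewrite -subr_eq0 -lift_is_additive; apply/eqP/fglift_rel.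
by apply/tensor_piP; rewrite reprK.
Qed.

Lemma tensor_lift_pure a v : tensor_lift (pure a v) = a *: f v.
Proof. by rewrite tensor_lift_pi liftU. Qed.

Lemma tensor_lift_linear : linear tensor_lift.
Proof.
move=> c x y; rewrite -[x]reprK -[y]reprK -tensor_pi_linear !tensor_lift_pi.
exact: fglift_linear.
Qed.

Lemma tensor_lift_sum (n : nat) (a : 'I_n -> k) (x : 'I_n -> V) :
  tensor_lift (\sum_i pure (a i) (x i)) = \sum_i a i *: f (x i).
Proof.
have h0 : tensor_lift 0 = 0.
  by have := tensor_lift_linear (-1) 0 0; rewrite scaler0 addr0 scaleN1r addNr.
rewrite (big_morph tensor_lift (id1 := 0) (op1 := +%R)) //.
  by apply: eq_bigr => i _; rewrite tensor_lift_pure.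
by move=> u v; have := tensor_lift_linear 1 u v; rewrite !scale1r.
Qed.
End Lift.

Lemma tensor_map_sum (h : V -> V) (n : nat) (a : 'I_n -> k) (x : 'I_n -> V) :
  linear h ->
  tensor_map h (\sum_i pure (a i) (x i)) = \sum_i pure (a i) (h (x i)).
Proof.
move=> hl; have hD : {morph h : u v / u + v} by move=> u v; have := hl 1 u v; rewrite !scale1r.
have h0 : h 0 = 0 by apply: (addrI (h 0)); rewrite -hD !addr0.
have hZ b v : h (b *: v) = b *: h v by rewrite -[LHS]/(h (b *: v)) -[b *: v]addr0 hl h0 addr0.
have fD : {morph (fun v => pure 1 (h v)) : u v / u + v}.
  by move=> u v; rewrite hD pure_tensorDr.
have fZ b v : pure 1 (h (b *: v)) = iota b *: pure 1 (h v).
  by rewrite hZ pure_tensorZr pure_tensorZl mul1r mulr1.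
have := tensor_lift_sum fD fZ a x; rewrite /tensor_lift /tensor_map => ->.
by apply: eq_bigr => i _; rewrite pure_tensorZl mulr1.
Qed.
End TensorTheory.

(** * Detection of tensors by functionals *)

Section TensorDetect.
Variables (A k : fieldType) (iota : {rmorphism A -> k}) (V : lmodType A).
Local Notation pure := (@pure_tensor A k iota V).
Variables (W : V -> Prop) (G : Type) (psi : G -> V -> A).
Hypotheses (WD : forall (c : A) u v, W u -> W v -> W (c *: u + v))
  (psiL : forall g (c : A) u v, psi g (c *: u + v) = c * psi g u + psi g v)
  (W_detect : forall v, W v -> (forall g, psi g v = 0) -> v = 0).

(** If the coefficients a_i satisfy no nontrivial relation over A, the hypothesis gives psi_g(x_i) =
    0 for all g and i, so every x_i vanishes. Otherwise a relation expresses one coefficient a_j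
    through the others, and the tensor is rewritten with one term less. *)
Lemma tensor_detect (n : nat) (a : 'I_n -> k) (x : 'I_n -> V) :
  (forall i, W (x i)) -> (forall g, \sum_i a i * iota (psi g (x i)) = 0) ->
  \sum_i pure (a i) (x i) = 0.
Proof.
elim: n => [|n IH] in a x *; first by rewrite big_ord0.
move=> Wx h; have [[m [j mj am]]|free] := pselect (exists m : 'I_n.+1 -> A,
    exists2 j, m j != 0 & \sum_i a i * iota (m i) = 0); last first.
  suff x0 i : x i = 0.
    by rewrite big1 // => i _; rewrite x0 -(scale0r 0) pure_tensorZr rmorph0 mulr0
      -(mul0r 0) -pure_tensorZl scale0r.
  apply: W_detect => // g; apply: contrapT => /eqP xi; apply: free.
  by exists (fun i => psi g (x i)), i.
pose y i := - (m (fintype.lift j i) / m j) *: x j + x (fintype.lift j i).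
have psi0 g : psi g 0 = 0.
  by have := psiL g (-1) 0 0; rewrite scaler0 addr0 mulN1r addNr.
have aj : a j = - \sum_i a (fintype.lift j i) * iota (m (fintype.lift j i) / m j).
  move: am; rewrite (bigD1_ord j) //= => /eqP; rewrite addr_eq0 => /eqP.
  move=> /(congr1 (fun t => t / iota (m j))).
  rewrite mulfK ?fmorph_eq0 // => ->; rewrite mulNr mulr_suml; congr (- _).
  by apply: eq_bigr => i _; rewrite fmorph_div mulrA.
have -> : \sum_i pure (a i) (x i) = \sum_i pure (a (fintype.lift j i)) (y i).
  rewrite (bigD1_ord j) //= aj -[- _]mulN1r -pure_tensorZl pure_tensor_suml.
  rewrite scaler_sumr -big_split; apply: eq_bigr => i _ /=.
  rewrite pure_tensorDr pure_tensorZr pure_tensorZl; congr (pure _ _ + _).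
  by rewrite rmorphN mulN1r mulrN.
apply: IH => [i|g]; first exact: WD.
have := h g; rewrite (bigD1_ord j) //= aj => e; rewrite -[RHS]e mulNr mulr_suml -sumrN -big_split.
apply: eq_bigr => i _ /=; rewrite /y psiL !(rmorphD, rmorphM, rmorphN) /=.
ring.
Qed.
End TensorDetect.

(** * The archimedean part *)

Section ComplexTopology.
Variable R : realType.
Local Notation C := (complex_of R).

Lemma pos_complexE (e : C) : 0 < e -> exists2 r : R, 0 < r & e = r%:C%C.
Proof.
case: e => a b /=; rewrite ltcE /= => /andP[/eqP -> a0]; by exists a.
Qed.

Lemma cabs_real (r : R) : cabs (r%:C%C : C) = `|r|.
Proof. by rewrite /cabs /= expr0n addr0 sqrtr_sqr. Qed.

Lemma real_complex_continuous : continuous (fun r : R => r%:C%C : C).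
Proof.
move=> r; apply/cvgrPdist_lt => e /pos_complexE[d d0 ->].
near=> s; rewrite -rmorphB /= cabsE ltcR cabs_real.
near: s; by move: d d0; apply/cvgrPdist_lt.
Unshelve. all: by end_near. Qed.

Lemma cabs_continuous : continuous (@cabs R).
Proof.
move=> z; have FF : Filter (nbhs z) by exact: nbhs_filter.
apply: (proj2 (@cvgrPdist_lt R R C (nbhs z) FF (@cabs R) (cabs z))) => e e0.
have e0' : (0 : C) < e%:C%C by rewrite ltcR.
have := proj1 (@cvgrPdist_lt C C C (nbhs z) FF id z) cvg_id _ e0'.
apply: filterS => w; rewrite cabsE ltcR; apply: le_lt_trans.
have h (a b : C) : cabs a - cabs b <= cabs (a - b).
  by rewrite lerBlDr; apply: le_trans (cabsD _ _); rewrite subrK.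
rewrite ler_norml h andbT lerNl opprB -[X in _ <= cabs X]opprB cabsN; exact: h.
Qed.

Variables (X : topologicalType) (f g : X -> C).
Hypotheses (cf : continuous f) (cg : continuous g).

Lemma complex_continuousM : continuous (fun x => f x * g x).
Proof. move=> x; exact: (@cvgM C X (nbhs x) _ f g (f x) (g x) (@cf x) (@cg x)). Qed.

Lemma complex_continuousD : continuous (fun x => f x + g x).
Proof. move=> x; exact: (@cvgD C C X (nbhs x) _ f g (f x) (g x) (@cf x) (@cg x)). Qed.

Lemma complex_continuousB : continuous (fun x => f x - g x).
Proof. move=> x; exact: (@cvgB C C X (nbhs x) _ f g (f x) (g x) (@cf x) (@cg x)). Qed.

Lemma complex_continuous_abs : continuous (fun x => cabs (f x)).
Proof.
by move=> x; apply: (@continuous_comp X C R f (@cabs R)); [exact: cf|exact: cabs_continuous].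
Qed.
End ComplexTopology.

Section ArchimedeanUnits.
Variables (R : realType) (F : fieldExtType rat).
Local Notation C := (complex_of R).
Local Notation U := (@F_R_units R F).

Definition arch_unit (f : arch_space R F) (h : F_R_units f) : U := SigSub (mem_set h).

Lemma arch_unitP (x : U) : F_R_units (set_val x).
Proof. by apply/set_mem; exact: valP. Qed.

Lemma arch_unit_inj (x y : U) : (forall t, set_val x t = set_val y t) -> x = y.
Proof. by move=> xy; apply/val_inj/functional_extensionality_dep. Qed.

(** Pointwise equal embeddings may be different records; both values are the conjugate of the value
    at the conjugate embedding. *)
Lemma F_R_ext (f : arch_space R F) (s t : embedding R F) : F_R f -> s =1 t -> f s = f t.
Proof.
move=> fR st; pose c : embedding R F := Num.conj \o t.
have ct : f c = (f t)^* by apply: fR.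
have cs : f c = (f s)^* by apply: fR => a; rewrite st.
by rewrite -[f s]conjCK -cs ct conjCK.
Qed.

Lemma F_R_units1 : F_R_units (fun _ : embedding R F => 1).
Proof. by split=> [s t _|t]; rewrite ?rmorph1 ?oner_neq0. Qed.

Lemma F_R_unitsM (f g : arch_space R F) :
  F_R_units f -> F_R_units g -> F_R_units (fun t => f t * g t).
Proof.
move=> [fR f0] [gR g0]; split=> [s t st|t]; last by rewrite mulf_neq0.
by rewrite (fR _ _ st) (gR _ _ st) rmorphM.
Qed.

Lemma F_R_unitsV (f : arch_space R F) : F_R_units f -> F_R_units (fun t => (f t)^-1).
Proof.
move=> [fR f0]; split=> [s t st|t]; last by rewrite invr_eq0.
by rewrite (fR _ _ st) fmorphV.
Qed.

Lemma arch_continuous (X : topologicalType) (f : X -> arch_space R F) :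
  (forall t, continuous (fun x => f x t : C)) -> continuous f.
Proof.
move=> h x; apply/cvg_sup => t.
apply: (@continuous_comp_initial _ X _ (proj t : arch_space R F -> C) f _ x).
exact: h.
Qed.

Lemma arch_unit_continuous (X : topologicalType) (f : X -> U) :
  (forall t, continuous (fun x => set_val (f x) t : C)) -> continuous f.
Proof.
move=> h; apply: (@continuous_comp_initial _ X (arch_space R F) set_val f).
by apply: arch_continuous.
Qed.

Lemma arch_coord_continuous (t : embedding R F) : continuous (fun f : arch_space R F => f t : C).
Proof.
move=> x; have /cvg_sup/(_ t) h := @cvg_id _ (nbhs x).
apply: cvg_trans (cvg_app (fun f : arch_space R F => f t : C) h) _.
exact: (@initial_continuous _ _ (fun f : arch_space R F => f t : C)).
Qed.

Lemma arch_unit_coord_continuous (t : embedding R F) : continuous (fun x : U => set_val x t : C).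
Proof.
move=> x; apply: (@continuous_comp _ _ _ (set_val : U -> arch_space R F) (fun f => f t : C)).
  exact: initial_continuous.
exact: arch_coord_continuous.
Qed.
End ArchimedeanUnits.

(** * The identity component of the archimedean units *)

Section IdentityComponent.
Variables (R : realType) (F : fieldExtType rat).
Local Notation C := (complex_of R).
Local Notation U := (@F_R_units R F).
Local Notation P := (@F_R_plus R F).

Let scale (g x : arch_space R F) : arch_space R F := fun t => g t * x t.

Let scale_continuous g : continuous (scale g).
Proof.
apply: arch_continuous => t; apply: complex_continuousM; last exact: arch_coord_continuous.
exact: cst_continuous.
Qed.

Let scale_component g f h : F_R_units g ->
  connected_component U f h -> connected_component U (scale g f) (scale g h).
Proof.
move=> Ug [B [Bf BU cB] Bh]; exists (scale g @` B); last by exists h.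
split; first by exists f.
  by move=> _ [x Bx <-]; apply: F_R_unitsM => //; exact: BU.
apply: connected_continuous_connected => //; apply: continuous_subspaceT.
exact: scale_continuous.
Qed.

Lemma F_R_plus_units f : P f -> F_R_units f.
Proof. exact: connected_component_sub. Qed.

Lemma F_R_plus1 : P (fun=> 1).
Proof. exact/connected_component_refl/F_R_units1. Qed.

Lemma F_R_plusM f g : P f -> P g -> P (fun t => f t * g t).
Proof.
move=> Pf Pg; have Uf := F_R_plus_units Pf; apply: connected_component_trans Pf _.
have fE : f = scale f (fun=> 1) by apply/functional_extensionality_dep => t; rewrite /scale mulr1.
by rewrite {1}fE; apply: scale_component.
Qed.

Lemma F_R_plusV f : P f -> P (fun t => (f t)^-1).
Proof.
move=> Pf; have Uf := F_R_plus_units Pf; apply: connected_component_sym.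
have := scale_component (F_R_unitsV Uf) Pf.
have -> : scale (fun t => (f t)^-1) (fun=> 1) = (fun t => (f t)^-1).
  by apply/functional_extensionality_dep => t; rewrite /scale mulr1.
suff -> : scale (fun t => (f t)^-1) f = (fun=> 1) by [].
by apply/functional_extensionality_dep => t; rewrite /scale mulVf //; case: Uf.
Qed.

Definition segment (f : arch_space R F) (r : R) : arch_space R F :=
  fun t => 1 + r%:C%C * (f t - 1).

Lemma segment_F_R f r : F_R f -> F_R (segment f r).
Proof.
move=> fR s t st; rewrite /segment (fR _ _ st) rmorphD rmorph1 rmorphM rmorphB rmorph1.
by congr (_ + _ * _); apply/esym; exact: conjc_real.
Qed.

Lemma segment_continuous f : continuous (segment f).
Proof.
apply: arch_continuous => t; apply: complex_continuousD; first exact: cst_continuous.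
by apply: complex_continuousM; [exact: real_complex_continuous|exact: cst_continuous].
Qed.

Lemma segment_F_R_plus f : F_R f ->
  (forall r, 0 <= r <= 1 -> forall t, segment f r t != 0) -> P f.
Proof.
move=> fR f0; exists (segment f @` `[0, 1]).
  split.
  - exists 0; first by rewrite /= in_itv /= lexx ler01.
    by apply/functional_extensionality_dep => t; rewrite /segment mul0r addr0.
  - move=> _ [r + <-]; rewrite /= in_itv /= => r01.
    by split; [exact: segment_F_R|exact: f0].
  - apply: connected_continuous_connected; first exact: segment_connected.
    by apply: continuous_subspaceT; exact: segment_continuous.
exists 1; first by rewrite /= in_itv /= lexx ler01.
by apply/functional_extensionality_dep => t; rewrite /segment mul1r addrC subrK.
Qed.

Definition arch_abs (f : arch_space R F) : arch_space R F := fun t => (cabs (f t))%:C%C.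

Lemma segment_abs f r t : F_R_units f -> 0 <= r <= 1 ->
  0 < 1 + r * (cabs (f t) - 1) /\
  segment (arch_abs f) r t = (1 + r * (cabs (f t) - 1))%:C%C.
Proof.
move=> [_ /(_ t) f0] /andP[r0 r1]; split.
  have : 0 < cabs (f t) by rewrite cabs_gt0.
  have [->|rn1] := eqVneq r 1; first by lra.
  have r1' : r < 1 by rewrite lt_neqAle rn1.
  move=> c0; have : 0 <= r * cabs (f t) by rewrite mulr_ge0 // ltW.
  by lra.
by rewrite /segment /arch_abs rmorphD rmorphM rmorphB rmorph1.
Qed.

Lemma F_R_plus_abs f : F_R_units f -> P (arch_abs f).
Proof.
move=> Uf; have [fR f0] := Uf; apply: segment_F_R_plus.
  move=> s t st; rewrite /arch_abs (fR _ _ st) cabsJ; apply/esym; exact: conjc_real.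
move=> r r01 t; have [h ->] := segment_abs t Uf r01.
by rewrite fmorph_eq0 gt_eqF.
Qed.

(** Polar decomposition: it makes acting on Y(N) by f, in the identity component, the same as acting
    by |f|. *)
Lemma compact_part_abs f : P f -> compact_part (fun t => arch_abs f t / f t).
Proof.
move=> Pf; have Uf := F_R_plus_units Pf; have [fR f0] := Uf; split.
  by apply: F_R_plusM; [exact: F_R_plus_abs|exact: F_R_plusV].
move=> t; rewrite cabsE cabsM cabsV cabs_real ger0_norm ?cabs_ge0 //.
by rewrite divff ?rmorph1 // cabs_eq0.
Qed.

(** The ball of radius 1 about 1 is star-shaped about 1 and consists of families without zero
    entries, so segments join its points to 1 inside the units. *)
Lemma F_R_plus_nbhs : exists2 A : set U, nbhs (arch_unit (F_R_units1 R F)) A &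
  forall a, A a -> P (set_val a).
Proof.
(* A neighbourhood in the product topology restricts only finitely many coordinates; the finite list
   [s] meets every embedding up to pointwise equality and thus controls all of them. *)
have [s [sall _]] := finite_embeddings R F.
exists [set a : U | forall t, cabs (set_val a t - 1) < 1].
  set o := arch_unit _; have FF : Filter (nbhs o) by exact: nbhs_filter.
  have : \forall a \near o, forall i : 'I_(\dim {:F}), cabs (set_val a (s i) - 1) < 1.
    apply: (@filter_forall _ _ _ (nbhs o)) => i.
    have c : {for o, continuous (fun a : U => cabs (set_val a (s i) - 1))}.
      apply: complex_continuous_abs; apply: complex_continuousB.
        exact: arch_unit_coord_continuous.
      exact: cst_continuous.
    have h : cabs (set_val o (s i) - 1) < 1.
      have -> : set_val o (s i) - 1 = 0 by exact: subrr.
      by have /eqP -> : cabs (0 : C) == 0 by rewrite cabs_eq0.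
    by apply: (c [set r | r < 1]); apply: open_nbhs_nbhs; split => //; exact: open_lt.
  apply: filterS => a h t; have [i ti] := sall t.
  have [aR _] := arch_unitP a.
  by rewrite (F_R_ext aR ti).
move=> a h; have [aR _] := arch_unitP a; apply: segment_F_R_plus => // r /andP[r0 r1] t.
apply/eqP => /eqP; rewrite /segment addr_eq0 => /eqP e.
have := h t; rewrite ltNge => /negP; apply.
have : cabs (r%:C%C * (set_val a t - 1)) = 1.
  by rewrite -[X in cabs X]opprK -e cabsN cabs1.
rewrite cabsM cabs_real ger0_norm // => <-.
by rewrite ler_piMl ?cabs_ge0.
Qed.
End IdentityComponent.

(** * Ideles and the space Y(N) *)

Section LevelGroup.
Variable F : fieldType.

Lemma completion_embM (v : finite_place F) a b :
  completion_emb v (a * b) = completion_emb v a * completion_emb v b.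
Proof.
rewrite /completion_emb -completion_piM; congr (\pi_(completion v) _).
exact/val_inj.
Qed.

Lemma completion_emb1 (v : finite_place F) : completion_emb v 1 = 1.
Proof. by rewrite /completion_emb -completion_pi1; congr (\pi_(completion v) _); exact/val_inj. Qed.

Lemma completion_embV (v : finite_place F) a : a != 0 ->
  completion_emb v a^-1 = (completion_emb v a)^-1.
Proof.
move=> a0; have e : completion_emb v a^-1 * completion_emb v a = 1.
  by rewrite -completion_embM mulVf // completion_emb1.
have ea0 : completion_emb v a != 0.
  by apply: contra_eq_neq e => ->; rewrite mulr0 eq_sym oner_neq0.
by rewrite -[RHS]mul1r -e mulfK.
Qed.

Lemma completion_emb_neq0 (v : finite_place F) a : a != 0 -> completion_emb v a != 0.
Proof.
move=> a0; apply/eqP => e; have : completion_emb v (a * a^-1) = 0 by rewrite completion_embM e mul0r.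
by rewrite divff // completion_emb1 => /eqP; rewrite oner_eq0.
Qed.

Lemma Ov_emb_ord (v : finite_place F) (n : int) a :
  completion_ge n (completion_emb v a) -> ord_ge v n a.
Proof.
move=> [s hs]; rewrite /completion_emb => /completionP/asboolP/(_ n)[M /(_ M (leqnn M)) h].
have -> : a = (a - s M) + s M by rewrite subrK.
exact: ord_geD.
Qed.

Lemma Ov_unitsV (v : finite_place F) (x : completion v) : Ov_units x -> Ov_units x^-1.
Proof. by move=> [x0 h1 h2]; split; rewrite ?invr_eq0 ?invrK. Qed.

Lemma local_ideal0 (v : finite_place F) I : @local_ideal F v I 0.
Proof. by exists 0%N, (fun=> 0), (fun=> 0); split=> [[]//|]; rewrite big_ord0. Qed.

Lemma local_idealD (v : finite_place F) I x y :
  @local_ideal F v I x -> @local_ideal F v I y -> @local_ideal F v I (x + y).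
Proof.
move=> [n [a [b [h ->]]]] [m [c [d [h' ->]]]]; exists (n + m)%N.
exists (fun i => match fintype.split i with inl j => a j | inr j => c j end).
exists (fun i => match fintype.split i with inl j => b j | inr j => d j end).
split=> [i|]; first by case: (fintype.split i).
rewrite big_split_ord; congr (_ + _); apply: eq_bigr => i _.
  by rewrite (unsplitK (inl i)).
by rewrite (unsplitK (inr i)).
Qed.

Lemma local_idealM (v : finite_place F) I x z :
  @local_ideal F v I x -> Ov z -> @local_ideal F v I (x * z).
Proof.
move=> [n [a [b [h ->]]]] Oz; exists n, a, (fun i => b i * z); split=> [i|].
  by have [Ia Ob] := h i; split=> //; exact: OvM.
by rewrite mulr_suml; apply: eq_bigr => i _; rewrite mulrA.
Qed.

Lemma level_units (I : set F) k (v : finite_place F) : level I k -> Ov_units (k v).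
Proof.
move=> /(_ v)[h1 h2]; have [d|/h2//] := pselect (divides v I).
by apply: one_plus_max_ideal; apply: (local_ideal_max d); exact: h1.
Qed.

Lemma level_neq0 (I : set F) k (v : finite_place F) : level I k -> k v != 0.
Proof. by move=> hk; have [] := level_units v hk. Qed.

Lemma level1 (I : set F) : level I (fun=> 1).
Proof. by move=> v; split=> _; rewrite ?subrr; [exact: local_ideal0|exact: Ov_units1]. Qed.

Lemma levelM (I : set F) k l : level I k -> level I l -> level I (fun v => k v * l v).
Proof.
move=> hk hl v; split=> [d|_]; last by apply: Ov_unitsM; exact: level_units.
have -> : k v * l v - 1 = (k v - 1) * l v + (l v - 1).
  by rewrite mulrBl mul1r addrA subrK.
apply: local_idealD; last exact: (hl v).1.
by apply: local_idealM; [exact: (hk v).1|have [] := level_units v hl].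
Qed.

Lemma levelV (I : set F) k : level I k -> level I (fun v => (k v)^-1).
Proof.
move=> hk v; split=> [d|_]; last by apply: Ov_unitsV; exact: level_units.
have k0 := level_neq0 v hk.
have -> : (k v)^-1 - 1 = (k v - 1) * (- (k v)^-1).
  by rewrite mulrN mulrBl divff // mul1r opprB.
apply: local_idealM; first exact: (hk v).1.
by apply: completion_geN; have [] := level_units v hk.
Qed.

Lemma level_eq (I : set F) k l : (forall v, k v = l v) -> level I k -> level I l.
Proof. by move=> e hk v; rewrite -e. Qed.

Lemma fidele_mul_finite (x y : finite_idele F) : finite_set [set v | ~ Ov_units (x v * y v)].
Proof.
apply: (@sub_finite_set _ _ ([set v | ~ Ov_units (x v)] `|` [set v | ~ Ov_units (y v)])).
  move=> v /= h; have [hx|] := pselect (Ov_units (x v)); last by left.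
  by right => hy; apply: h; exact: Ov_unitsM.
by rewrite finite_setU; split; exact: fidele_finite.
Qed.

Definition fidele_mul (x y : finite_idele F) : finite_idele F :=
  FiniteIdele (fun v => mulf_neq0 (fidele_neq0 x v) (fidele_neq0 y v)) (fidele_mul_finite x y).

Lemma fidele_inv_neq0 (x : finite_idele F) v : (x v)^-1 != 0.
Proof. by rewrite invr_eq0 fidele_neq0. Qed.

Lemma fidele_inv_finite (x : finite_idele F) : finite_set [set v | ~ Ov_units (x v)^-1].
Proof.
apply: sub_finite_set (fidele_finite x) => v /= h hx; apply: h; exact: Ov_unitsV.
Qed.

Definition fidele_inv (x : finite_idele F) : finite_idele F :=
  FiniteIdele (fidele_inv_neq0 x) (fidele_inv_finite x).

Lemma fidele_one_finite : finite_set [set v : finite_place F | ~ Ov_units (1 : completion v)].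
Proof. by apply: sub_finite_set (finite_set0 _) => v /=; apply; exact: Ov_units1. Qed.

Definition fidele_one : finite_idele F :=
  FiniteIdele (fun v => oner_neq0 (completion v)) fidele_one_finite.

Lemma fidele_mul_continuous (b : finite_idele F) : continuous (fidele_mul b).
Proof.
apply/continuousP => A; rewrite /open /= => oA x Ax; have [M hM h] := oA _ Ax.
exists M => // y hy; apply: h; apply: level_eq hy => v /=.
by rewrite invfM mulrACA divff ?fidele_neq0 // mul1r.
Qed.

Lemma fidele_level_open (N : set F) (x : finite_idele F) : nonzero_ideal N ->
  open [set y : finite_idele F | level N (fun v => y v / x v)].
Proof.
move=> hN; rewrite /open /= => y hy; exists N => // z hz /=.
apply: level_eq (levelM hz hy) => v; by rewrite mulrA divfK // fidele_neq0.
Qed.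
End LevelGroup.

(** * Cosets of ideles and the quotient Y(N) *)

Section Cosets.
Variables (R : realType) (F : fieldExtType rat).
Local Notation C := (complex_of R).
Local Notation U := (@F_R_units R F).
Local Notation I := (idele R F).

Lemma idele_ext (x y : I) : (forall t, arch_part x t = arch_part y t) ->
  (forall v, finite_part x v = finite_part y v) -> x = y.
Proof.
case: x y => [x1 x2] [y1 y2] /= h1 h2; congr (_, _); first exact: arch_unit_inj.
exact: finite_idele_ext.
Qed.

Definition arch_mul (a b : U) : U := arch_unit (F_R_unitsM (arch_unitP a) (arch_unitP b)).
Definition arch_inv (a : U) : U := arch_unit (F_R_unitsV (arch_unitP a)).
Definition arch_one : U := arch_unit (F_R_units1 R F).

Lemma arch_unit_neq0 (a : U) t : set_val a t != 0.
Proof. by have [_] := arch_unitP a. Qed.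

Definition idele_one : I := (arch_one, fidele_one F).
Definition idele_mul (c x : I) : I := (arch_mul c.1 x.1, fidele_mul c.2 x.2).
Definition idele_inv (c : I) : I := (arch_inv c.1, fidele_inv c.2).

Lemma idele_mul_continuous (c : I) : continuous (idele_mul c).
Proof.
have ca : continuous (arch_mul c.1).
  apply: arch_unit_continuous => t; apply: complex_continuousM; first exact: cst_continuous.
  exact: arch_unit_coord_continuous.
move=> x A [[P Q] /= [hP hQ] sPQ].
have hP' : nbhs x.1 (arch_mul c.1 @^-1` P) by exact: ca.
have hQ' : nbhs x.2 (fidele_mul c.2 @^-1` Q) by exact: (@fidele_mul_continuous _ c.2 x.2).
by exists (arch_mul c.1 @^-1` P, fidele_mul c.2 @^-1` Q) => // -[a b] [/= Pa Qb]; exact: sPQ.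
Qed.

Lemma idele_mulVK (c x : I) : idele_mul c (idele_mul (idele_inv c) x) = x.
Proof.
apply: idele_ext => [t|v] /=.
  exact: (mulVKf (arch_unit_neq0 c.1 t) (arch_part x t)).
by rewrite mulVKf // fidele_neq0.
Qed.

Lemma idele_mulC (c x : I) : idele_mul c x = idele_mul x c.
Proof. by apply: idele_ext => [t|v]; exact: mulrC. Qed.

Lemma idele_mulA (a b c : I) : idele_mul a (idele_mul b c) = idele_mul (idele_mul a b) c.
Proof. by apply: idele_ext => [t|v]; exact: mulrA. Qed.

Lemma idele_mul1 (x : I) : idele_mul idele_one x = x.
Proof. by apply: idele_ext => [t|v]; exact: mul1r. Qed.

Lemma idele_mulV (x : I) : idele_mul (idele_inv x) x = idele_one.
Proof.
by apply: idele_ext => [t|v]; [exact: (mulVf (arch_unit_neq0 x.1 t))|exact: mulVf (fidele_neq0 _ _)].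
Qed.

Lemma idele_div_inv (x y : I) : idele_mul (idele_inv (idele_mul x (idele_inv y))) x = y.
Proof.
have h (K : fieldType) (a b : K) : a != 0 -> (a / b)^-1 * a = b.
  by move=> a0; rewrite invf_div divfK.
apply: idele_ext => [t|v]; first exact: (h _ _ _ (arch_unit_neq0 x.1 t)).
exact: (h _ _ _ (fidele_neq0 x.2 v)).
Qed.

Definition act (a : U) (x : I) : I := (arch_mul a x.1, x.2).

Lemma act_continuous : continuous (fun z : U * I => act z.1 z.2).
Proof.
have cm : continuous (fun z : U * U => arch_mul z.1 z.2).
  apply: arch_unit_continuous => t; apply: complex_continuousM.
    move=> z; apply: (@continuous_comp _ _ _ fst (fun a : U => set_val a t : C)).
      exact: cvg_fst.
    exact: arch_unit_coord_continuous.
  move=> z; apply: (@continuous_comp _ _ _ snd (fun a : U => set_val a t : C)).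
    exact: cvg_snd.
  exact: arch_unit_coord_continuous.
move=> [a x] A [[P Q] /= [hP hQ] sPQ].
have [[P1 P2] /= [h1 h2] sP] := cm (a, x.1) P hP.
exists (P1, P2 `*` Q) => /=.
  split=> //; exists (P2, Q) => //=.
by move=> [a' [x1 x2]] [/= Pa [P2x Qx]]; apply: sPQ; split => //=; apply: (sP (a', x1)).
Qed.

Section Relation.
Variables (P : set (arch_space R F)) (N : set F).

(** The parameter [P] takes two values: [compact_part], for which this is equality in Y(N), and
    [F_R_plus], whose classes turn out to be open and closed and take the place of the components of
    Y(N). *)
Definition coset_rel (x y : I) : Prop := exists g u k, [/\ g != 0, P u, level N k,
  (forall t : embedding R F, arch_part y t = t g * arch_part x t * u t) &
  (forall v, finite_part y v = completion_emb v g * finite_part x v * k v)].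

Hypotheses (P1 : P (fun=> 1)) (PM : forall f g, P f -> P g -> P (fun t => f t * g t))
  (PV : forall f, P f -> P (fun t => (f t)^-1)) (PU : P `<=` @F_R_units R F).

Lemma coset_rel_refl x : coset_rel x x.
Proof.
exists 1, (fun=> 1), (fun=> 1); split=> //; first exact: oner_neq0.
- exact: level1.
- by move=> t; rewrite rmorph1 mul1r mulr1.
- by move=> v; rewrite completion_emb1 mul1r mulr1.
Qed.

Lemma coset_rel_sym x y : coset_rel x y -> coset_rel y x.
Proof.
move=> [g [u [k [g0 Pu Nk h1 h2]]]].
exists g^-1, (fun t => (u t)^-1), (fun v => (k v)^-1); split.
- by rewrite invr_eq0.
- exact: PV.
- exact: levelV.
- move=> t; have [_ u0] := PU Pu.
  by rewrite h1 fmorphV -[t g * _ * _]mulrA mulKf ?fmorph_eq0 // mulfK.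
- move=> v; rewrite h2 completion_embV // -[_ g * _ * _]mulrA mulKf ?completion_emb_neq0 //.
  by rewrite mulfK // (level_neq0 v Nk).
Qed.

Lemma coset_rel_trans x y z : coset_rel x y -> coset_rel y z -> coset_rel x z.
Proof.
move=> [g [u [k [g0 Pu Nk h1 h2]]]] [g' [u' [k' [g'0 Pu' Nk' h1' h2']]]].
exists (g' * g), (fun t => u t * u' t), (fun v => k v * k' v); split.
- by rewrite mulf_neq0.
- exact: PM.
- exact: levelM.
- by move=> t; rewrite h1' h1 rmorphM !mulrA.
- by move=> v; rewrite h2' h2 completion_embM !mulrA.
Qed.

Lemma coset_rel_mul c x y : coset_rel x y -> coset_rel (idele_mul c x) (idele_mul c y).
Proof.
move=> [g [u [k [g0 Pu Nk h1 h2]]]]; exists g, u, k; split=> // [t|v].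
  have e z : arch_part (idele_mul c z) t = set_val c.1 t * arch_part z t by [].
  by rewrite !e h1 !mulrA [_ * t g]mulrC.
have e z : finite_part (idele_mul c z) v = c.2 v * finite_part z v by [].
by rewrite !e h2 !mulrA [_ * completion_emb v g]mulrC.
Qed.
End Relation.

Lemma compact_part_units : @compact_part R F `<=` @F_R_units R F.
Proof. by move=> u [/F_R_plus_units]. Qed.

Lemma compact_part1 : @compact_part R F (fun=> 1).
Proof. by split=> [|t]; rewrite ?normr1 //; exact: F_R_plus1. Qed.

Lemma compact_partM f g : @compact_part R F f -> @compact_part R F g ->
  @compact_part R F (fun t => f t * g t).
Proof.
by move=> [Pf f1] [Pg g1]; split=> [|t]; rewrite ?normrM ?f1 ?g1 ?mulr1 //; exact: F_R_plusM.
Qed.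

Lemma compact_partV f : @compact_part R F f -> @compact_part R F (fun t => (f t)^-1).
Proof.
by move=> [Pf f1]; split=> [|t]; rewrite ?normfV ?f1 ?invr1 //; exact: F_R_plusV.
Qed.

Section Quotient.
Variable N : set F.
Local Notation YN := (Y R N).
Local Notation rel := (coset_rel (@compact_part R F) N).

Let rel_sym x y : rel x y -> rel y x.
Proof. exact: (coset_rel_sym compact_partV compact_part_units). Qed.

Let rel_trans x y z : rel x y -> rel y z -> rel x z.
Proof. exact: (coset_rel_trans compact_partM). Qed.

Lemma Y_classP (x y : I) : Y_class N x = Y_class N y <-> rel x y.
Proof.
have E : (Y_class N x = Y_class N y) <-> idele_coset N x = idele_coset N y.
  by split=> [/eqmodP/asboolP //|e]; apply/eqmodP/asboolP.
rewrite E; split=> [e|xy].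
  have : rel y y by apply: coset_rel_refl; exact: compact_part1.
  by rewrite -[rel y]/(idele_coset N y) -e.
apply/seteqP; split=> z; first exact/rel_trans/rel_sym.
exact: rel_trans.
Qed.

Lemma Y_reprK (y : YN) : Y_class N (Y_repr y) = y.
Proof. exact: reprK. Qed.

Lemma Y_class_continuous : continuous (Y_class N : I -> YN).
Proof. exact: pi_continuous. Qed.

Lemma Y_openE (A : set YN) : open A <-> open (Y_class N @^-1` A).
Proof. by []. Qed.

(** The fibres of [Y_class] are cosets of a group of ideles, so the saturation of A is a union of
    translates of A. *)
Lemma Y_class_open (A : set I) : open A -> open (Y_class N @` A).
Proof.
move=> oA; apply/Y_openE.
have -> : Y_class N @^-1` (Y_class N @` A) =
    \bigcup_(c in [set c | rel idele_one c]) (idele_mul (idele_inv c) @^-1` A).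
  apply/seteqP; split=> [z [y Ay /Y_classP yz]|z [c /= c1 Acz]].
    exists (idele_mul z (idele_inv y)); last by rewrite /= idele_div_inv.
    by have := coset_rel_mul (idele_inv y) yz; rewrite idele_mulV idele_mulC.
  exists (idele_mul (idele_inv c) z) => //; apply/Y_classP.
  have := coset_rel_mul (idele_mul (idele_inv c) z) c1.
  by rewrite (idele_mulC _ idele_one) idele_mul1 (idele_mulC _ c) idele_mulVK.
apply: bigcup_open => c _.
by move/continuousP : (@idele_mul_continuous (idele_inv c)); apply.
Qed.

Lemma act_mul a x : act a x = idele_mul (a, fidele_one F) x.
Proof. by apply: idele_ext => // v; rewrite /= mul1r. Qed.

Definition Y_act (a : U) (y : YN) : YN := Y_class N (act a (Y_repr y)).

Lemma Y_actE a x : Y_act a (Y_class N x) = Y_class N (act a x).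
Proof.
apply/Y_classP; rewrite !act_mul; apply: coset_rel_mul.
by apply/Y_classP; rewrite Y_reprK.
Qed.

(** The product of a quotient map with an identity need not be a quotient map. Openness of [Y_class]
    is used instead, to lift points near e(t0) to ideles near a representative. *)
Lemma Y_act_continuous (T : topologicalType) (a : T -> U) (e : T -> YN) :
  continuous a -> continuous e -> continuous (fun t => Y_act (a t) (e t)).
Proof.
move=> ca ce t0 O; rewrite (@nbhsE YN) => -[O' [oO' O't0] sO].
pose x0 := Y_repr (e t0).
have : nbhs (a t0, x0) [set z : U * I | O' (Y_class N (act z.1 z.2))].
  apply: (@continuous_comp _ _ _ (fun z : U * I => act z.1 z.2) (Y_class N) (a t0, x0)).
  - exact: act_continuous.
  - exact: Y_class_continuous.
  - exact: open_nbhs_nbhs.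
move=> [[A B] /= [hA]]; rewrite (@nbhsE I) => -[B' [oB' B'x0] sB] sAB.
have hB : nbhs (e t0) (Y_class N @` B').
  apply: open_nbhs_nbhs; split; first exact: Y_class_open.
  by exists x0 => //; exact: Y_reprK.
have FF : Filter (nbhs t0) by exact: nbhs_filter.
have hAB := @filterI _ (nbhs t0) FF _ _ (ca t0 A hA) (ce t0 _ hB).
apply: (@filterS _ (nbhs t0) FF _ _ _ hAB) => t /= [At [x B'x xe]].
by apply: sO; rewrite -xe Y_actE; apply: (sAB (a t, x)); split => //; exact: sB.
Qed.

Definition idele_fin (b : finite_idele F) : I := (arch_one, b).

Definition Y_mul_fun (b : finite_idele F) (y : YN) : YN :=
  Y_class N (idele_mul (idele_fin b) (Y_repr y)).

Lemma Y_mul_funE b x : Y_mul_fun b (Y_class N x) = Y_class N (idele_mul (idele_fin b) x).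
Proof.
by apply/Y_classP; apply: coset_rel_mul; apply/Y_classP; rewrite Y_reprK.
Qed.

Lemma Y_mul_continuous b : continuous (Y_mul_fun b).
Proof.
have h : continuous (fun x => Y_class N (idele_mul (idele_fin b) x)).
  move=> x; apply: (@continuous_comp _ _ _ (idele_mul (idele_fin b)) (Y_class N)).
    exact: idele_mul_continuous.
  exact: Y_class_continuous.
apply: (repr_comp_continuous h) => x y /eqP xy.
by apply/eqP; rewrite -!Y_mul_funE; congr Y_mul_fun.
Qed.

Definition Y_mul b : continuousType YN YN := mkcts (@Y_mul_continuous b).

Lemma Y_mulE b x : Y_mul b (Y_class N x) = Y_class N (idele_mul (idele_fin b) x).
Proof. exact: Y_mul_funE. Qed.

Lemma Y_mulM b c y : Y_mul b (Y_mul c y) = Y_mul (fidele_mul b c) y.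
Proof.
rewrite -[y]Y_reprK !Y_mulE idele_mulA; congr (Y_class N (idele_mul _ _)).
by apply: idele_ext => // t; exact: mul1r.
Qed.

Lemma Y_mul1 y : Y_mul (fidele_one F) y = y.
Proof.
rewrite -[y]Y_reprK Y_mulE -[Y_repr y in RHS]idele_mul1.
by congr (Y_class N (idele_mul _ _)).
Qed.

Definition fidele_single (v : finite_place F) (z : completion v) (z0 : z != 0) :=
  fidele_trans z0 (fidele_one F).

Lemma fidele_single_mul v (z : completion v) (z0 : z != 0) x :
  fidele_mul (fidele_single z0) x = fidele_trans z0 x.
Proof.
apply: finite_idele_ext => w; rewrite /= /fidele_trans_val.
have [<-|vw] := eqVneq v w; first by rewrite !dfwithin /= mulr1.
by rewrite !dfwithout //= mul1r.
Qed.

Lemma Y_trans_mul v (z : completion v) (z0 : z != 0) : Y_trans R z0 N = Y_mul (fidele_single z0).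
Proof.
apply/continuousEP => y; congr (Y_class N _).
apply: idele_ext => [t|w]; first exact/esym/mul1r.
by rewrite [RHS]/(fidele_mul (fidele_single z0) (Y_repr y).2 w) fidele_single_mul.
Qed.
End Quotient.

(** * Cosets of the identity component are open and closed in Y(N) *)

Section OpenCosets.
Variables (N : set F) (hN : nonzero_ideal N).
Local Notation YN := (Y R N).

(** Multiplication by the inverse of x reduces this to a neighbourhood of 1, where K(N) is open in
    the finite ideles. *)
Lemma idele_nbhs (A : set U) (x : I) : nbhs arch_one A ->
  \forall y \near x, exists a k, [/\ A a, level N k,
    (forall t, arch_part y t = arch_part x t * set_val a t) &
    (forall v, finite_part y v = finite_part x v * k v)].
Proof.
move=> hA; pose B := [set y : finite_idele F | level N (fun v => y v / fidele_one F v)].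
have hAB : nbhs idele_one (A `*` B).
  exists (A, B) => //=; split=> //; apply: open_nbhs_nbhs; split.
    exact: fidele_level_open.
  by apply: level_eq (level1 N) => v; rewrite divr1.
rewrite -(idele_mulV x) in hAB.
have := @idele_mul_continuous (idele_inv x) x _ hAB.
have FF : Filter (nbhs x) by exact: nbhs_filter.
apply: (@filterS _ (nbhs x) FF) => y [/= Aa Bb].
exists (arch_mul (idele_inv x).1 y.1), (fun v => (finite_part x v)^-1 * finite_part y v).
split=> //.
- by apply: level_eq Bb => v; rewrite divr1.
- move=> t; apply/esym; exact: (mulVKf (arch_unit_neq0 x.1 t)).
- by move=> v; rewrite mulVKf // fidele_neq0.
Qed.

Local Notation drel := (coset_rel (@F_R_plus R F) N).

Lemma drel_refl x : drel x x.
Proof. by apply: coset_rel_refl; exact: F_R_plus1. Qed.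
Lemma drel_sym x y : drel x y -> drel y x.
Proof. exact: (coset_rel_sym (@F_R_plusV R F) (@F_R_plus_units R F)). Qed.
Lemma drel_trans x y z : drel x y -> drel y z -> drel x z.
Proof. exact: (coset_rel_trans (@F_R_plusM R F)). Qed.

Lemma drel_class x y : Y_class N x = Y_class N y -> drel x y.
Proof.
by move=> /Y_classP[g [u [k [g0 [Pu _] Nk h1 h2]]]]; exists g, u, k.
Qed.

Lemma drel_nbhs x : \forall y \near x, drel x y.
Proof.
have [A hA AP] := F_R_plus_nbhs R F.
apply: filterS (idele_nbhs x hA) => y [a [k [Aa Nk h1 h2]]].
exists 1, (set_val a), k; split=> //; first exact: oner_neq0.
- exact: AP.
- by move=> t; rewrite rmorph1 mul1r.
- by move=> v; rewrite completion_emb1 mul1r.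
Qed.

Definition Y_drel (y z : YN) : Prop := drel (Y_repr y) (Y_repr z).

Lemma Y_drelE x z : drel x (Y_repr (Y_class N z)) <-> drel x z.
Proof.
have h : drel (Y_repr (Y_class N z)) z by apply: drel_class; rewrite Y_reprK.
by split=> h'; [exact: drel_trans h|exact/(drel_trans h')/drel_sym].
Qed.

Lemma Y_drel_open (x : I) : open [set z : YN | drel x (Y_repr z)].
Proof.
apply/Y_openE; rewrite openE => z /= /Y_drelE xz; rewrite /interior.
by apply: filterS (drel_nbhs z) => w zw /=; apply/Y_drelE; exact: drel_trans zw.
Qed.

Lemma Y_drel_closed (x : I) : open [set z : YN | ~ drel x (Y_repr z)].
Proof.
apply/Y_openE; rewrite openE => z /= xz; rewrite /interior.
apply: filterS (drel_nbhs z) => w zw /= /Y_drelE xw; apply: xz; apply/Y_drelE.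
exact/(drel_trans xw)/drel_sym.
Qed.

Lemma Y_drel_mul (b : finite_idele F) (x : I) (y : YN) : drel x (Y_repr y) ->
  drel (idele_mul (idele_fin b) x) (Y_repr (Y_mul N b y)).
Proof.
by rewrite -{2}[y]Y_reprK Y_mulE => h; apply/Y_drelE; exact: coset_rel_mul.
Qed.
End OpenCosets.

(** * The unit group E(N) *)

Section UnitGroup.
Variable N : set F.
Local Notation E := (@unit_group R F N).

(** An element of E(N) is a unit at every finite place, so neither it nor its inverse has a negative
    valuation, and both are integral by [exists_negative_place]. *)
Lemma unit_group_integer e : E e -> integer_units e.
Proof.
move=> [e0 _ Ne]; have vge v : 0 <= vord v e /\ 0 <= vord v e^-1.
  have [_ h1 h2] := level_units v Ne; split.
    by have := Ov_emb_ord h1; rewrite /ord_ge (negPf e0).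
  rewrite -completion_embV // in h2.
  by have := Ov_emb_ord h2; rewrite /ord_ge invr_eq0 (negPf e0).
split=> //; apply: contrapT => /exists_negative_place[v]; apply/negP; rewrite -leNgt.
  by have [] := vge v.
by have [] := vge v.
Qed.

Lemma unit_group1 : E 1.
Proof.
split; first exact: oner_neq0.
  have -> : (fun t : embedding R F => t 1) = (fun=> 1).
    by apply/functional_extensionality_dep => t; rewrite rmorph1.
  exact: F_R_plus1.
by apply: level_eq (level1 N) => v; rewrite completion_emb1.
Qed.

Lemma unit_groupM e f : E e -> E f -> E (e * f).
Proof.
move=> [e0 Pe Ne] [f0 Pf Nf]; split; first by rewrite mulf_neq0.
  have -> : (fun t : embedding R F => t (e * f)) = (fun t => t e * t f).
    by apply/functional_extensionality_dep => t; rewrite rmorphM.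
  exact: F_R_plusM.
by apply: level_eq (levelM Ne Nf) => v; rewrite completion_embM.
Qed.

Lemma unit_groupV e : E e -> E e^-1.
Proof.
move=> [e0 Pe Ne]; split; first by rewrite invr_eq0.
  have -> : (fun t : embedding R F => t e^-1) = (fun t => (t e)^-1).
    by apply/functional_extensionality_dep => t; rewrite fmorphV.
  exact: F_R_plusV.
by apply: level_eq (levelV Ne) => v; rewrite completion_embV.
Qed.

(** The cosets of the powers of a lie in a finite set, so two different powers have the same
    coset. *)
Lemma unit_group_power (d : nat) (a : F) : (@unit_quotient R F N #= `I_d)%card ->
  integer_units a -> exists2 m, (0 < m)%N & E (a ^+ m).
Proof.
move=> hd [a0 Oa Oai].
have aX m : integer_units (a ^+ m).
  have h b : ring_of_integers b -> ring_of_integers (b ^+ m).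
    move=> Ob; elim: m => [|m IH]; rewrite ?expr0 ?exprS; first exact: integral1.
    exact: integral_mul.
  by split; rewrite ?expf_neq0 // -?exprVn; exact: h.
have fin : finite_set (@unit_quotient R F N) by exists d.
have [i [j [ij e]]] : exists i j, (i < j)%N /\
    [set a ^+ i * e | e in E] = [set a ^+ j * e | e in E].
  apply: contrapT => nh; have : finite_set [set: nat].
    have f_in : [set: nat] `<=` (fun i : nat => [set a ^+ i * e | e in E]) @^-1` (@unit_quotient R F N).
      by move=> i _; exists (a ^+ i).
    apply: sub_finite_set f_in (finite_preimage _ fin) => i j _ _ e.
    by case: (ltngtP i j) => // ij; exfalso; apply: nh; [exists i, j|exists j, i].
  exact: infinite_nat.
have : [set a ^+ i * e | e in E] (a ^+ j).
  by rewrite e; exists 1; rewrite ?mulr1 //; exact: unit_group1.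
move=> [u Eu ue]; exists (j - i)%N; first by rewrite subn_gt0.
suff -> : a ^+ (j - i) = u by [].
by apply: (mulfI (expf_neq0 i a0)); rewrite ue -exprD subnKC // ltnW.
Qed.
End UnitGroup.
End Cosets.

(** * Singular simplices *)

Section SimplexMaps.
Variable R : realType.
Local Notation simplex := (@simplex R).

Definition bary n (t : simplex n) (i : 'I_n.+1) : R := val t ord0 i.

Lemma bary_ge0 n (t : simplex n) i : 0 <= bary t i.
Proof. by have /set_mem[h _] := valP t; exact: h. Qed.

Lemma bary_sum n (t : simplex n) : \sum_i bary t i = 1.
Proof. by have /set_mem[_ h] := valP t. Qed.

Lemma bary_le1 n (t : simplex n) i : bary t i <= 1.
Proof.
by rewrite -(bary_sum t) (bigD1 i) //= lerDl sumr_ge0 // => j _; exact: bary_ge0.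
Qed.

Lemma bary_inj n (s t : simplex n) : (forall i, bary s i = bary t i) -> s = t.
Proof. by move=> h; apply/val_inj/rowP. Qed.

Lemma bary_continuous n i : continuous (fun t : simplex n => bary t i).
Proof.
move=> t; apply: (@continuous_comp _ _ _ (val : simplex n -> _) (fun M : 'rV[R]_n.+1 => M ord0 i)).
  exact: initial_continuous.
exact: coord_continuous.
Qed.

Lemma simplex_continuous (X : topologicalType) n (f : X -> simplex n) :
  (forall i, continuous (fun x => bary (f x) i)) -> continuous f.
Proof.
move=> cf; apply/continuousP => _ [B oB <-].
suff c : continuous (fun x => val (f x)) by move/continuousP: c => /(_ _ oB).
move=> x A [P hP sPA]; have FF : Filter (nbhs x) by exact: nbhs_filter.
have h : \forall y \near x, forall j, P ord0 j (bary (f y) j).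
  by apply: (@filter_forall _ _ _ (nbhs x)) => j; apply: (cf j x); exact: hP.
by apply: filterS h => y hy; apply: sPA => i j; rewrite (ord1 i).
Qed.

Lemma bary_map m n (f : 'I_m.+1 -> 'I_n.+1) (t : simplex m) j :
  bary (simplex_map R f t) j = \sum_(i | f i == j) bary t i.
Proof. by rewrite /bary /= mxE. Qed.

Lemma simplex_map_comp l m n (f : 'I_l.+1 -> 'I_m.+1) (g : 'I_m.+1 -> 'I_n.+1) (t : simplex l) :
  simplex_map R g (simplex_map R f t) = simplex_map R (g \o f) t.
Proof.
apply: bary_inj => k; rewrite !bary_map; under eq_bigr do rewrite bary_map.
rewrite [RHS](partition_big f (fun j => g j == k)) //=.
by apply: eq_bigr => j /eqP <-; apply: eq_bigl => i; case: eqP => [->|]; rewrite ?eqxx ?andbF.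
Qed.

Lemma simplex_map_id n (t : simplex n) : simplex_map R id t = t.
Proof. by apply: bary_inj => k; rewrite bary_map big_pred1_eq. Qed.

Lemma bary_vertex n (i j : 'I_n.+1) : bary (simplex_vertex R i) j = (j == i)%:R.
Proof. by rewrite /bary /= mxE eqxx. Qed.

Lemma simplex_map_vertex m n (f : 'I_m.+1 -> 'I_n.+1) i :
  simplex_map R f (simplex_vertex R i) = simplex_vertex R (f i).
Proof.
apply: bary_inj => k; rewrite bary_map bary_vertex.
under eq_bigr do rewrite bary_vertex.
rewrite (eq_sym k); have [<-|ki] := eqVneq (f i) k.
  by rewrite (bigD1 i) //= eqxx big1 ?addr0 // => j /andP[_ /negPf ->].
rewrite big1 // => j /eqP jk; case: eqP => // ji.
by move: ki; rewrite -jk ji eqxx.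
Qed.

Definition simplex_of n (f : 'I_n.+1 -> R) (f0 : forall i, 0 <= f i) (f1 : \sum_i f i = 1) : simplex n.
Proof.
exists (\row_i f i); apply/mem_set; split=> [i|]; first by rewrite mxE.
by rewrite -f1; apply: eq_bigr => i _; rewrite mxE.
Defined.

Lemma bary_of n f (f0 : forall i, 0 <= f i) (f1 : \sum_i f i = 1) i :
  bary (@simplex_of n f f0 f1) i = f i.
Proof. by rewrite /bary /= mxE. Qed.

(** The projection of the line onto [0, 1], written with absolute values so that its continuity is
    immediate. *)
Definition clamp (r : R) : R := (`|r| - `|r - 1| + 1) / 2.

Lemma clamp_itv r : 0 <= clamp r <= 1.
Proof.
by rewrite /clamp; case: (ger0P r) => h1; case: (ger0P (r - 1)) => h2; apply/andP; split; lra.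
Qed.

Lemma clampE r : 0 <= r <= 1 -> clamp r = r.
Proof.
move=> /andP[r0 r1]; rewrite /clamp ger0_norm // ler0_norm; lra.
Qed.

Lemma clamp_continuous : continuous clamp.
Proof.
move=> r; apply: cvgM; last exact: cvg_cst.
apply: cvgD; last exact: cvg_cst.
apply: cvgB; apply: cvg_norm; first exact: cvg_id.
by apply: cvgB; [exact: cvg_id|exact: cvg_cst].
Qed.

Section Segment.
Variables (n : nat) (a b : simplex n) (r : R).
Hypothesis r01 : 0 <= r <= 1.

Let f i := (1 - r) * bary a i + r * bary b i.
Let f0 i : 0 <= f i.
Proof.
by have /andP[r0 r1] := r01; rewrite addr_ge0 // mulr_ge0 ?bary_ge0 // subr_ge0.
Qed.
Let f1 : \sum_i f i = 1.
Proof. by rewrite big_split /= -!mulr_sumr !bary_sum; ring. Qed.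

Definition simplex_segment : simplex n := simplex_of f0 f1.

Lemma bary_segment i : bary simplex_segment i = (1 - r) * bary a i + r * bary b i.
Proof. exact: bary_of. Qed.
End Segment.

(** Two points are joined by a segment, which [clamp] reparametrises over the whole line; the line
    is connected. *)
Lemma simplex_connected n (A : set (simplex n)) : open A -> open (~` A) ->
  forall a b, A a -> A b.
Proof.
move=> oA oAc a b Aa.
pose g r := simplex_segment a b (clamp_itv r).
have cg : continuous g.
  apply: simplex_continuous => i.
  have -> : (fun r => bary (g r) i) = (fun r => (1 - clamp r) * bary a i + clamp r * bary b i).
    by apply/funext => r; exact: bary_segment.
  move=> r; apply: cvgD; apply: cvgM; try exact: cvg_cst; last exact: clamp_continuous.
  by apply: cvgB; [exact: cvg_cst|exact: clamp_continuous].
have g0 : g 0 = a.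
  by apply: bary_inj => i; rewrite bary_segment clampE ?lexx ?ler01 // subr0 mul1r mul0r addr0.
have g1 : g 1 = b.
  by apply: bary_inj => i; rewrite bary_segment clampE ?lexx ?ler01 // subrr mul1r mul0r add0r.
have cR : connected [set: R] by apply/connected_intervalP.
suff e : g @^-1` A = [set: R] by rewrite -g1 -[A _]/((g @^-1` A) 1) e.
apply: cR.
- by exists 0; rewrite /= g0.
- by exists (g @^-1` A); rewrite ?setTI //; move/continuousP: cg; apply.
- exists (g @^-1` A); rewrite ?setTI //.
  have -> : g @^-1` A = ~` (g @^-1` (~` A)) by rewrite -preimage_setC setCK.
  by apply: open_closedC; move/continuousP: cg; apply.
Qed.
End SimplexMaps.

(** * Lifting maps to R/Z *)

Section Lifting.
Variable R : realType.
Local Notation simplex := (@simplex R).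

Definition near_int (e u : R) : Prop := exists m : int, `|u - m%:~R| < e.
(** The representative of u modulo Z in [-1/2, 1/2). *)
Definition round_part (u : R) : R := u - (Num.floor (u + 2^-1))%:~R.
(** A map to R/Z is represented by a real function that need not be continuous; this is continuity
    of the map to R/Z. *)
Definition modZ_continuous (T : topologicalType) (h : T -> R) : Prop :=
  forall t e, 0 < e -> \forall s \near t, near_int e (h s - h t).
Definition integral_valued (u : R) : Prop := exists m : int, u = m%:~R.

Lemma intr_small (m : int) : `|m%:~R : R| < 1 -> m = 0.
Proof.
by rewrite -intr_norm -[1]/(1%:~R) ltr_int -[_ < 1]/(`|m|%N < 1)%N ltnS leqn0 absz_eq0 => /eqP.
Qed.

Lemma round_part_int u : integral_valued (u - round_part u).
Proof. by exists (Num.floor (u + 2^-1)); rewrite /round_part subKr. Qed.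

Lemma round_part_small u : `|u| < 2^-1 -> round_part u = u.
Proof.
rewrite ltr_norml => /andP[h1 h2]; rewrite /round_part.
suff -> : Num.floor (u + 2^-1) = 0 by rewrite subr0.
apply/eqP; rewrite -[_ == _]/(Num.floor (u + 2^-1) == 0) floor_eq; apply/andP; split; lra.
Qed.

Lemma round_part_shift u (m : int) : round_part (u + m%:~R) = round_part u.
Proof.
by rewrite /round_part (addrAC u m%:~R 2^-1) (@floorDrz _ (u + 2^-1)) ?intr_int //
  intrKfloor rmorphD /=; ring.
Qed.

Lemma round_part_near e u : e <= 2^-1 -> near_int e u -> `|round_part u| < e.
Proof.
move=> he [m hm]; have -> : u = (u - m%:~R) + m%:~R by rewrite subrK.
rewrite round_part_shift round_part_small //; exact: lt_le_trans he.
Qed.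

Lemma near_intB e f u w : near_int e u -> near_int f w -> near_int (e + f) (u - w).
Proof.
move=> [m hm] [n hn]; exists (m - n); rewrite rmorphB /= opprB addrC addrA -addrA.
have -> : n%:~R - m%:~R + (u - w) = (u - m%:~R) - (w - n%:~R) :> R by ring.
by apply: le_lt_trans (ler_normB _ _) _; exact: ltrD.
Qed.

Lemma near_int_int e u w : integral_valued (u - w) -> near_int e w -> near_int e u.
Proof.
move=> [m hm] [n hn]; exists (m + n).
have -> : u - (m + n)%:~R = w - n%:~R :> R by rewrite rmorphD /= -hm; ring.
by [].
Qed.

Lemma modZ_continuous_comp (S T : topologicalType) (f : S -> T) (h : T -> R) :
  continuous f -> modZ_continuous h -> modZ_continuous (h \o f).
Proof. by move=> cf ch s e e0; exact: (cf s _ (ch (f s) e e0)). Qed.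

Lemma modZ_continuousB (T : topologicalType) (h h' : T -> R) :
  modZ_continuous h -> modZ_continuous h' -> modZ_continuous (fun t => h t - h' t).
Proof.
move=> ch ch' t e e0; have e2 : 0 < e / 2 by rewrite divr_gt0.
have FF : Filter (nbhs t) by exact: nbhs_filter.
apply: filterS2 (ch t _ e2) (ch' t _ e2) => s h1 h2.
have -> : h s - h' s - (h t - h' t) = (h s - h t) - (h' s - h' t) by ring.
by rewrite [e](splitr e); exact: near_intB.
Qed.

(** Values within 1/4 of an integer stay away from the half-integers, where [round_part] jumps. *)
Lemma round_part_continuous (T : topologicalType) (u : T -> R) :
  modZ_continuous u -> (forall t, near_int 4^-1 (u t)) ->
  continuous (fun t => round_part (u t)).
Proof.
move=> cu hu t; have FF : Filter (nbhs t) by exact: nbhs_filter.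
apply/cvgrPdist_lt => e e0; pose f := Num.min e 4^-1.
have f0 : 0 < f by rewrite lt_min e0 invr_gt0 ltr0n.
apply: filterS (cu t f f0) => s hs.
have r1 : `|round_part (u t)| < 4^-1 by apply: round_part_near (hu t); lra.
have r2 : `|round_part (u s)| < 4^-1 by apply: round_part_near (hu s); lra.
have : near_int f (round_part (u s) - round_part (u t)).
  apply: near_int_int hs; exists (Num.floor (u t + 2^-1) - Num.floor (u s + 2^-1)).
  by rewrite rmorphB /= /round_part; ring.
(* Both rounded values are smaller than 1/4 in absolute value and their difference is within 1/4 of
   m, so |m| < 3/4. *)
move=> [m hm]; have m0 : m = 0.
  apply: intr_small; have f4 : f <= 4^-1 by rewrite ge_min lexx orbT.
  move: r1 r2 hm; rewrite !ltr_norml => /andP[a1 a2] /andP[b1 b2] /andP[c1 c2].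
  by apply/andP; split; lra.
rewrite distrC; move: hm; rewrite m0 subr0 => /lt_le_trans; apply.
by rewrite ge_min lexx.
Qed.

Lemma simplex_nbhs n (t : simplex n) A : nbhs t A ->
  exists2 d, 0 < d & forall s : simplex n, (forall i, `|bary s i - bary t i| < d) -> A s.
Proof.
rewrite nbhsE => -[_ [[B oB <-] /= Bt] BA].
have : nbhs (set_val t : 'rV[R]_n.+1) B by exact: open_nbhs_nbhs.
move=> /nbhs_ballP[d /= d0 dB]; exists d => // s hs; apply: BA => /=; apply: dB; split=> // i j.
by rewrite (ord1 i) /ball /= distrC; exact: hs.
Qed.

Lemma simplex_compact n : compact (simplex n : set 'rV[R]_n.+1).
Proof.
apply: bounded_closed_compact.
  exists 1; split=> // M M1 t [t0 t1] /=; apply: le_trans (ltW M1).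
  rewrite [X in X <= _]mx_normrE; apply/bigmax_leP; split=> // -[i j] _ /=.
  rewrite (ord1 i) ger0_norm // -t1 (bigD1 j) //= lerDl sumr_ge0 //.
have -> : simplex n = (\bigcap_i [set t | 0 <= t ord0 i]) `&`
    [set t | \sum_i t ord0 i = 1] :> set 'rV[R]_n.+1.
  apply/seteqP; split=> t /=; first by move=> [t0 t1]; split=> // i _; exact: t0.
  by move=> [t0 t1]; split=> // i; exact: t0.
apply: closedI.
  apply: closed_bigI => i _.
  refine (@preimage_closed _ _ (fun t : 'rV[R]_n.+1 => t ord0 i) [set x | 0 <= x] _ _).
    by move=> t _; exact: coord_continuous.
  exact: closed_ge.
refine (@preimage_closed _ _ (fun t : 'rV[R]_n.+1 => \sum_i t ord0 i) [set x | x = 1] _ _);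
  last exact: closed_eq.
move=> t _; have cD : continuous (fun z : R^o * R^o => z.1 + z.2) by exact: add_continuous.
by refine (@continuous_big R _ _ _ _ cD _ _ _ _ t) => i _; exact: coord_continuous.
Qed.

(** The Heine-Cantor theorem for maps from a simplex to R/Z. *)
Lemma modZ_uniform n (h : simplex n -> R) e : modZ_continuous h -> 0 < e ->
  exists2 d, 0 < d & forall s t : simplex n, (forall i, `|bary s i - bary t i| < d) ->
    near_int e (h s - h t).
Proof.
move=> ch e0; have e2 : 0 < e / 2 by rewrite divr_gt0.
pose P (d : R) (x : 'rV[R]_n.+1) := forall s t : simplex n, val s = x ->
  (forall i, `|bary s i - bary t i| < d) -> near_int e (h s - h t).
have /compact_near_coveringP cover := @simplex_compact n.
have hW : \forall d \near 0^'+, simplex n `<=` P d.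
  apply: cover => x Kx; pose x' : simplex n := exist _ x (mem_set Kx).
  have [d d0 hd] := simplex_nbhs (ch x' _ e2).
  have d2 : 0 < d / 2 by rewrite divr_gt0.
  exists ([set y : 'rV[R]_n.+1 | forall i, `|y ord0 i - x ord0 i| < d / 2], [set r | r < d / 2]) => /=.
    split; last by exact: nbhs_right_lt.
    apply: (@filter_forall _ _ _ (nbhs x)) => i.
    have /cvgrPdist_lt/(_ _ d2) := @coord_continuous R 1 n.+1 ord0 i x.
    by apply: filterS => s; rewrite distrC.
  move=> [y r] /= [hy hr] s t sy hst.
  have h1 : near_int (e / 2) (h s - h x').
    apply: hd => i; apply: lt_trans (_ : d / 2 < d); last by lra.
    by have := hy i; rewrite -sy.
  have h2 : near_int (e / 2) (h t - h x').
    apply: hd => i; have := hst i; have := hy i; rewrite -sy /bary.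
    set a := val s ord0 i; set b := val t ord0 i; set c := x ord0 i => k1 k2.
    have -> : b - val x' ord0 i = (b - a) + (a - c) by rewrite /c /=; ring.
    apply: le_lt_trans (ler_normD _ _) _; rewrite distrC.
    by move: (lt_trans k2 hr) k1; lra.
  have -> : h s - h t = (h s - h x') - (h t - h x') by ring.
  by rewrite [e](splitr e); exact: near_intB.
have [d [d0 hd]] := filter_ex (filterI (nbhs_right_gt 0) hW).
exists d => // s t; apply: (hd (val s)) => //; exact/set_mem/valP.
Qed.

(* The lift adds up the small differences of h along M.+1 steps from a vertex. *)
Theorem lift_exists n (h : simplex n -> R) : modZ_continuous h ->
  exists2 H : simplex n -> R, continuous H & forall t, integral_valued (H t - h t).
Proof.
move=> ch; have e4 : 0 < 4^-1 :> R by rewrite invr_gt0 ltr0n.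
have [d d0 hd] := modZ_uniform ch e4.
(* One of M+1 equal steps along a segment changes each barycentric coordinate by less than d. *)
have [M hM] : exists M : nat, d^-1 < M.+1%:R.
  by exists (Num.truncn d^-1); exact: truncnS_gt.
pose v0 : simplex n := simplex_vertex R ord0.
pose q j := clamp (j%:R / M.+1%:R : R).
pose x j t := simplex_segment v0 t (clamp_itv (j%:R / M.+1%:R)).
have qE j : (j <= M.+1)%N -> q j = j%:R / M.+1%:R.
  move=> jM; rewrite /q clampE // divr_ge0 ?ler0n //= ler_pdivrMr ?ltr0n // mul1r.
  by rewrite ler_nat.
have xE j t i : bary (x j t) i = (1 - q j) * bary v0 i + q j * bary t i.
  exact: bary_segment.
have cx j : continuous (x j).
  apply: simplex_continuous => i.
  have -> : (fun t => bary (x j t) i) = (fun t => (1 - q j) * bary v0 i + q j * bary t i).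
    by apply/funext => t; exact: xE.
  move=> t; have FF : Filter (nbhs t) by exact: nbhs_filter.
  by apply: cvgD; apply: cvgM; try exact: cvg_cst; exact: bary_continuous.
pose u j t := h (x j.+1 t) - h (x j t).
have nu j t : (j < M.+1)%N -> near_int 4^-1 (u j t).
  move=> jM; apply: hd => i; rewrite !xE !qE //; last exact: ltnW.
  have -> : (1 - j.+1%:R / M.+1%:R) * bary v0 i + j.+1%:R / M.+1%:R * bary t i -
    ((1 - j%:R / M.+1%:R) * bary v0 i + j%:R / M.+1%:R * bary t i) =
    M.+1%:R^-1 * (bary t i - bary v0 i).
    by rewrite -[j.+1]addn1 natrD; move: (M.+1%:R^-1 : R) => c; ring.
  rewrite normrM ger0_norm ?invr_ge0 ?ler0n //.
  apply: le_lt_trans (_ : M.+1%:R^-1 * 1 < d).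
    rewrite ler_wpM2l ?invr_ge0 ?ler0n // ler_norml.
    have := bary_ge0 t i; have := bary_le1 t i; have := bary_ge0 v0 i; have := bary_le1 v0 i.
    by move=> *; apply/andP; split; lra.
  by rewrite mulr1 invf_plt // posrE ?ltr0n.
exists (fun t => h v0 + \sum_(j < M.+1) round_part (u j t)).
  move=> t; have FF : Filter (nbhs t) by exact: nbhs_filter.
  apply: cvgD; first exact: cvg_cst.
  have cD : continuous (fun z : R^o * R^o => z.1 + z.2) by exact: add_continuous.
  refine (@continuous_big R _ _ _ _ cD _ _ _ _ t) => j _.
  apply: round_part_continuous => [|s]; last exact: nu.
  by apply: modZ_continuousB; apply: modZ_continuous_comp ch.
move=> t; have e : \sum_(j < M.+1) u j t = h t - h v0.
  rewrite -(big_mkord predT (u^~ t)) telescope_sumr //; congr (h _ - h _).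
    by apply: bary_inj => i; rewrite xE qE // divff ?pnatr_eq0 // subrr mul0r mul1r add0r.
  by apply: bary_inj => i; rewrite xE qE // mul0r subr0 mul1r mul0r addr0.
have -> : h v0 + \sum_(j < M.+1) round_part (u j t) - h t =
   - \sum_(j < M.+1) (u j t - round_part (u j t)).
  by rewrite [in RHS]sumrB e; ring.
elim/big_ind: _ => [|y z [m ym] [l zl]|j _].
- by exists 0; rewrite oppr0.
- by exists (m + l); rewrite opprD ym zl rmorphD.
- by have [m ->] := round_part_int (u j t); exists (- m); rewrite rmorphN.
Qed.

(** A continuous function with integral values is locally constant, and a simplex is connected. *)
Lemma lift_unique n (H : simplex n -> R) : continuous H ->
  (forall t, integral_valued (H t)) -> forall s t, H s = H t.
Proof.
move=> cH iH s t.
have near_eq a : \forall b \near a, H b = H a.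
  have /cvgrPdist_lt/(_ 1 ltr01) := cH a.
  have FF : Filter (nbhs a) by exact: nbhs_filter.
  apply: filterS => b; have [m ->] := iH a; have [l ->] := iH b.
  by rewrite -rmorphB => /intr_small/eqP; rewrite subr_eq0 => /eqP ->.
pose A := [set b | H s = H b].
apply: (@simplex_connected R n A _ _ s) => //; rewrite openE => a /= Aa; rewrite /interior.
  by apply: filterS (near_eq a) => b e; rewrite /A /= e.
by apply: filterS (near_eq a) => b e; rewrite /A /= e.
Qed.

Section Winding.
Variables (X : topologicalType) (theta : X -> R).
Hypothesis ctheta : modZ_continuous theta.

Local Notation v0 := (simplex_vertex R (ord0 : 'I_2)).
Local Notation v1 := (simplex_vertex R (ord_max : 'I_2)).

(** For a path that is not a loop, subtracting the difference of the chosen values of theta turns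
    the increment of a lift into an integer. That integer depends on theta as a real function; for a
    loop the correction vanishes and only the map to R/Z matters. *)
Definition winding (e : continuousType (simplex 1) X) : int :=
  xget 0 [set m : int | exists H : simplex 1 -> R, [/\ continuous H,
    forall t, integral_valued (H t - theta (e t)) &
    m%:~R = (H v1 - H v0) - (theta (e v1) - theta (e v0))]].

Lemma winding_lift (e : continuousType (simplex 1) X) (H : simplex 1 -> R) :
  continuous H -> (forall t, integral_valued (H t - theta (e t))) ->
  (winding e)%:~R = (H v1 - H v0) - (theta (e v1) - theta (e v0)).
Proof.
move=> cH iH; rewrite /winding; case: xgetP => [m _ [H' [cH' iH' ->]]|no].
  congr (_ - _); have : H' v1 - H v1 = H' v0 - H v0.
    apply: (@lift_unique 1 (fun t => H' t - H t)) => t.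
      have FF : Filter (nbhs t) by exact: nbhs_filter.
      by apply: cvgB; [exact: cH'|exact: cH].
    have [a ea] := iH t; have [b eb] := iH' t; exists (b - a).
    by rewrite rmorphB /= -ea -eb; ring.
  by lra.
have [a ea] := iH v1; have [b eb] := iH v0.
exfalso; apply: (no (a - b)); exists H; split=> //.
by rewrite rmorphB /= -ea -eb; ring.
Qed.

(** One lift over the whole triangle restricts to its three edges, and the contributions of the
    vertices cancel. *)
Lemma winding_cocycle (t : continuousType (simplex 2) X) :
  winding (sing_sub (face ord0) t) - winding (sing_sub (face 1) t) +
  winding (sing_sub (face ord_max) t) = 0.
Proof.
have ch : modZ_continuous (theta \o t) by apply: modZ_continuous_comp ctheta; exact: cts_fun.
have [H cH iH] := lift_exists ch.
have E (i : 'I_3) : (winding (sing_sub (face i) t))%:~R =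
    (H (simplex_vertex R (face i ord_max)) - H (simplex_vertex R (face i ord0)))
    - (theta (t (simplex_vertex R (face i ord_max))) - theta (t (simplex_vertex R (face i ord0)))).
  rewrite (@winding_lift _ (H \o simplex_map R (face i))).
  - by rewrite /sing_sub /= !simplex_map_vertex.
  - by move=> s; apply: continuous_comp; [exact: simplex_map_continuous|exact: cH].
  - by move=> s; exact: iH.
have f0m : face (ord0 : 'I_3) ord_max = ord_max by exact/val_inj.
have f00 : face (ord0 : 'I_3) ord0 = 1 by exact/val_inj.
have f1m : face (1 : 'I_3) ord_max = ord_max by exact/val_inj.
have f10 : face (1 : 'I_3) ord0 = ord0 by exact/val_inj.
have fmm : face (ord_max : 'I_3) ord_max = 1 by exact/val_inj.
have fm0 : face (ord_max : 'I_3) ord0 = ord0 by exact/val_inj.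
apply/eqP; rewrite -(intr_eq0 R) rmorphD rmorphB /= !E f0m f00 f1m f10 fmm fm0.
by apply/eqP; ring.
Qed.
End Winding.
End Lifting.

(** * Paths and squares *)

Section Paths.
Variables (R : realType) (X : topologicalType).
Local Notation simplex := (@simplex R).
Local Notation path := (continuousType (simplex 1) X).
Local Notation v0 := (simplex_vertex R (ord0 : 'I_2)).
Local Notation v1 := (simplex_vertex R (ord_max : 'I_2)).

Lemma simplex0_eq (s t : simplex 0) : s = t.
Proof.
apply: bary_inj => i; have := bary_sum s; have := bary_sum t.
by rewrite !big_ord1 (ord1 i) => -> ->.
Qed.

Lemma face0 : face (ord0 : 'I_2) ord0 = ord_max. Proof. exact/val_inj. Qed.
Lemma face1 : face (ord_max : 'I_2) ord0 = ord0. Proof. exact/val_inj. Qed.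

Definition unit_point (r : R) : simplex 1 := simplex_segment v0 v1 (clamp_itv r).

Lemma bary_unit_point (r : R) i : bary (unit_point r) i = if i == ord0 then 1 - clamp r else clamp r.
Proof.
rewrite bary_segment !bary_vertex; case: (altP (i =P ord0)) => [->|i0].
  by rewrite -[_ == ord_max]/false mulr1 mulr0 addr0.
have -> : i = ord_max by apply/val_inj; case: i i0 => -[|[|[]]].
by rewrite eqxx mulr0 mulr1 add0r.
Qed.

Lemma unit_point_bary (t : simplex 1) r : r = bary t ord_max -> unit_point r = t.
Proof.
move=> ->; apply: bary_inj => i; rewrite bary_unit_point clampE ?bary_ge0 ?bary_le1 //.
have := bary_sum t; rewrite big_ord_recl big_ord1 => e.
have e1 : fintype.lift ord0 (ord0 : 'I_1) = ord_max by exact/val_inj.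
case: (altP (i =P ord0)) => [->|i0]; first by rewrite -e e1 addrK.
by have -> : i = ord_max by apply/val_inj; case: i i0 => -[|[|[]]].
Qed.

Lemma unit_point_continuous : continuous unit_point.
Proof.
apply: simplex_continuous => i.
have -> : (fun r => bary (unit_point r) i) = (fun r => if i == ord0 then 1 - clamp r else clamp r).
  by apply/funext => r; exact: bary_unit_point.
case: eqP => _; last exact: clamp_continuous.
by move=> r; apply: cvgB; [exact: cvg_cst|exact: clamp_continuous].
Qed.

Section Horn.
Variables (e f : path).
Hypothesis ef : e v0 = f v0.

(* The filler is [t |-> glue (t_1 - t_2)]. *)
Let glue (r : R) : X := if 0 <= r then e (unit_point r) else f (unit_point (- r)).

Let glue_continuous : continuous glue.
Proof.
have ce : continuous (fun r => e (unit_point r)).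
  by move=> r; apply: continuous_comp; [exact: unit_point_continuous|exact: cts_fun].
have cf : continuous (fun r => f (unit_point (- r))).
  move=> r; apply: (@continuous_comp _ _ _ (fun r => unit_point (- r)) f); last exact: cts_fun.
  apply: continuous_comp; last exact: unit_point_continuous.
  by apply: cvgN; exact: cvg_id.
move=> r A; rewrite /glue; case: ltgtP => [r0|r0|r0] hA.
- have := ce r A hA; apply: filterS2 (open_nbhs_nbhs (conj (@open_gt R 0) r0)) => s s0 hs.
  by rewrite /= (ltW s0).
- have := cf r A hA; apply: filterS2 (open_nbhs_nbhs (conj (@open_lt R 0) r0)) => s s0 hs.
  by rewrite /= leNgt s0.
- rewrite -r0 in hA *; have hA' : nbhs (f (unit_point (- 0))) A.
    rewrite oppr0; have -> : unit_point 0 = v0 by apply: unit_point_bary; rewrite bary_vertex.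
    by rewrite -ef; have <- : unit_point 0 = v0 by apply: unit_point_bary; rewrite bary_vertex.
  have h1 : \forall s \near (0 : R), A (e (unit_point s)) by exact: ce.
  have h2 : \forall s \near (0 : R), A (f (unit_point (- s))) by exact: (cf 0).
  by apply: filterS2 h1 h2 => s k1 k2 /=; case: ifP.
Qed.

Let fill_fun (t : simplex 2) : X := glue (bary t 1 - bary t ord_max).
Let fill_continuous : continuous fill_fun.
Proof.
move=> t; apply: (@continuous_comp _ _ _ (fun t : simplex 2 => bary t 1 - bary t ord_max) glue);
  last exact: glue_continuous.
have FF : Filter (nbhs t) by exact: nbhs_filter.
by apply: cvgB; exact: bary_continuous.
Qed.

(** The remaining face of the triangle follows e backwards and then f. This gives composition of
    paths together with the cocycle relation for it. *)
Lemma horn_filler : exists t : continuousType (simplex 2) X,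
  sing_sub (face ord_max) t = e /\ sing_sub (face 1) t = f.
Proof.
pose T : continuousType (simplex 2) X := mkcts fill_continuous.
have f0 : face (ord_max : 'I_3) ord0 = ord0 by exact/val_inj.
have f1 : face (ord_max : 'I_3) ord_max = 1 by exact/val_inj.
have g0 : face (1 : 'I_3) ord0 = ord0 by exact/val_inj.
have g1 : face (1 : 'I_3) ord_max = ord_max by exact/val_inj.
have l1 : fintype.lift ord0 (ord0 : 'I_1) = ord_max :> 'I_2 by exact/val_inj.
have TE i (s : simplex 1) : sing_sub (face i) T s =
  glue (bary (simplex_map R (face i) s) 1 - bary (simplex_map R (face i) s) ord_max) by [].
have BE i j (s : simplex 1) : bary (simplex_map R (face i) s) j =
    (if face i ord0 == j then bary s ord0 else 0) +
    (if face i ord_max == j then bary s ord_max else 0).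
  rewrite bary_map big_mkcond big_ord_recl big_ord1.
  by have -> : fintype.lift ord0 (ord0 : 'I_1) = ord_max :> 'I_2 by exact/val_inj.
exists T; split; apply/continuousEP => s; rewrite TE !BE.
  rewrite f0 f1 /= !addr0 add0r subr0 /glue bary_ge0.
  by congr (e _); exact: unit_point_bary.
rewrite g0 g1 /= !add0r /glue oppr_ge0 opprK.
case: ifP => [h|_]; last by congr (f _); exact: unit_point_bary.
have b0 : bary s ord_max = 0 by apply/eqP; rewrite eq_le h bary_ge0.
have -> : unit_point (- bary s ord_max) = v0.
  by apply: unit_point_bary; rewrite bary_vertex b0 oppr0.
rewrite ef; congr (f _); rewrite -(@unit_point_bary s 0) // ?b0 //.
by apply/esym/unit_point_bary; rewrite bary_vertex.
Qed.
End Horn.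

Definition rev_path (e : path) : path := sing_sub (@rev_ord 2) e.

Lemma rev_path0 e : rev_path e v0 = e v1.
Proof.
by rewrite /rev_path /sing_sub /= simplex_map_vertex; congr (e (simplex_vertex R _)); exact/val_inj.
Qed.
Lemma rev_path1 e : rev_path e v1 = e v0.
Proof.
by rewrite /rev_path /sing_sub /= simplex_map_vertex; congr (e (simplex_vertex R _)); exact/val_inj.
Qed.

Definition const_simplex n (y : X) : continuousType (simplex n) X :=
  mkcts (@cst_continuous (simplex n) X y).

Lemma sing0_const (s : continuousType (simplex 0) X) : s = const_simplex 0 (s (simplex_vertex R ord0)).
Proof. by apply/continuousEP => t /=; congr (s _); exact: simplex0_eq. Qed.

Lemma path_face0 (e : path) : sing_sub (face ord0) e = const_simplex 0 (e v1).
Proof. by rewrite [LHS]sing0_const /sing_sub /= simplex_map_vertex face0. Qed.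
Lemma path_face1 (e : path) : sing_sub (face ord_max) e = const_simplex 0 (e v0).
Proof. by rewrite [LHS]sing0_const /sing_sub /= simplex_map_vertex face1. Qed.

Variable A : comNzRingType.
Local Notation cochain := (cochain R A X).

Lemma coboundary_path (c : cochain) (e : path) :
  coboundary c (sing e) = c (sing (const_simplex 0 (e v1))) - c (sing (const_simplex 0 (e v0))).
Proof.
rewrite /coboundary /= !big_ord_recl big_ord0 /= expr0 expr1 mul1r mulN1r addr0.
have -> : fintype.lift ord0 (ord0 : 'I_1) = ord_max :> 'I_2 by exact/val_inj.
by rewrite path_face0 path_face1.
Qed.

Lemma coboundary_triangle (c : cochain) (t : continuousType (simplex 2) X) :
  coboundary c (sing t) = c (sing (sing_sub (face ord0) t)) - c (sing (sing_sub (face 1) t))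
    + c (sing (sing_sub (face ord_max) t)).
Proof.
rewrite /coboundary /= !big_ord_recl big_ord0 /= !expr0 mul1r !exprS expr0
  mulr1 mulrN1 opprK mul1r mulN1r addr0 addrA.
have -> : fintype.lift ord0 (ord0 : 'I_2) = 1 :> 'I_3 by exact/val_inj.
by have -> : fintype.lift ord0 (fintype.lift ord0 (ord0 : 'I_1)) = ord_max :> 'I_3 by exact/val_inj.
Qed.

(** The square is cut along its diagonal into two triangles. In the difference of their cocycle
    relations the diagonal and the two equal sides swept by the base point cancel, which leaves the
    loops at the two ends of the homotopy. *)
Lemma square_loops (c : cochain) (Q : simplex 1 * simplex 1 -> X) (e f : path) :
  coboundary c = 0 -> continuous Q -> (forall s, Q (s, v0) = Q (s, v1)) ->
  (forall s, e s = Q (v0, s)) -> (forall s, f s = Q (v1, s)) -> c (sing e) = c (sing f).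
Proof.
move=> zc cQ loopQ eQ fQ.
have cT (g h : 'I_3 -> 'I_2) : continuous (fun t : simplex 2 => Q (simplex_map R g t, simplex_map R h t)).
  move=> t; apply: (@continuous_comp _ _ _ (fun t => (simplex_map R g t, simplex_map R h t)) Q);
    last exact: cQ.
  have FF : Filter (nbhs t) by exact: nbhs_filter.
  move=> B [[B1 B2] /= [hB1 hB2] sB].
  have h1 := simplex_map_continuous hB1; have h2 := simplex_map_continuous hB2.
  by apply: (@filterS2 _ (nbhs t) FF _ _ _ _ h1 h2) => s s1 s2; apply: sB.
pose a (i : 'I_3) : 'I_2 := if i == ord0 then ord0 else ord_max.
pose b (i : 'I_3) : 'I_2 := if i == ord_max then ord_max else ord0.
pose T := mkcts (cT a b); pose T' := mkcts (cT b a).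
have := congr1 (fun w => w (sing T)) zc; rewrite coboundary_triangle => h1.
have := congr1 (fun w => w (sing T')) zc; rewrite coboundary_triangle => h2.
have TE (s : simplex 1) i : sing_sub (face i) T s =
    Q (simplex_map R (a \o face i) s, simplex_map R (b \o face i) s).
  by rewrite -!simplex_map_comp.
have TE' (s : simplex 1) i : sing_sub (face i) T' s =
    Q (simplex_map R (b \o face i) s, simplex_map R (a \o face i) s).
  by rewrite -!simplex_map_comp.
have cst j (s : simplex 1) : simplex_map R (fun=> j) s = simplex_vertex R j.
  apply: bary_inj => i; rewrite bary_map bary_vertex (eq_sym i); case: eqP => _.
    by rewrite bary_sum.
  exact: big_pred0.
have ord2 (P : 'I_2 -> Prop) : P ord0 -> P ord_max -> forall i, P i.
  move=> p0 p1 i; case: (altP (i =P ord0)) => [->//|i0].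
  by have -> : i = ord_max by apply/val_inj; case: i i0 => -[|[|[]]].
have a0 : a \o face ord0 = (fun=> ord_max) by apply/funext => i; move: i; apply: ord2; apply/val_inj.
have b0 : b \o face ord0 = id by apply/funext => i; move: i; apply: ord2; apply/val_inj.
have a1 : a \o face 1 = id by apply/funext => i; move: i; apply: ord2; apply/val_inj.
have b1 : b \o face 1 = id by apply/funext => i; move: i; apply: ord2; apply/val_inj.
have a2 : a \o face ord_max = id by apply/funext => i; move: i; apply: ord2; apply/val_inj.
have b2 : b \o face ord_max = (fun=> ord0) by apply/funext => i; move: i; apply: ord2; apply/val_inj.
have E1 : sing_sub (face ord0) T = f.
  by apply/continuousEP => s; rewrite TE a0 b0 cst simplex_map_id fQ.
have E2 : sing_sub (face ord_max) T' = e.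
  by apply/continuousEP => s; rewrite TE' a2 b2 cst simplex_map_id eQ.
have E3 : sing_sub (face 1) T = sing_sub (face 1) T'.
  by apply/continuousEP => s; rewrite TE TE' a1 b1.
have E4 : sing_sub (face ord_max) T = sing_sub (face ord0) T'.
  by apply/continuousEP => s; rewrite TE TE' a0 b0 a2 b2 !cst simplex_map_id loopQ.
move: h1 h2; rewrite E1 E2 E3 E4; set u := c (sing (sing_sub (face 1) T')).
set w := c (sing (sing_sub (face ord0) T')) => h1 h2.
have : c (sing f) - u + w = w - u + c (sing e) by rewrite h1 h2.
by rewrite [RHS]addrC -addrA (addrC (- u)) => /addIr ->.
Qed.

End Paths.

(** * Cohomology in degrees 0 and 1 *)

Section Classes.
Variables (R : realType) (A : comNzRingType) (X : topologicalType).
Local Notation cochain := (cochain R A X).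
Local Notation cocycle := (cocycle R A X).
Local Notation H := (cohomology R A X).
Local Notation simplex := (@simplex R).
Local Notation v0 := (simplex_vertex R (ord0 : 'I_2)).
Local Notation v1 := (simplex_vertex R (ord_max : 'I_2)).

Lemma cocycleP (z : cocycle) : bounded_degree z /\ coboundary z = 0.
Proof. by case: z => z /= /asboolP. Qed.

Definition mk_cocycle (z : cochain) (bz : bounded_degree z) (dz : coboundary z = 0) : cocycle :=
  Cocycle (introT (asboolP _) (conj bz dz)).

Lemma class_eq (z w : cocycle) : cohomology_class z = cohomology_class w <->
  exists2 b : cochain, bounded_degree b & cocycle_val z - cocycle_val w = coboundary b.
Proof.
split=> [/lmod_quotP/asboolP[b bb e]|[b bb e]]; first by exists b.
by apply/lmod_quotP/asboolP; exists b.
Qed.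

Lemma class_linear : linear (@cohomology_class R A X).
Proof. exact: lmod_quot_pi_linear. Qed.

Lemma class0 : cohomology_class (0 : cocycle) = 0.
Proof. by have := class_linear (-1) 0 0; rewrite !scaleN1r !addNr. Qed.

Lemma class_repr (x : H) : cohomology_class (repr x) = x.
Proof. exact: reprK. Qed.

Lemma cohomology_degZ j (a : A) (x y : H) :
  cohomology_deg j x -> cohomology_deg j y -> cohomology_deg j (a *: x + y).
Proof.
move=> [z hz ->] [w hw ->]; exists (a *: z + w); last by rewrite class_linear.
move=> s js; change (a * cocycle_val z s + cocycle_val w s = 0).
by rewrite hz // hw // mulr0 addr0.
Qed.

Section Evaluation.
Variable s : singular R X.
Hypothesis closed_s : forall b : cochain, coboundary b s = 0.

(** It is independent of the chosen cocycle because all coboundaries vanish on s, as they do for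
    points and loops. *)
Definition evaluation (x : H) : A := cocycle_val (repr x) s.

Lemma evaluation_class (z : cocycle) : evaluation (cohomology_class z) = cocycle_val z s.
Proof.
have /class_eq[b _ e] := class_repr (cohomology_class z).
apply/eqP; rewrite -subr_eq0; apply/eqP.
by have := congr1 (fun c : cochain => c s) e; rewrite closed_s.
Qed.

Lemma evaluation_linear (a : A) (x y : H) :
  evaluation (a *: x + y) = a * evaluation x + evaluation y.
Proof. by rewrite -(class_repr x) -(class_repr y) -class_linear !evaluation_class. Qed.
End Evaluation.

Lemma closed_point (y : X) (b : cochain) : coboundary b (sing (const_simplex R 0 y)) = 0.
Proof. by []. Qed.

Lemma closed_loop (e : continuousType (simplex 1) X) (b : cochain) :
  e v0 = e v1 -> coboundary b (sing e) = 0.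
Proof. by move=> l; rewrite coboundary_path l subrr. Qed.

Lemma deg0_detect (x : H) : cohomology_deg 0 x ->
  (forall y, evaluation (sing (const_simplex R 0 y)) x = 0) -> x = 0.
Proof.
move=> [z hz ->] ev0.
have -> : z = 0.
  apply/val_inj/funext => -[[|n] s] /=; last by apply: hz.
  by have := ev0 (s (simplex_vertex R ord0)); rewrite evaluation_class // -sing0_const.
exact: class0.
Qed.

(** A cocycle that vanishes on loops takes equal values on paths with the same ends, so its values
    along paths from a base point of each path component define a primitive. *)
Lemma deg1_detect (x : H) : cohomology_deg 1 x ->
  (forall e : continuousType (simplex 1) X, e v0 = e v1 -> evaluation (sing e) x = 0) -> x = 0.
Proof.
move=> [z hz ->] ev0; have [_ dz] := cocycleP z.
have z_loop (e : continuousType (simplex 1) X) : e v0 = e v1 -> cocycle_val z (sing e) = 0.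
  by move=> l; have := ev0 e l; rewrite evaluation_class // => b; exact: closed_loop.
have triangle (t : continuousType (simplex 2) X) :
    cocycle_val z (sing (sing_sub (face ord0) t)) - cocycle_val z (sing (sing_sub (face 1) t))
    + cocycle_val z (sing (sing_sub (face ord_max) t)) = 0.
  by rewrite -coboundary_triangle dz.
have fill (e f : continuousType (simplex 1) X) : e v0 = f v0 ->
    exists g : continuousType (simplex 1) X, [/\ g v0 = e v1, g v1 = f v1 &
      cocycle_val z (sing g) = cocycle_val z (sing f) - cocycle_val z (sing e)].
  move=> /horn_filler[t [te tf]]; exists (sing_sub (face ord0) t).
  split; [rewrite -te|rewrite -tf|have := triangle t; rewrite te tf => /eqP].
  3: by rewrite -addrA addr_eq0 => /eqP ->; rewrite opprD opprK.
    by rewrite /sing_sub /= !simplex_map_vertex; congr (t (simplex_vertex R _)); exact/val_inj.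
  by rewrite /sing_sub /= !simplex_map_vertex; congr (t (simplex_vertex R _)); exact/val_inj.
have z_ends (e f : continuousType (simplex 1) X) : e v0 = f v0 -> e v1 = f v1 ->
    cocycle_val z (sing e) = cocycle_val z (sing f).
  move=> h0 h1; have [g [g0 g1]] := fill e f h0.
  by rewrite z_loop ?g0 ?g1 // => /esym/eqP; rewrite subr_eq0 => /eqP ->.
pose comp y : set X := [set b | exists e : continuousType (simplex 1) X, e v0 = b /\ e v1 = y].
have comp_refl y : comp y y by exists (const_simplex R 1 y).
have comp_sub (f : continuousType (simplex 1) X) : comp (f v0) `<=` comp (f v1).
  move=> b [e [e0 e1]]; have [g [g0 g1 _]] := fill (rev_path e) f (etrans (rev_path0 e) e1).
  by exists g; rewrite g0 g1 rev_path1.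
have comp_eq (f : continuousType (simplex 1) X) : comp (f v0) = comp (f v1).
  apply/seteqP; split; first exact: comp_sub.
  by have := comp_sub (rev_path f); rewrite rev_path0 rev_path1.
(* The base point is a function of the component as a set, so points joined by a path get the same
   one; the option covers the empty set. *)
have /choice[base hbase] : forall P : set X, exists b : option X,
    (exists y, P y) -> exists2 y, b = Some y & P y.
  move=> P; have [[y Py]|no] := pselect (exists y, P y); first by exists (Some y) => _; exists y.
  by exists None.
have /choice[pth hpth] : forall y, exists e : continuousType (simplex 1) X,
    base (comp y) = Some (e v0) /\ e v1 = y.
  move=> y; have [b eb [e [e0 e1]]] := hbase (comp y) (ex_intro _ y (comp_refl y)).
  by exists e; rewrite e0.
pose b : cochain := fun s => match s with
  | existT 0 t => cocycle_val z (sing (pth (t (simplex_vertex R ord0))))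
  | _ => 0 end.
have -> : cohomology_class z = cohomology_class 0.
  apply/class_eq; exists b; first by exists 1%N => -[[|n] s].
  rewrite subr0; apply/funext => -[[|[|n]] s].
  - by rewrite /= hz.
  - rewrite (coboundary_path b s) /b /=.
    have [p0 p1] := hpth (s v0); have [q0 q1] := hpth (s v1).
    have pq : pth (s v0) v0 = pth (s v1) v0.
      by apply: Some_inj; rewrite -p0 -q0 comp_eq.
    have [g [g0 g1 zg]] := fill _ _ pq.
    by rewrite -zg; apply: z_ends; rewrite ?g0 ?g1.
  - rewrite hz //= big1 // => i _; exact: mulr0.
exact: class0.
Qed.

(** The filtration by degree: Hecke operators need not be homogeneous, but they preserve it. *)
Definition cohomology_ge (j : nat) : set H := [set x | exists2 z : cocycle,
  (forall s, (projT1 s < j)%N -> cocycle_val z s = 0) & x = cohomology_class z].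

Lemma deg_ge j x : cohomology_deg j x -> cohomology_ge j x.
Proof. by move=> [z hz ->]; exists z => // s sj; apply: hz => e; rewrite e ltnn in sj. Qed.

Lemma cohomology_ge_lin j a x y : cohomology_ge j x -> cohomology_ge j y -> cohomology_ge j (a *: x + y).
Proof.
move=> [z hz ->] [w hw ->]; exists (a *: z + w); last by rewrite class_linear.
move=> s js; change (a * cocycle_val z s + cocycle_val w s = 0).
by rewrite hz // hw // mulr0 addr0.
Qed.

(** In degree j the cocycle z equals the coboundary of b, so the component of b of degree j - 1
    already has coboundary z; for j = 0 that component is zero. *)
Lemma deg_ge0 j x : cohomology_deg j x -> cohomology_ge j.+1 x -> x = 0.
Proof.
move=> [z hz ->] [w hw /class_eq[b [M hM] e]].
have zb s : projT1 s = j -> cocycle_val z s = coboundary b s.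
  move=> sj; rewrite -e; change (cocycle_val z s = cocycle_val z s - cocycle_val w s).
  by rewrite hw ?subr0 // sj.
pose b' : cochain := fun s => if (projT1 s).+1 == j then b s else 0.
have -> : cohomology_class z = cohomology_class 0.
  apply/class_eq; exists b'; first by exists M => s Ms; rewrite /b' hM // if_same.
  rewrite subr0; apply/funext => -[[|n] s].
    have [j0|/eqP nj] := eqVneq 0%N j; first by rewrite zb.
    by rewrite hz.
  have [nj|/eqP nj] := eqVneq n.+1 j.
    by rewrite zb //= /b' /=; apply: eq_bigr => i _; rewrite (introT eqP nj).
  rewrite hz //= big1 // => i _; rewrite /b' /=; case: eqP => // _; exact: mulr0.
exact: class0.
Qed.
End Classes.

(** * Pullback in cohomology *)

Section Pullback.
Variables (R : realType) (A : comNzRingType).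

Section OneMap.
Variables (X X' : topologicalType) (f : continuousType X X').

Lemma coboundary_pullback (c : cochain R A X') :
  coboundary (cochain_pullback f c) = cochain_pullback f (coboundary c).
Proof.
apply/funext => -[[|n] s] //=; apply: eq_bigr => i _; congr (_ * c (sing _)).
exact/continuousEP.
Qed.

Lemma pullback_cocycleP (z : cocycle R A X') :
  cochain_pullback f z \in @cocycle_pred R A X.
Proof.
have [[M hM] dz] := cocycleP z; apply/asboolP; split.
  by exists M => s Ms; rewrite /cochain_pullback hM.
by rewrite coboundary_pullback dz.
Qed.

Definition cocycle_pullback (z : cocycle R A X') : cocycle R A X :=
  Cocycle (pullback_cocycleP z).

Definition cohomology_pullback (x : cohomology R A X') : cohomology R A X :=
  cohomology_class (cocycle_pullback (repr x)).

Lemma cohomology_pullback_class z :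
  cohomology_pullback (cohomology_class z) = cohomology_class (cocycle_pullback z).
Proof.
have /class_eq[b [M hM] e] := class_repr (cohomology_class z).
apply/class_eq; exists (cochain_pullback f b).
  by exists M => s Ms; rewrite /cochain_pullback hM.
by rewrite coboundary_pullback -e.
Qed.

Lemma cohomology_pullback_linear : linear cohomology_pullback.
Proof.
move=> a x y; rewrite -(class_repr x) -(class_repr y) -class_linear !cohomology_pullback_class.
by rewrite -class_linear; congr cohomology_class; exact/val_inj.
Qed.

Lemma cohomology_pullback_deg j x : cohomology_deg j x -> cohomology_deg j (cohomology_pullback x).
Proof.
move=> [z hz ->]; exists (cocycle_pullback z); last exact: cohomology_pullback_class.
by move=> s sj; exact: hz.
Qed.

Lemma cohomology_pullback_ge j x : cohomology_ge j x -> cohomology_ge j (cohomology_pullback x).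
Proof.
move=> [z hz ->]; exists (cocycle_pullback z); last exact: cohomology_pullback_class.
by move=> s sj; exact: hz.
Qed.

Lemma evaluation_pullback (s : singular R X) (x : cohomology R A X') :
  (forall b, @coboundary R A X b s = 0) ->
  evaluation s (cohomology_pullback x) = evaluation (sing_push f s) x.
Proof.
by move=> cs; rewrite -{1}(class_repr x) cohomology_pullback_class evaluation_class.
Qed.
End OneMap.

Lemma cohomology_pullback_comp (X : topologicalType) (f g h : continuousType X X) x :
  (forall t, h t = f (g t)) ->
  cohomology_pullback h x = cohomology_pullback g (cohomology_pullback f x).
Proof.
move=> hE; rewrite -(class_repr x) !cohomology_pullback_class; congr cohomology_class.
apply/val_inj/funext => -[n s]; congr (cocycle_val (repr x) (sing _)).
by apply/continuousEP => t; exact: hE.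
Qed.

Lemma cohomology_pullback_id (X : topologicalType) (f : continuousType X X) x :
  (forall t, f t = t) -> cohomology_pullback f x = x.
Proof.
move=> fE; rewrite -{2}(class_repr x); congr cohomology_class.
apply/val_inj/funext => -[n s]; congr (cocycle_val (repr x) (sing _)).
by apply/continuousEP => t; exact: fE.
Qed.
End Pullback.

(** * The map to R/Z defined by units *)

Section AbsPath.
Variables (R : realType) (F : fieldExtType rat).
Variables (f : arch_space R F) (Uf : F_R_units f).
Local Notation C := (complex_of R).
Local Notation P := (@F_R_plus R F).

(** Each point of the segment from 1 to |f| is joined to 1 by the initial piece of the same
    segment. *)
Lemma segment_abs_plus r : 0 <= r <= 1 -> P (segment (arch_abs f) r).
Proof.
move=> /andP[r0 r1]; have [absR _] := F_R_plus_units (F_R_plus_abs Uf).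
apply: segment_F_R_plus; first exact: segment_F_R.
move=> q /andP[q0 q1] t.
have -> : segment (segment (arch_abs f) r) q t = segment (arch_abs f) (q * r) t.
  by rewrite /segment rmorphM /=; ring.
have qr : 0 <= q * r <= 1 by rewrite mulr_ge0 //= mulr_ile1.
by have [h ->] := segment_abs t Uf qr; rewrite fmorph_eq0 gt_eqF.
Qed.

Let itv (s : simplex R 1) : 0 <= bary s ord_max <= 1.
Proof. by rewrite bary_ge0 bary_le1. Qed.

Definition abs_path (s : simplex R 1) : @F_R_units R F :=
  arch_unit (F_R_plus_units (segment_abs_plus (itv s))).

Lemma abs_path_plus s : P (set_val (abs_path s)).
Proof. exact: segment_abs_plus. Qed.

Lemma abs_path_continuous : continuous abs_path.
Proof.
apply: arch_unit_continuous => t.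
move=> s; apply: (@continuous_comp _ _ _ (fun s : simplex R 1 => bary s ord_max)
  (fun r => segment (arch_abs f) r t : C)); first exact: bary_continuous.
apply: (@continuous_comp _ _ _ (segment (arch_abs f)) (fun g : arch_space R F => g t : C)).
  exact: segment_continuous.
exact: arch_coord_continuous.
Qed.

Lemma abs_path0 : abs_path (simplex_vertex R ord0) = arch_one R F.
Proof.
apply: arch_unit_inj => t.
change (segment (arch_abs f) (bary (simplex_vertex R ord0) (ord_max : 'I_2)) t = 1).
rewrite bary_vertex /segment; by rewrite -[_ == _]/false rmorph0 mul0r addr0.
Qed.

Lemma abs_path1 t : set_val (abs_path (simplex_vertex R ord_max)) t = arch_abs f t.
Proof.
change (segment (arch_abs f) (bary (simplex_vertex R ord_max) (ord_max : 'I_2)) t = arch_abs f t).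
by rewrite bary_vertex eqxx /segment rmorph1 mul1r addrC subrK.
Qed.
End AbsPath.

Section Theta.
Variables (R : realType) (F : fieldExtType rat) (N : set F).
Local Notation C := (complex_of R).
Local Notation U := (@F_R_units R F).
Local Notation I := (idele R F).
Local Notation E := (@unit_group R F N).
Local Notation emb e := (fun t : embedding R F => t e : C).

(** The logarithms of the absolute values of the conjugates send E(N) to a subgroup of R^n, where n
    is the degree of F. It is discrete because bounded logarithms bound the conjugates of integers,
    and nonzero because E(N) has finite index and so contains a power of a unit with some conjugate
    off the unit circle. *)
Lemma unit_functional (d : nat) : \dim {:F} <> 1%N -> ~ imaginary_quadratic R F ->
  (@unit_quotient R F N #= `I_d)%card ->
  exists lam : arch_space R F -> R, [/\
    forall f g, F_R_units f -> F_R_units g -> lam (fun t => f t * g t) = lam f + lam g,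
    forall f g, (forall t, cabs (f t) = cabs (g t)) -> lam f = lam g,
    continuous (fun a : U => lam (set_val a)),
    forall e, E e -> integral_valued (lam (emb e)) &
    exists2 e, E e & lam (emb e) = 1].
Proof.
move=> n1 niq hd; have [s [sall sfin]] := finite_embeddings R F.
pose lg (f : arch_space R F) : 'rV[R]_(\dim {:F}) := \row_i ln (cabs (f (s i))).
pose L : set 'rV[R]_(\dim {:F}) := [set lg (emb e) | e in E].
have pos z : (z : C) != 0 -> cabs z \is Num.pos by rewrite posrE cabs_gt0.
have lgM f g : F_R_units f -> F_R_units g -> lg (fun t => f t * g t) = lg f + lg g.
  by move=> [_ f0] [_ g0]; apply/rowP => i; rewrite !mxE cabsM lnM // pos.
have L0 : L 0.
  exists 1; first exact: unit_group1.
  by apply/rowP => i; rewrite !mxE rmorph1 cabs1 ln1.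
have LB x y : L x -> L y -> L (x - y).
  move=> [e Ee <-] [f Ef <-]; have [e0 _ _] := Ee; have [f0 _ _] := Ef.
  exists (e / f); first by apply: unit_groupM => //; exact: unit_groupV.
  by apply/rowP => i; rewrite !mxE rmorphM fmorphV cabsM cabsV ln_div ?pos ?fmorph_eq0.
have Ldisc (B : R) : exists M : nat, forall x : 'I_M.+1 -> 'rV[R]_(\dim {:F}),
    (forall i, L (x i) /\ forall j, `|x i 0 j| <= B) -> ~ injective x.
  have [M hM] := sfin (sequences.expR B); exists M => x hx xinj.
  have /choice[e he] : forall i, exists e, E e /\ lg (emb e) = x i.
    by move=> i; have [[e Ee <-] _] := hx i; exists e.
  apply: (hM e); last by move=> i j eij; apply: xinj; rewrite -!(proj2 (he _)) eij.
  move=> k; have [Ee ex] := he k; have [e0 Oe _] := unit_group_integer Ee; split=> // i.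
  have [_ /(_ i)] := hx k; rewrite -ex mxE ler_norml => /andP[_].
  move=> h; rewrite -[X in X <= _](@lnK R); first by rewrite ler_expR.
  by apply: pos; rewrite fmorph_eq0.
have [e0 Ue0 [t0 t0e]] := exists_nontorsion_unit n1 niq.
have [m m0 Em] := unit_group_power hd Ue0.
have Lx : L (lg (emb (e0 ^+ m))) by exists (e0 ^+ m).
have xn0 : lg (emb (e0 ^+ m)) != 0.
  have [i ti] := sall t0; apply/eqP => /rowP/(_ i); rewrite !mxE -ti rmorphXn.
  have [en0 _ _] := Ue0; have cp : 0 < cabs (t0 e0) by rewrite cabs_gt0 fmorph_eq0.
  have -> : cabs (t0 e0 ^+ m) = cabs (t0 e0) ^+ m.
    by elim: (m) => [|k IH]; rewrite ?expr0 ?cabs1 // !exprS cabsM IH.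
  rewrite lnXn // => /eqP; rewrite mulrn_eq0 -leqn0 leqNgt m0 /= => /eqP l0.
  by move: t0e; rewrite -(@lnK _ (cabs (t0 e0))) ?posrE // l0 expR0 eqxx.
have [l [y [e Ee <-] yl] lint] := integral_functional L0 LB Ldisc Lx xn0.
exists (fun f => (lg f *m l) 0 0); split.
- by move=> f g Uf Ug; rewrite lgM // mulmxDl mxE.
- move=> f g fg; suff -> : lg f = lg g by [].
  by apply/rowP => i; rewrite !mxE fg.
- have -> : (fun a : U => (lg (set_val a) *m l) 0 0) =
    (fun a : U => \sum_i ln (cabs (set_val a (s i))) * l i 0).
    by apply/funext => a; rewrite mxE; apply: eq_bigr => i _; rewrite mxE.
  have cD : continuous (fun z : R^o * R^o => z.1 + z.2) by exact: add_continuous.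
  have cln i : continuous (fun a : U => ln (cabs (set_val a (s i)))).
    move=> a; apply: (@continuous_comp U R R (fun a : U => cabs (set_val a (s i))) (@ln R)).
      by apply: complex_continuous_abs; exact: arch_unit_coord_continuous.
    by apply: continuous_ln; rewrite cabs_gt0 arch_unit_neq0.
  refine (@continuous_big R _ _ _ _ cD _ _ _ _) => i _ a.
  have FF : Filter (nbhs a) by exact: nbhs_filter.
  by apply: cvgM; [exact: cln|exact: cvg_cst].
- by move=> f Ef; apply: lint; exists f.
- by exists e.
Qed.

Variable lam : arch_space R F -> R.
Hypothesis lamM : forall f g, F_R_units f -> F_R_units g -> lam (fun t => f t * g t) = lam f + lam g.
Hypothesis lam_abs : forall f g, (forall t, cabs (f t) = cabs (g t)) -> lam f = lam g.
Hypothesis lam_continuous : continuous (fun a : U => lam (set_val a)).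
Hypothesis lam_unit : forall e, E e -> integral_valued (lam (emb e)).
Hypothesis lam_one : exists2 e, E e & lam (emb e) = 1.
Hypothesis hN : nonzero_ideal N.

Local Notation P := (@F_R_plus R F).
Local Notation drel := (coset_rel P N).
Local Notation YN := (Y R N).

Let lam1 : lam (fun=> 1) = 0.
Proof.
have := lamM (F_R_units1 R F) (F_R_units1 R F).
rewrite (_ : (fun t => _) = (fun=> 1)).
  by move/eqP; rewrite -subr_eq subrr eq_sym => /eqP.
by apply/functional_extensionality_dep => t; rewrite mulr1.
Qed.

Let lam_compact f : (forall t, `|f t| = 1) -> lam f = 0.
Proof.
move=> f1; rewrite -lam1; apply: lam_abs => t; apply: (complexI (R := R)).
by rewrite -!cabsE f1 normr1.
Qed.

Lemma intvalB (u w : R) : integral_valued u -> integral_valued w -> integral_valued (u - w).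
Proof. by move=> [m ->] [n ->]; exists (m - n); rewrite rmorphB. Qed.

Lemma intvalD (u w : R) : integral_valued u -> integral_valued w -> integral_valued (u + w).
Proof. by move=> [m ->] [n ->]; exists (m + n); rewrite rmorphD. Qed.

Lemma intvalN (u : R) : integral_valued u -> integral_valued (- u).
Proof. by move=> [m ->]; exists (- m); rewrite rmorphN. Qed.

Lemma ratio_eq (K : fieldType) (g h a b x : K) : g != 0 -> b != 0 -> x != 0 ->
  h * x * b = g * x * a -> h / g = a / b.
Proof.
move=> g0 b0 x0 e; apply: (mulIf x0); apply: (mulIf (mulf_neq0 g0 b0)).
transitivity (h * x * b); first by field.
by rewrite e; field.
Qed.

(* The relation defining the cosets of F_R_plus, with its archimedean component a
   made explicit. *)
Definition coset_via (x y : I) (a : arch_space R F) : Prop := exists g k,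
  [/\ g != 0, level N k, (forall t : embedding R F, arch_part y t = t g * arch_part x t * a t) &
   (forall v, finite_part y v = completion_emb v g * finite_part x v * k v)].

Lemma coset_via_drel x y a : P a -> coset_via x y a -> drel x y.
Proof. by move=> Pa [g [k [g0 Nk h1 h2]]]; exists g, a, k. Qed.

Lemma coset_via_trans x y z a b : coset_via x y a -> coset_via y z b ->
  coset_via x z (fun t => a t * b t).
Proof.
move=> [g [k [g0 Nk h1 h2]]] [g' [k' [g'0 Nk' h1' h2']]].
exists (g' * g), (fun v => k v * k' v); split.
- by rewrite mulf_neq0.
- exact: levelM.
- by move=> t; rewrite h1' h1 rmorphM; ring.
- by move=> v; rewrite h2' h2 completion_embM; ring.
Qed.

Lemma coset_via_mul c x y a : coset_via x y a -> coset_via (idele_mul c x) (idele_mul c y) a.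
Proof.
move=> [g [k h]]; have [|g' [a' [k' [g'0 -> Nk' h1 h2]]]] := @coset_rel_mul R F [set a] N c x y.
  by case: h => *; exists g, a, k.
by exists g', k'.
Qed.

(** Comparing the two relations shows that a/b is the image of g'/g, and that g'/g lies in K(N) at
    the finite places. So g'/g belongs to E(N), where lam is integral. *)
Lemma lam_coset_via x y a b : P a -> P b -> coset_via x y a -> coset_via x y b ->
  integral_valued (lam a - lam b).
Proof.
move=> Pa Pb [g [k [g0 Nk h1 h2]]] [g' [k' [g'0 Nk' h1' h2']]].
have ab : forall t : embedding R F, t (g' / g) = a t / b t.
  move=> t; have [_ b0] := F_R_plus_units Pb.
  have x0 : arch_part x t != 0 by exact: arch_unit_neq0.
  have tg0 : t g != 0 by rewrite fmorph_eq0.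
  rewrite rmorphM fmorphV; apply: (ratio_eq tg0 (b0 t) x0).
  by rewrite -h1' h1.
have Ee : E (g' / g).
  split; first by rewrite mulf_neq0 ?invr_eq0.
    have -> : emb (g' / g) = (fun t => a t * (b t)^-1).
      by apply/functional_extensionality_dep.
    by apply: F_R_plusM => //; exact: F_R_plusV.
  apply: level_eq (levelM Nk (levelV Nk')) => v.
  have k0 := level_neq0 v Nk; have k'0 := level_neq0 v Nk'; have x0 := fidele_neq0 (finite_part x) v.
  have cg0 := completion_emb_neq0 v g0.
  rewrite completion_embM completion_embV //; apply/esym/(ratio_eq cg0 k'0 x0).
  by rewrite -h2' h2.
have [m] := lam_unit Ee; have Ub := F_R_plus_units Pb.
have -> : emb (g' / g) = (fun t => a t * (b t)^-1) by apply/functional_extensionality_dep.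
rewrite lamM; [|exact: F_R_plus_units|exact: F_R_unitsV].
have := lamM Ub (F_R_unitsV Ub); rewrite (_ : (fun t => b t * _) = (fun=> 1)); last first.
  by apply/functional_extensionality_dep => t; rewrite divff //; case: Ub.
by rewrite lam1 => /esym/eqP; rewrite addrC addr_eq0 => /eqP -> h; exists m.
Qed.

(** The set handed to [xget] depends only on the class of x, so related ideles get the same base
    point. It contains x, so the default is never reached. *)
Definition coset_base (x : I) : I := xget (idele_one R F) [set y | drel x y].
(** The archimedean displacement a from the base point is determined up to E(N), so [lam a] is
    determined modulo integers. *)
Definition idele_phase (x : I) : R :=
  xget 0 [set l | exists2 a, P a & coset_via (coset_base x) x a /\ l = lam a].

Lemma coset_base_eq x y : drel x y -> coset_base x = coset_base y.
Proof.
move=> xy; congr xget; apply/seteqP; split=> z /= h.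
  exact: drel_trans (drel_sym xy) h.
exact: drel_trans h.
Qed.

Lemma idele_phaseE x : exists2 a, P a & coset_via (coset_base x) x a /\ idele_phase x = lam a.
Proof.
have [g [a [k [g0 Pa Nk h1 h2]]]] : drel (coset_base x) x.
  apply: drel_sym; rewrite /coset_base; case: xgetP => [y _ //|no].
  by exfalso; apply: (no x); exact: drel_refl.
rewrite /idele_phase; case: xgetP => [l _ [b Pb hb]|no]; first by exists b.
by exfalso; apply: (no (lam a)); exists a => //; split=> //; exists g, k.
Qed.

Lemma idele_phase_via x y a : P a -> coset_via x y a ->
  integral_valued (idele_phase y - idele_phase x - lam a).
Proof.
move=> Pa xy; have [b Pb [hb ->]] := idele_phaseE y; have [c Pc [hc ->]] := idele_phaseE x.
have [Ua Uc] := (F_R_plus_units Pa, F_R_plus_units Pc).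
rewrite (coset_base_eq (coset_via_drel Pa xy)) in hc.
have := lam_coset_via Pb (F_R_plusM Pc Pa) hb (coset_via_trans hc xy).
by rewrite lamM // opprD addrA.
Qed.

(** A real representative of the map theta from Y(N) to R/Z. *)
Definition phase (y : YN) : R := idele_phase (Y_repr y).

(** Passing from x to the representative of its class is a displacement by an element of U, on which
    lam vanishes. *)
Lemma phase_class x : integral_valued (phase (Y_class N x) - idele_phase x).
Proof.
have /Y_classP[g [u [k [g0 [Pu u1] Nk h1 h2]]]] : Y_class N x = Y_class N (Y_repr (Y_class N x)).
  by rewrite Y_reprK.
have via : coset_via x (Y_repr (Y_class N x)) u by exists g, k.
by have := idele_phase_via Pu via; rewrite lam_compact // subr0.
Qed.

Lemma phase_via x y a : P a -> coset_via x y a ->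
  integral_valued (phase (Y_class N y) - phase (Y_class N x) - lam a).
Proof.
move=> Pa xy.
have -> : phase (Y_class N y) - phase (Y_class N x) - lam a =
  (idele_phase y - idele_phase x - lam a) + (phase (Y_class N y) - idele_phase y)
   - (phase (Y_class N x) - idele_phase x) by ring.
apply: intvalB; last exact: phase_class.
by apply: intvalD; [exact: idele_phase_via|exact: phase_class].
Qed.

(** Near x an idele differs by an element of K(N), which does not change the phase modulo integers,
    and by an archimedean factor near 1, on which lam is small. *)
Lemma phase_continuous : modZ_continuous phase.
Proof.
move=> y e e0; set x := Y_repr y.
have [A hA AP] := F_R_plus_nbhs R F.
have hA' : \forall a \near arch_one R F, A a /\ `|lam (set_val a)| < e.
  apply: filterI hA _; have FF : Filter (nbhs (arch_one R F)) by exact: nbhs_filter.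
  have /cvgrPdist_lt/(_ e e0) := @lam_continuous (arch_one R F).
  apply: filterS => a; rewrite [X in X - _](_ : _ = 0); first by rewrite sub0r normrN.
  by rewrite -lam1; congr lam.
have hx := idele_nbhs hN x hA'.
have : nbhs x [set z : I | near_int e (phase (Y_class N z) - phase y)].
  have FF : Filter (nbhs x) by exact: nbhs_filter.
  apply: filterS hx => z [a [k [[Aa la] Nk h1 h2]]] /=.
  have via : coset_via x z (set_val a).
    exists 1, k; split=> // [|t|v]; first exact: oner_neq0.
      by rewrite rmorph1 mul1r h1.
    by rewrite completion_emb1 mul1r h2.
  have := phase_via (AP _ Aa) via; rewrite Y_reprK => /near_int_int; apply.
  by exists 0; rewrite subr0.
rewrite nbhsE => -[O [oO Ox] sO].
change (nbhs y [set s | near_int e (phase s - phase y)]); rewrite (@nbhsE YN).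
exists (Y_class N @` O); last by move=> _ [z Oz <-]; exact: (sO z Oz).
by split; [exact: Y_class_open|exists x; rewrite ?Y_reprK].
Qed.

(** The class of the starting point is open and closed, so a path cannot leave it. *)
Lemma path_drel (e : continuousType (simplex R 1) YN) s : Y_drel (e (simplex_vertex R ord0)) (e s).
Proof.
set y := e _; have oA := @Y_drel_open R F N hN (Y_repr y); have oB := @Y_drel_closed R F N hN (Y_repr y).
pose A := [set s : simplex R 1 | drel (Y_repr y) (Y_repr (e s))].
apply: (@simplex_connected R 1 A _ _ (simplex_vertex R ord0)).
- exact: (proj1 (continuousP e) (@cts_fun _ _ e) _ oA).
- exact: (proj1 (continuousP e) (@cts_fun _ _ e) _ oB).
- exact: drel_refl.
Qed.

Lemma winding_mul (b : finite_idele F) (e : continuousType (simplex R 1) YN) :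
  e (simplex_vertex R ord0) = e (simplex_vertex R ord_max) ->
  winding phase (Y_mul R N b \o e) = winding phase e.
Proof.
move=> loop; set y := e (simplex_vertex R ord0).
have [H cH iH] : exists2 H : simplex R 1 -> R,
    continuous H & forall t, integral_valued (H t - phase (e t)).
  apply: (lift_exists (h := phase \o e)); apply: modZ_continuous_comp phase_continuous; exact: cts_fun.
(* The archimedean displacement from the starting point is the same along e and along its translate,
   so a lift of the phase along e becomes one along the translate after adding the constant c. *)
pose c := phase (Y_mul R N b y) - phase y.
have iHb t : integral_valued (H t + c - phase ((Y_mul R N b \o e) t)).
  have [g [a [k [g0 Pa Nk h1 h2]]]] := path_drel e t.
  have via : coset_via (Y_repr y) (Y_repr (e t)) a by exists g, k.
  have viab : coset_via (idele_mul (idele_fin R b) (Y_repr y))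
      (idele_mul (idele_fin R b) (Y_repr (e t))) a.
    exact: coset_via_mul.
  have := phase_via Pa via; rewrite !Y_reprK => i1.
  have := phase_via Pa viab; rewrite -!Y_mulE !Y_reprK => i2.
  rewrite (_ : H t + c - _ = (H t - phase (e t)) + (phase (e t) - phase y - lam a)
    - (phase (Y_mul R N b (e t)) - phase (Y_mul R N b y) - lam a)); last by rewrite /c /=; ring.
  by apply: intvalB => //; apply: intvalD.
apply/eqP; rewrite -(eqr_int R) (winding_lift cH iH) (winding_lift _ iHb); last first.
  move=> t; have FF : Filter (nbhs t) by exact: nbhs_filter.
  by apply: cvgD; [exact: cH|exact: cvg_cst].
by rewrite /= -loop -/y !subrr !subr0; apply/eqP; ring.
Qed.

Lemma act_via a x : coset_via x (act a x) (set_val a).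
Proof.
exists 1, (fun=> 1); split=> [||t|v]; [exact: oner_neq0|exact: level1| |].
  by rewrite rmorph1 mul1r mulrC.
by rewrite completion_emb1 mul1r mulr1.
Qed.

(** Let u in E(N) have lam(u) = 1. The loop moves y along the segment from 1 to |u|; it closes up
    because |u|/u is in U and u, being in E(N), acts trivially on Y(N) through its archimedean
    component. Along it lam lifts the change of phase, and grows from 0 to 1. *)
Lemma winding_loop (y : YN) : exists e : continuousType (simplex R 1) YN,
  [/\ e (simplex_vertex R ord0) = y, e (simplex_vertex R ord_max) = y & winding phase e = 1].
Proof.
have [u Eu lu] := lam_one; have [u0 Pf Nu] := Eu.
have Uf := F_R_plus_units Pf; pose al := abs_path Uf.
have ce : continuous (fun s => Y_act (al s) y).
  by apply: Y_act_continuous; [exact: abs_path_continuous|exact: cst_continuous].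
have e0 : Y_act (al (simplex_vertex R ord0)) y = y.
  rewrite /al abs_path0 -[RHS]Y_reprK; congr (Y_class N _).
  by apply: idele_ext => // t; exact: mul1r.
have e1 : Y_act (al (simplex_vertex R ord_max)) y = y.
  rewrite -[RHS]Y_reprK; apply/esym/Y_classP.
  exists u, (fun t => arch_abs (emb u) t / t u), (fun v => (completion_emb v u)^-1); split=> //.
  - exact: compact_part_abs.
  - exact: levelV.
  - move=> t; have tu0 : t u != 0 by rewrite fmorph_eq0.
    have aux (z w x : C) : z != 0 -> w * x = z * x * (w / z) by move=> z0; field.
    by rewrite [LHS]/(set_val (al _) t * arch_part (Y_repr y) t) abs_path1; exact: aux.
  - by move=> v; have c0 := completion_emb_neq0 v u0; rewrite [LHS]/(finite_part (Y_repr y) v)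
      mulrAC mulfV // mul1r.
pose e : continuousType (simplex R 1) YN := mkcts ce.
have f0 : e (simplex_vertex R ord0) = y := e0.
have f1 : e (simplex_vertex R ord_max) = y := e1.
exists e; split=> //; apply/eqP; rewrite -(eqr_int R).
rewrite (@winding_lift _ _ _ _ (fun s => phase y + lam (set_val (al s)))).
- rewrite f0 f1 subrr subr0; apply/eqP.
  have -> : lam (set_val (al (simplex_vertex R ord_max))) = 1.
    by rewrite -lu; apply: lam_abs => t; rewrite abs_path1 cabs_real ger0_norm // cabs_ge0.
  have -> : lam (set_val (al (simplex_vertex R ord0))) = 0 by rewrite /al abs_path0 lam1.
  ring.
- move=> s; have FF : Filter (nbhs s) by exact: nbhs_filter.
  apply: cvgD; first exact: cvg_cst.
  apply: (@continuous_comp _ _ _ al (fun a : U => lam (set_val a))); first exact: abs_path_continuous.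
  exact: lam_continuous.
- move=> s; have := phase_via (abs_path_plus Uf s) (act_via (al s) (Y_repr y)).
  rewrite Y_reprK => /intvalN; congr integral_valued; rewrite /= /Y_act; ring.
Qed.
End Theta.

(** * Hecke operators and translations *)

Section TensorMore.
Variables (A k : nzRingType) (iota : {rmorphism A -> k}) (V : lmodType A).
Local Notation pure := (@pure_tensor A k iota V).

Definition tensor_sum (c : tensor iota V) : Prop :=
  exists (n : nat) (a : 'I_n -> k) (x : 'I_n -> V), c = \sum_i pure (a i) (x i).

Lemma tensor_sumZ m n (a : 'I_n -> k) (x : 'I_n -> V) :
  m *: (\sum_i pure (a i) (x i)) = \sum_i pure (m * a i) (x i).
Proof. by rewrite scaler_sumr; apply: eq_bigr => i _; rewrite pure_tensorZl. Qed.

Lemma tensor_map_comp (h h' : V -> V) c : linear h -> linear h' -> tensor_sum c ->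
  tensor_map (h \o h') c = tensor_map h (tensor_map h' c).
Proof.
move=> hl hl' [n [a [x ->]]]; rewrite !tensor_map_sum // => b u v /=.
by rewrite hl' hl.
Qed.

Lemma tensor_mapZ (h : V -> V) m c : linear h -> tensor_sum c ->
  tensor_map h (m *: c) = m *: tensor_map h c.
Proof. by move=> hl [n [a [x ->]]]; rewrite tensor_sumZ !tensor_map_sum // tensor_sumZ. Qed.

Lemma tensor_map_add (h h' : V -> V) c : linear h -> linear h' -> tensor_sum c ->
  tensor_map (h \+ h') c = tensor_map h c + tensor_map h' c.
Proof.
move=> hl hl' [n [a [x ->]]]; rewrite !tensor_map_sum //.
  by rewrite -big_split; apply: eq_bigr => i _ /=; rewrite pure_tensorDr.
by move=> b u v /=; rewrite hl hl' scalerDr addrACA.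
Qed.

Lemma tensor_map_id c : tensor_sum c -> tensor_map idfun c = c.
Proof. by move=> [n [a [x ->]]]; rewrite tensor_map_sum. Qed.
End TensorMore.

Lemma tensor_map_scale (A k : comNzRingType) (iota : {rmorphism A -> k}) (V : lmodType A)
  (b : A) (h : V -> V) (c : tensor iota V) : linear h -> tensor_sum c ->
  tensor_map (b \*: h) c = iota b *: tensor_map h c.
Proof.
move=> hl [n [a [x ->]]]; rewrite !tensor_map_sum //.
  by rewrite tensor_sumZ; apply: eq_bigr => i _; rewrite /= pure_tensorZr mulrC.
by move=> e u v /=; rewrite hl scalerDr !scalerA mulrC.
Qed.

Lemma tensor_eq_detect (A k : fieldType) (iota : {rmorphism A -> k}) (V : lmodType A)
    (W : V -> Prop) (G : Type) (psi : G -> V -> A)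
    (WD : forall (c : A) u v, W u -> W v -> W (c *: u + v))
    (psiL : forall g (c : A) u v, psi g (c *: u + v) = c * psi g u + psi g v)
    (W_detect : forall v, W v -> (forall g, psi g v = 0) -> v = 0)
    (n : nat) (a b : 'I_n -> k) (x y : 'I_n -> V) :
  (forall i, W (x i)) -> (forall i, W (y i)) ->
  (forall g, \sum_i a i * iota (psi g (x i)) = \sum_i b i * iota (psi g (y i))) ->
  \sum_i pure_tensor iota (a i) (x i) = \sum_i pure_tensor iota (b i) (y i).
Proof.
move=> Wx Wy h; apply/eqP; rewrite -subr_eq0; apply/eqP.
pose c (i : 'I_(n + n)) : k := match fintype.split i with inl j => a j | inr j => - b j end.
pose z (i : 'I_(n + n)) : V := match fintype.split i with inl j => x j | inr j => y j end.
have sl j : fintype.split (lshift n j) = inl j by exact: (unsplitK (inl j)).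
have sr j : fintype.split (@rshift n n j) = inr j by exact: (unsplitK (inr j)).
have := @tensor_detect A k iota V W G psi WD psiL W_detect (n + n) c z.
rewrite big_split_ord /= /c /z => E; apply: (etrans _ (E _ _)).
- congr (_ + _); first by apply: eq_bigr => j _; rewrite sl.
  rewrite -sumrN; apply: eq_bigr => j _; rewrite sr.
  by rewrite -scaleN1r pure_tensorZl mulN1r.
- by move=> i; case: (fintype.split i).
- move=> g; rewrite big_split_ord /=.
  under eq_bigr do rewrite sl; under [X in _ + X]eq_bigr do rewrite sr mulNr.
  by rewrite sumrN h subrr.
Qed.

(** * Cup products in lowest degree *)

Section CupProduct.
Variables (R : realType) (A : comNzRingType) (X : topologicalType).
Local Notation cochain := (cochain R A X).

Lemma cup_linear (a : cochain) : linear (cup a).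
Proof.
move=> m b c; apply/funext => s; rewrite /cup.
change (\sum_(i < (projT1 s).+1) a (sing (sing_sub (@front_face (projT1 s) i) (projT2 s))) *
   (m * b (sing (sing_sub (@back_face (projT1 s) i) (projT2 s))) +
    c (sing (sing_sub (@back_face (projT1 s) i) (projT2 s)))) =
  m * cup a b s + cup a c s).
rewrite /cup mulr_sumr -big_split; apply: eq_bigr => i _ /=.
by rewrite mulrDr mulrCA.
Qed.

Lemma cup_front (a b : cochain) n (t : continuousType (simplex R n) X) :
  cup a b (sing t) = a (sing (sing_sub (@front_face n ord0) t)) * b (sing t) +
   \sum_(i < n) a (sing (sing_sub (@front_face n (fintype.lift ord0 i)) t)) *
                b (sing (sing_sub (@back_face n (fintype.lift ord0 i)) t)).
Proof.
rewrite /cup big_ord_recl; congr (_ * b _ + _).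
case: n t => [|n] t; congr (sing _); apply/continuousEP => s.
  by congr (t _); exact: simplex0_eq.
have e : (@back_face n.+1 ord0 : 'I_n.+2 -> 'I_n.+2) = id.
  by apply/funext => j; rewrite /back_face add0n inord_val.
change (t (simplex_map R (@back_face n.+1 ord0 : 'I_n.+2 -> 'I_n.+2) s) = t s).
by rewrite e simplex_map_id.
Qed.

Lemma cup_below (a b : cochain) j :
  (forall s, (projT1 s < j)%N -> b s = 0) -> forall s, (projT1 s < j)%N -> cup a b s = 0.
Proof.
move=> hb s sj; rewrite /cup big1 // => i _; rewrite hb ?mulr0 //=.
exact: leq_ltn_trans (leq_subr _ _) sj.
Qed.

Lemma cup_leading (a b : cochain) (a0 : A) j :
  (forall t : continuousType (simplex R 0) X, a (sing t) = a0) ->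
  (forall s, (projT1 s < j)%N -> b s = 0) ->
  forall s, (projT1 s < j.+1)%N -> cup a b s = a0 * b s.
Proof.
move=> ha hb [n t] /= nj; rewrite [cup _ _ _](cup_front a b t) ha big1 ?addr0 // => i _.
rewrite hb ?mulr0 //= /bump add1n; have := ltn_ord i; lia.
Qed.

Lemma cup_unit (a b : cochain) :
  (forall s, a s = if projT1 s is 0 then 1 else 0) -> cup a b = b.
Proof.
move=> ha; apply/funext => -[n t]; rewrite [cup _ _ _](cup_front a b t) ha /= mul1r big1 ?addr0 // => i _.
by rewrite ha /= mul0r.
Qed.
End CupProduct.

Section Hecke.
Variables (R : realType) (F : fieldExtType rat) (N : set F) (p : nat).
Local Notation YN := (Y R N).
Local Notation H := (cohomology R 'F_p YN).

(** A derived operator at v is only defined through a classifying map, so the existence of one is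
    part of the condition. *)
Definition hecke_place (v : finite_place F) : Prop :=
  ~ divides v (ideal_mul (principal_ideal p%:R) N) /\
  exists g : continuousType (simplex R 1) YN -> residue_units v, classifying_map g.

Inductive hecke_idele : finite_idele F -> Prop :=
| hecke_idele1 : hecke_idele (fidele_one F)
| hecke_ideleS v (z : completion v) (z0 : z != 0) b :
    hecke_place v -> hecke_idele b -> hecke_idele (fidele_mul (fidele_single z0) b).

Lemma hecke_idele_mul b c : hecke_idele b -> hecke_idele c -> hecke_idele (fidele_mul b c).
Proof.
elim=> [|v z z0 d hv _ IH] hc.
  by rewrite (_ : fidele_mul _ c = c) //; apply: finite_idele_ext => w; exact: mul1r.
rewrite (_ : fidele_mul _ c = fidele_mul (fidele_single z0) (fidele_mul d c)).
  by apply: hecke_ideleS => //; exact: IH.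
by apply: finite_idele_ext => w; rewrite /= mulrA.
Qed.

Lemma hecke_idele_single v (z : completion v) (z0 : z != 0) :
  hecke_place v -> hecke_idele (fidele_single z0).
Proof.
move=> hv; have := hecke_ideleS z0 hv hecke_idele1.
by rewrite (_ : fidele_mul _ _ = fidele_single z0) //; apply: finite_idele_ext => w; exact: mulr1.
Qed.

Lemma hecke_idele_inv b : hecke_idele b -> hecke_idele (fidele_inv b).
Proof.
elim=> [|v z z0 d hv _ IH].
  rewrite (_ : fidele_inv _ = fidele_one F); first exact: hecke_idele1.
  by apply: finite_idele_ext => w; exact: invr1.
have zi0 : z^-1 != 0 by rewrite invr_eq0.
rewrite (_ : fidele_inv _ = fidele_mul (fidele_single zi0) (fidele_inv d)); first exact: hecke_ideleS.
apply: finite_idele_ext => w; rewrite /= invfM; congr (_ * _).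
rewrite /fidele_single /= /fidele_trans_val; case: (eqVneq v w) => [<-|vw].
  by rewrite !dfwithin !mulr1.
by rewrite !dfwithout //= invr1.
Qed.

Definition translate (b : finite_idele F) : H -> H := cohomology_pullback (Y_mul R N b).

Lemma translate_linear b : linear (translate b).
Proof. exact: cohomology_pullback_linear. Qed.

Lemma translate_mul b c x : translate (fidele_mul b c) x = translate c (translate b x).
Proof. by apply: cohomology_pullback_comp => t; rewrite Y_mulM. Qed.

(** Closedness in degree 0, applied to the pair formed by two given arguments, says that the values
    there agree. *)
Lemma group_cocycle_const (v : finite_place F) (a : group_cochain p v) : group_cocycle a ->
  exists a0, forall u : 'I_1 -> residue_units v, a (existT _ 0%N u) = a0.
Proof.
move=> [_ _ hc]; have [[u0]|no] := pselect (inhabited ('I_1 -> residue_units v)); last first.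
  by exists 0 => u; exfalso; apply: no.
exists (a (existT _ 0%N u0)) => u.
pose x (i : 'I_2) := if i == ord0 then u ord0 else u0 ord0.
have := hc 0%N x; rewrite !big_ord_recl big_ord0 /= expr0 expr1 mul1r mulN1r addr0.
have -> : fintype.lift ord0 (ord0 : 'I_1) = ord_max :> 'I_2 by exact/val_inj.
have -> : x \o face ord0 = u0 by apply/funext => i; rewrite (ord1 i) /= face0.
have -> : x \o face ord_max = u by apply/funext => i; rewrite (ord1 i) /= face1.
by move/eqP; rewrite subr_eq0 => /eqP.
Qed.

(** It represents the unit of the cohomology ring, so that the derived operator attached to it is a
    pure translation. *)
Definition unit_cochain (v : finite_place F) : group_cochain p v :=
  fun s => if projT1 s is 0 then 1 else 0.

Lemma unit_cochain_cocycle (v : finite_place F) : group_cocycle (@unit_cochain v).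
Proof.
split=> [|n x g //|[|n] x].
- by exists 1%N => -[|n] x.
- rewrite !big_ord_recl big_ord0 /= expr0 expr1 mul1r mulN1r addr0.
  by rewrite /unit_cochain /= subrr.
- by rewrite big1 // => i _; rewrite /unit_cochain /= mulr0.
Qed.

Lemma translate_hecke b : hecke_idele b -> @hecke_algebra R F N p (translate b).
Proof.
elim=> [|v z z0 d [hv [g hg]] _ IH].
  rewrite (_ : translate _ = idfun); first exact: hecke_one.
  by apply/funext => x; apply: cohomology_pullback_id => t; exact: Y_mul1.
rewrite (_ : translate _ = translate d \o translate (fidele_single z0)); last first.
  by apply/funext => x; exact: translate_mul.
apply: hecke_comp => //.
apply: (@hecke_gen R F N p v z z0 (@unit_cochain v)) => //; first exact: unit_cochain_cocycle.
exists g => // c; exists (cocycle_pullback (Y_mul R N (fidele_single z0)) c).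
  exact: cohomology_pullback_class.
rewrite /= cup_unit //; first by rewrite Y_trans_mul.
Qed.

Lemma translate_hecke0 b : hecke_idele b -> @hecke_algebra0 R F N p (translate b).
Proof.
move=> hb; split; first exact: translate_hecke.
by move=> j x; exact: cohomology_pullback_deg.
Qed.

(* [h0] is the part of degree 0 of [h], which only has components of degree >= 0. *)
Record leading_part (h h0 : H -> H) : Prop := LeadingPart {
  leading_linear : linear h;
  leading_linear0 : linear h0;
  leading_ge : forall j x, cohomology_ge j x -> cohomology_ge j (h x);
  leading_ge0 : forall j x, cohomology_ge j x -> cohomology_ge j (h0 x);
  leading_deg0 : forall j x, cohomology_deg j x -> cohomology_deg j (h0 x);
  leading_diff : forall j x, cohomology_ge j x -> cohomology_ge j.+1 (h x - h0 x)
}.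

Lemma leading_part_id : leading_part idfun idfun.
Proof.
split=> // j x _; rewrite subrr; exists 0 => //; exact/esym/class0.
Qed.

Let geD j (x y : H) : cohomology_ge j x -> cohomology_ge j y -> cohomology_ge j (x + y).
Proof. by rewrite -{2}[x]scale1r; exact: cohomology_ge_lin. Qed.
Let degD j (x y : H) : cohomology_deg j x -> cohomology_deg j y -> cohomology_deg j (x + y).
Proof. by rewrite -{2}[x]scale1r; exact: cohomology_degZ. Qed.
Let ge_zero j : cohomology_ge j (0 : H).
Proof. by exists 0 => //; exact/esym/class0. Qed.
Let deg_zero j : cohomology_deg j (0 : H).
Proof. by exists 0 => //; exact/esym/class0. Qed.
Let geZ j b (x : H) : cohomology_ge j x -> cohomology_ge j (b *: x).
Proof. by move=> hx; rewrite -[_ *: _]addr0; apply: cohomology_ge_lin; last exact: ge_zero. Qed.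
Let degZ j b (x : H) : cohomology_deg j x -> cohomology_deg j (b *: x).
Proof. by move=> hx; rewrite -[_ *: _]addr0; apply: cohomology_degZ; last exact: deg_zero. Qed.

Lemma leading_part_add h h0 h' h0' : leading_part h h0 -> leading_part h' h0' ->
  leading_part (h \+ h') (h0 \+ h0').
Proof.
move=> [l l0 g g0 d0 f] [l' l0' g' g0' d0' f']; split.
- by move=> b u v /=; rewrite l l' scalerDr addrACA.
- by move=> b u v /=; rewrite l0 l0' scalerDr addrACA.
- by move=> j x hx; apply: geD; [exact: g|exact: g'].
- by move=> j x hx; apply: geD; [exact: g0|exact: g0'].
- by move=> j x hx; apply: degD; [exact: d0|exact: d0'].
- by move=> j x hx /=; rewrite opprD addrACA; apply: geD; [exact: f|exact: f'].
Qed.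

Lemma leading_part_scale b h h0 : leading_part h h0 -> leading_part (b \*: h) (b \*: h0).
Proof.
move=> [l l0 g g0 d0 f]; split.
- by move=> e u v /=; rewrite l scalerDr !scalerA mulrC.
- by move=> e u v /=; rewrite l0 scalerDr !scalerA mulrC.
- by move=> j x hx; apply: geZ; exact: g.
- by move=> j x hx; apply: geZ; exact: g0.
- by move=> j x hx; apply: degZ; exact: d0.
- by move=> j x hx /=; rewrite -scalerBr; apply: geZ; exact: f.
Qed.

Lemma leading_part_comp h h0 h' h0' : leading_part h h0 -> leading_part h' h0' ->
  leading_part (h \o h') (h0 \o h0').
Proof.
move=> [l l0 g g0 d0 f] [l' l0' g' g0' d0' f']; split.
- by move=> b u v /=; rewrite l' l.
- by move=> b u v /=; rewrite l0' l0.
- by move=> j x hx; apply: g; exact: g'.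
- by move=> j x hx; apply: g0; exact: g0'.
- by move=> j x hx; apply: d0; exact: d0'.
- move=> j x hx /=.
  have -> : h (h' x) - h0 (h0' x) = h (h' x - h0' x) + (h (h0' x) - h0 (h0' x)).
    have -> : h (h' x - h0' x) = h (h' x) - h (h0' x).
      by rewrite addrC -scaleN1r l scaleN1r addrC.
    by rewrite addrA subrK.
  by apply: geD; [apply: g; exact: f'|apply: f; exact: g0'].
Qed.

Variables (k : closedFieldType) (iota : {rmorphism 'F_p -> k}).

(** For a generator, [h0] is the constant value of the group cocycle in degree 0 times a
    translation; sums, multiples and composites follow. The scalar mu is chosen before c, so it is
    determined by chi and serves all degrees at once. *)
Lemma hecke_leading (h : H -> H) (chi : finite_idele F -> k) : @hecke_algebra R F N p h ->
  exists h0, leading_part h h0 /\ exists mu : k, forall c : tensor iota H, tensor_sum c ->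
    (forall b, hecke_idele b -> tensor_map (translate b) c = chi b *: c) ->
    tensor_map h0 c = mu *: c.
Proof.
elim=> {h} [v z z0 a h vpN ga [g hg hE]||h h' _ [h0 [L [m hm]]] _ [h0' [L' [m' hm']]]
  |b h _ [h0 [L [m hm]]]|h h' _ [h0 [L [m hm]]] _ [h0' [L' [m' hm']]]].
- have [a0 ha] := group_cocycle_const ga; pose s := fidele_single z0.
  have hv : hecke_place v by split=> //; exists g.
  have hP (c : cocycle R 'F_p YN) : exists2 c' : cocycle R 'F_p YN,
      h (cohomology_class c) = cohomology_class c' &
      cocycle_val c' = cup (bracket g a) (cocycle_val (cocycle_pullback (Y_mul R N s) c)).
    by have [c' h1 h2] := hE c; exists c' => //; rewrite h2 Y_trans_mul.
  have ha0 (t : continuousType (simplex R 0) YN) : bracket g a (sing t) = a0 by rewrite /bracket /= ha.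
  exists (a0 \*: translate s); split; [split|].
  + move=> b u w; rewrite -(class_repr u) -(class_repr w) -class_linear.
    have [c1 e1 f1] := hP (repr u); have [c2 e2 f2] := hP (repr w).
    have [c3 e3 f3] := hP (b *: repr u + repr w).
    rewrite e1 e2 e3 -class_linear; congr cohomology_class; apply/val_inj.
    rewrite /= f3; transitivity (b *: cocycle_val c1 + cocycle_val c2); last by [].
    by rewrite f1 f2 -cup_linear.
  + by move=> b u w /=; rewrite translate_linear scalerDr !scalerA mulrC.
  + move=> j _ [w hw ->]; have [c1 -> f1] := hP w; exists c1 => // t tj.
    by rewrite f1 (@cup_below _ _ _ _ _ j) // => t' t'j; exact: hw.
  + by move=> j x hx; apply: geZ; exact: cohomology_pullback_ge.
  + by move=> j x hx; apply: degZ; exact: cohomology_pullback_deg.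
  + move=> j _ [w hw ->]; have [c1 -> f1] := hP w.
    rewrite /= /translate cohomology_pullback_class.
    exists (c1 - a0 *: cocycle_pullback (Y_mul R N s) w).
      move=> t tj; change (cocycle_val c1 t - a0 * cocycle_val (cocycle_pullback (Y_mul R N s) w) t = 0).
      rewrite f1 (@cup_leading _ _ _ _ _ a0 j) ?subrr // => t' t'j; exact: hw.
    rewrite addrC -scaleNr -[cohomology_class c1 in LHS](class_repr).
    rewrite class_repr -class_linear; congr cohomology_class.
    by rewrite scaleNr addrC.
  exists (iota a0 * chi s) => c cs hc.
  rewrite tensor_map_scale //; last exact: translate_linear.
  by rewrite hc ?scalerA //; exact: hecke_idele_single.
- exists idfun; split; first exact: leading_part_id.
  by exists 1 => c cs _; rewrite scale1r; exact: tensor_map_id.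
- exists (h0 \+ h0'); split; first exact: leading_part_add.
  exists (m + m') => c cs hc; have [l0 l0'] := (leading_linear0 L, leading_linear0 L').
  by rewrite tensor_map_add // hm // hm' // scalerDl.
- exists (b \*: h0); split; first exact: leading_part_scale.
  exists (iota b * m) => c cs hc; have l0 := leading_linear0 L.
  by rewrite tensor_map_scale // hm // scalerA.
- exists (h0 \o h0'); split; first exact: leading_part_comp.
  exists (m * m') => c cs hc; have [l0 l0'] := (leading_linear0 L, leading_linear0 L').
  by rewrite tensor_map_comp // hm' // tensor_mapZ // hm // scalerA mulrC.
Qed.

(** On a class of degree j the difference h - h0 preserves the degree and also raises the
    filtration, so it vanishes by [deg_ge0]. *)
Lemma hecke0_eigen (h : H -> H) (chi : finite_idele F -> k) : @hecke_algebra0 R F N p h ->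
  exists mu : k, forall j (c : tensor iota H), cohomology_ext j c ->
    (forall b, hecke_idele b -> tensor_map (translate b) c = chi b *: c) ->
    tensor_map h c = mu *: c.
Proof.
move=> [hh hdeg]; have [h0 [L [m hm]]] := hecke_leading chi hh.
exists m => j c [n [a [x [hx cE]]]] hc; rewrite -hm //; last by exists n, a, x.
rewrite cE !tensor_map_sum; [|exact: leading_linear0 L|exact: leading_linear L].
apply: eq_bigr => i _; congr pure_tensor; apply/eqP; rewrite -subr_eq0; apply/eqP.
apply: (@deg_ge0 _ _ _ j); last by apply: (leading_diff L); exact: deg_ge.
have := degZ (-1) (leading_deg0 L (hx i)); rewrite scaleN1r; apply: degD; exact: hdeg.
Qed.

(** Translations by Hecke ideles belong to T^0, so lambda prescribes their eigenvalues. Conversely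
    these determine lambda: an operator h acts on c and on c' by the same scalar, and this scalar is
    lambda(h) because c is nonzero. *)
Lemma occurs_transfer (lambda : (H -> H) -> k) i j :
  (forall (chi : finite_idele F -> k) (c : tensor iota H), cohomology_ext i c -> c != 0 ->
    (forall b, hecke_idele b -> tensor_map (translate b) c = chi b *: c) ->
    exists c' : tensor iota H, [/\ cohomology_ext j c', c' != 0 &
      forall b, hecke_idele b -> tensor_map (translate b) c' = chi b *: c']) ->
  occurs_in iota lambda i -> occurs_in iota lambda j.
Proof.
move=> transfer [c [ic c0 hc]]; pose chi b := lambda (translate b).
have cE b : hecke_idele b -> tensor_map (translate b) c = chi b *: c.
  by move=> hb; apply: hc; exact: translate_hecke0.
have [c' [jc' c'0 c'E]] := transfer chi c ic c0 cE; exists c'; split=> // h hh.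
have [m hm] := hecke0_eigen chi hh; rewrite (hm j c' jc' c'E).
have := hc h hh; rewrite (hm i c ic cE) => /eqP; rewrite -subr_eq0 -scalerBl scaler_eq0 (negPf c0) orbF.
by rewrite subr_eq0 => /eqP ->.
Qed.
End Hecke.

(** * Transfer between degrees 0 and 1 *)

Section Transfer.
Variables (R : realType) (F : fieldExtType rat) (N : set F) (p : nat).
Hypothesis hN : nonzero_ideal N.
Variables (k : closedFieldType) (iota : {rmorphism 'F_p -> k}).
Local Notation C := (complex_of R).
Local Notation YN := (Y R N).
Local Notation H := (cohomology R 'F_p YN).
Local Notation path := (continuousType (simplex R 1) YN).
Local Notation v0 := (simplex_vertex R (ord0 : 'I_2)).
Local Notation v1 := (simplex_vertex R (ord_max : 'I_2)).
Local Notation drel := (coset_rel (@F_R_plus R F) N).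
Local Notation pure := (@pure_tensor 'F_p k iota H).
Local Notation evpt y := (evaluation (sing (const_simplex R 0 (y : YN)))).
Local Notation trans := (@translate R F N p).

(** Evaluation extends k-linearly to the tensor product, so the result does not depend on how a
    tensor is written as a sum. *)
Lemma tensor_evaluation (s : singular R YN) n m (a : 'I_n -> k) (x : 'I_n -> H)
    (b : 'I_m -> k) (y : 'I_m -> H) : (forall c : cochain R 'F_p YN, coboundary c s = 0) ->
  \sum_i pure (a i) (x i) = \sum_i pure (b i) (y i) ->
  \sum_i a i * iota (evaluation s (x i)) = \sum_i b i * iota (evaluation s (y i)).
Proof.
move=> cs e; pose f (u : H) : k^o := iota (evaluation s u).
have fD : {morph f : u v / u + v}.
  by move=> u v; rewrite /f -[u]scale1r evaluation_linear // mul1r scale1r rmorphD.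
have ev0 : evaluation s (0 : H) = 0.
  by have := evaluation_linear cs (-1) 0 0; rewrite scaleN1r addNr mulN1r addNr.
have fZ b' v : f (b' *: v) = iota b' *: f v.
  by rewrite /f -[b' *: v]addr0 evaluation_linear // ev0 addr0 rmorphM.
have := congr1 (tensor_lift f) e; rewrite !(tensor_lift_sum fD fZ).
by [].
Qed.

Lemma eigen_evaluation (s : singular R YN) n (a : 'I_n -> k) (x : 'I_n -> H) b m :
  (forall c : cochain R 'F_p YN, coboundary c s = 0) ->
  tensor_map (trans b) (\sum_i pure (a i) (x i)) = m *: \sum_i pure (a i) (x i) ->
  \sum_i a i * iota (evaluation (sing_push (Y_mul R N b) s) (x i)) =
  m * \sum_i a i * iota (evaluation s (x i)).
Proof.
move=> cs; rewrite tensor_map_sum; last exact: translate_linear.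
rewrite tensor_sumZ => /(tensor_evaluation cs) e.
transitivity (\sum_i a i * iota (evaluation s (trans b (x i)))).
  by apply: eq_bigr => i _; rewrite /translate evaluation_pullback.
by rewrite e mulr_sumr; apply: eq_bigr => i _; rewrite mulrA.
Qed.

(** Only the component of degree 0 of the cocycle enters, and it is closed. *)
Lemma evaluation_path (e : path) (x : H) : evpt (e v0) x = evpt (e v1) x.
Proof.
have [_ dz] := cocycleP (repr x); have := congr1 (fun w : cochain R 'F_p YN => w (sing e)) dz.
by rewrite coboundary_path => /eqP; rewrite subr_eq0 => /eqP.
Qed.

Section Lift.
Variable lam : arch_space R F -> R.
Hypothesis lamM : forall f g, F_R_units f -> F_R_units g -> lam (fun t => f t * g t) = lam f + lam g.
Hypothesis lam_abs : forall f g, (forall t, cabs (f t) = cabs (g t)) -> lam f = lam g.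
Hypothesis lam_continuous : continuous (fun a : @F_R_units R F => lam (set_val a)).
Hypothesis lam_unit : forall e, @unit_group R F N e ->
  integral_valued (lam (fun t : embedding R F => t e)).
Hypothesis lam_one : exists2 e, @unit_group R F N e & lam (fun t : embedding R F => t e) = 1.
Local Notation wind := (winding (phase (N := N) lam)).

(** The cup product of the degree 0 component of x with the winding cocycle of theta. *)
Let wcochain (x : H) : cochain R 'F_p YN := fun s => match s with
  | existT 1 e => evpt (e v0) x * (wind e)%:~R
  | _ => 0 end.

Let wcochain_closed x : coboundary (wcochain x) = 0.
Proof.
apply/funext => -[[|[|[|n]]] t] //.
- by rewrite /= big1 // => i _; rewrite mulr0.
- rewrite (coboundary_triangle (wcochain x) t).
  have cE (e : path) : wcochain x (sing e) = evpt (e v0) x * (wind e)%:~R by [].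
  have cw := winding_cocycle (phase_continuous lamM lam_abs lam_continuous lam_unit hN) t.
  have start (i : 'I_3) : sing_sub (face i) t v0 = t (simplex_vertex R (face i ord0)).
    by rewrite /sing_sub /= simplex_map_vertex.
  have e01 : evpt (t (simplex_vertex R ord0)) x = evpt (t (simplex_vertex R 1)) x.
    have := evaluation_path (sing_sub (face ord_max) t) x.
    rewrite start /sing_sub /= simplex_map_vertex.
    have -> : face (ord_max : 'I_3) ord0 = ord0 by exact/val_inj.
    by have -> : face (ord_max : 'I_3) ord_max = 1 by exact/val_inj.
  rewrite !cE !start.
  have -> : face (ord0 : 'I_3) ord0 = 1 by exact/val_inj.
  have -> : face (1 : 'I_3) ord0 = ord0 by exact/val_inj.
  have -> : face (ord_max : 'I_3) ord0 = ord0 by exact/val_inj.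
  by rewrite e01 -mulrBr -mulrDr -rmorphB -rmorphD cw mulr0.
- by rewrite /= big1 // => i _; rewrite mulr0.
Qed.

Let wcochain_bounded x : bounded_degree (wcochain x).
Proof. by exists 2%N => -[[|[|n]] t]. Qed.

Let wclass (x : H) : H := cohomology_class (mk_cocycle (wcochain_bounded x) (wcochain_closed x)).

Let wclass_deg x : cohomology_deg 1 (wclass x).
Proof. by exists (mk_cocycle (wcochain_bounded x) (wcochain_closed x)) => // -[[|[|n]] t]. Qed.

Let wclass_loop x (e : path) : e v0 = e v1 ->
  evaluation (sing e) (wclass x) = evpt (e v0) x * (wind e)%:~R.
Proof. by move=> l; rewrite evaluation_class // => b; exact: closed_loop. Qed.

Lemma transfer01 (chi : finite_idele F -> k) (c : tensor iota H) :
  cohomology_ext 0 c -> c != 0 ->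
  (forall b, hecke_idele R N p b -> tensor_map (trans b) c = chi b *: c) ->
  exists c' : tensor iota H, [/\ cohomology_ext 1 c', c' != 0 &
    forall b, hecke_idele R N p b -> tensor_map (trans b) c' = chi b *: c'].
Proof.
move=> [n [a [x [hx ->]]]] c0 hc.
have [y hy] : exists y, \sum_i a i * iota (evpt y (x i)) != 0.
  apply: contrapT => no; move/eqP: c0; apply.
  apply: (@tensor_detect _ _ iota H (@cohomology_deg R 'F_p YN 0) YN (fun y u => evpt y u)) => //.
  - by move=> m u w; exact: cohomology_degZ.
  - by move=> z m u w; rewrite evaluation_linear.
  - by move=> u hu h; exact: deg0_detect.
  - by move=> z; apply: contrapT => /eqP hz; apply: no; exists z.
have [e [e0 e1 we]] := winding_loop lamM lam_abs lam_continuous lam_unit lam_one y.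
have le : e v0 = e v1 by rewrite e0 e1.
exists (\sum_i pure (a i) (wclass (x i))); split.
- by exists n, a, (fun i => wclass (x i)).
- apply/eqP => h; move/eqP: hy; apply.
  (* The zero tensor is written as an empty sum. *)
  have := @tensor_evaluation (sing e) n 0 a (fun i => wclass (x i)) (fun=> 0) (fun=> 0).
  rewrite !big_ord0 h => /(_ (fun b => closed_loop b le) erefl) E; apply: (etrans _ E).
  by apply: eq_bigr => i _; rewrite wclass_loop // e0 we mulr1.
- move=> b hb; rewrite tensor_map_sum; last exact: translate_linear.
  rewrite tensor_sumZ.
  apply: (@tensor_eq_detect _ _ iota H (@cohomology_deg R 'F_p YN 1) {f : path | f v0 = f v1}
     (fun f u => evaluation (sing (sval f)) u)).
  + by move=> m u w; exact: cohomology_degZ.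
  + by move=> [f lf] m u w; rewrite evaluation_linear // => b'; exact: closed_loop.
  + by move=> u hu h; apply: deg1_detect => // f lf; exact: (h (exist _ f lf)).
  + by move=> i; apply: cohomology_pullback_deg.
  + by [].
  move=> [f lf] /=.
  have lbf : (Y_mul R N b \o f) v0 = (Y_mul R N b \o f) v1 by rewrite /= lf.
  transitivity (\sum_i a i * iota (evpt (Y_mul R N b (f v0)) (x i)) * iota (wind f)%:~R).
    apply: eq_bigr => i _; rewrite /translate evaluation_pullback; last by move=> b'; exact: closed_loop.
    rewrite [sing_push _ _]/(sing (Y_mul R N b \o f)) wclass_loop //.
    by rewrite winding_mul // rmorphM mulrA.
  rewrite -mulr_suml.
  have := @eigen_evaluation (sing (const_simplex R 0 (f v0))) n a x b (chi b)
    (@closed_point R 'F_p YN (f v0)) (hc b hb).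
  have -> : sing_push (Y_mul R N b) (sing (const_simplex R 0 (f v0))) =
    sing (const_simplex R 0 (Y_mul R N b (f v0))).
    by congr (sing _); apply/continuousEP => t.
  move=> ->; rewrite mulr_sumr mulr_suml; apply: eq_bigr => i _.
  by rewrite wclass_loop // rmorphM !mulrA.
Qed.
End Lift.

(* The homotopy between the two loops is the square obtained by letting the path
   from 1 to |a| act on b e, where b' e is the image of b e under a. *)
Lemma loop_translate (e : path) (b b' : finite_idele F) (x : H) : e v0 = e v1 ->
  drel (idele_mul (idele_fin R b) (Y_repr (e v0))) (idele_mul (idele_fin R b') (Y_repr (e v0))) ->
  evaluation (sing (Y_mul R N b \o e)) x = evaluation (sing (Y_mul R N b' \o e)) x.
Proof.
move=> le [g [a [h [g0 Pa Nh ha hf]]]]; have Ua := F_R_plus_units Pa.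
have [_ dz] := cocycleP (repr x).
pose Q (st : simplex R 1 * simplex R 1) := Y_act (abs_path Ua st.1) (Y_mul R N b (e st.2)).
have cQ : continuous Q.
  apply: Y_act_continuous => st.
    by apply: (@continuous_comp _ _ _ fst (abs_path Ua)); [exact: cvg_fst|exact: abs_path_continuous].
  apply: (@continuous_comp _ _ _ (fun st => e st.2) (Y_mul R N b)); last exact: cts_fun.
  by apply: (@continuous_comp _ _ _ snd e); [exact: cvg_snd|exact: cts_fun].
apply: (square_loops dz cQ) => [s|s|s]; rewrite /Q /=; first by rewrite le.
  rewrite abs_path0 -{1}[Y_mul R N b (e s)]Y_reprK; congr (Y_class N _).
  by apply: idele_ext => // t; apply/esym; exact: mul1r.
rewrite -[e s]Y_reprK !Y_mulE Y_actE; apply/esym/Y_classP.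
set y := Y_repr (e s); set y0 := Y_repr (e v0) in ha hf.
(* The homotopy ends at |a| instead of a; the discrepancy a/|a| lies in U. *)
exists g, (fun t => (arch_abs a t / a t)^-1), h; split=> //.
- by apply: compact_partV; exact: compact_part_abs.
- move=> t; have [_ a0] := Ua; have y00 : arch_part y0 t != 0 by exact: arch_unit_neq0.
  have := ha t; change (1 * arch_part y0 t = t g * (1 * arch_part y0 t) * a t -> 
    1 * arch_part y t =
      t g * (set_val (abs_path Ua v1) t * (1 * arch_part y t)) * (arch_abs a t / a t)^-1).
  rewrite abs_path1 => E.
  have ab0 : arch_abs a t != 0 by rewrite fmorph_eq0 cabs_eq0.
  (* At the base point the translates by b and b' have the same archimedean component, so a is the
     inverse of g at every embedding. The relation between the two translates then holds at each
     point of the loop, with the same g and h. *)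
  have ga : t g * a t = 1.
    by apply: (mulIf y00); rewrite mulrAC mul1r; move: E; rewrite mul1r => <-.
  have aux (u z w q : C) : z != 0 -> w != 0 -> u * z = 1 -> 1 * q = u * (w * (1 * q)) * (w / z)^-1.
    move=> z0 w0 uz; transitivity (u * z * q); first by rewrite uz.
    by field; rewrite z0 w0.
  exact: aux.
- move=> v; have yv0 := fidele_neq0 (finite_part y0) v.
  have := hf v; change (b' v * finite_part y0 v = completion_emb v g * (b v * finite_part y0 v) * h v ->
    b' v * finite_part y v = completion_emb v g * (b v * finite_part y v) * h v).
  have aux (K : fieldType) (q q' u w z z' : K) : z != 0 -> q * z = u * (w * z) * q' ->
      q * z' = u * (w * z') * q'.
    move=> z0 E; have -> : q = u * w * q' by apply: (mulIf z0); rewrite E; ring.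
    ring.
  exact: aux.
Qed.

Section Spread.
Variables (e : path) (le : e v0 = e v1).
Local Notation x0 := (Y_repr (e v0)).

Let reach (y : YN) (b : finite_idele F) : Prop :=
  hecke_idele R N p b /\ drel (idele_mul (idele_fin R b) x0) (Y_repr y).

(** The default 0 is the intended value on the components that no Hecke translate of e reaches. *)
Let value (x : H) (y : YN) : 'F_p := xget 0
  [set l | exists2 b, reach y b & l = evaluation (sing (Y_mul R N b \o e)) x].

Let valueE x y b : reach y b -> value x y = evaluation (sing (Y_mul R N b \o e)) x.
Proof.
move=> [hb rb]; rewrite /value; case: xgetP => [l _ [b' [hb' rb'] ->]|no].
  by apply: loop_translate => //; exact: drel_trans rb' (drel_sym rb).
by exfalso; apply: (no (evaluation (sing (Y_mul R N b \o e)) x)); exists b.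
Qed.

Let value0 x y : ~ (exists b, reach y b) -> value x y = 0.
Proof.
move=> no; rewrite /value; case: xgetP => // l _ [b rb _].
by exfalso; apply: no; exists b.
Qed.

Let value_path x (f : path) : value x (f v0) = value x (f v1).
Proof.
have f01 := path_drel hN f v1; congr xget; apply/seteqP; split=> l [b [hb rb] ->]; exists b => //.
  by split=> //; exact: drel_trans rb f01.
by split=> //; exact: drel_trans rb (drel_sym f01).
Qed.

Let vcochain (x : H) : cochain R 'F_p YN := fun s => match s with
  | existT 0 t => value x (t (simplex_vertex R ord0))
  | _ => 0 end.

Let vcochain_closed x : coboundary (vcochain x) = 0.
Proof.
apply/funext => -[[|[|n]] t] //.
  rewrite (coboundary_path (vcochain x) t) /vcochain /=.
  by rewrite value_path subrr.
by rewrite /= big1 // => i _; rewrite mulr0.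
Qed.

Let vcochain_bounded x : bounded_degree (vcochain x).
Proof. by exists 1%N => -[[|n] t]. Qed.

Let vclass (x : H) : H := cohomology_class (mk_cocycle (vcochain_bounded x) (vcochain_closed x)).

Let vclass_deg x : cohomology_deg 0 (vclass x).
Proof. by exists (mk_cocycle (vcochain_bounded x) (vcochain_closed x)) => // -[[|n] t]. Qed.

Let vclass_point x y : evpt y (vclass x) = value x y.
Proof. by rewrite evaluation_class. Qed.

Lemma transfer_loop (chi : finite_idele F -> k) n (a : 'I_n -> k) (x : 'I_n -> H) :
  let c := \sum_i pure (a i) (x i) in
  \sum_i a i * iota (evaluation (sing e) (x i)) != 0 ->
  (forall b, hecke_idele R N p b -> tensor_map (trans b) c = chi b *: c) ->
  exists c' : tensor iota H, [/\ cohomology_ext 0 c', c' != 0 &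
    forall b, hecke_idele R N p b -> tensor_map (trans b) c' = chi b *: c'].
Proof.
move=> c c0 hc; exists (\sum_i pure (a i) (vclass (x i))); split.
- by exists n, a, (fun i => vclass (x i)).
- apply/eqP => h; move/eqP: c0; apply.
  have := @tensor_evaluation (sing (const_simplex R 0 (e v0))) n 0 a
    (fun i => vclass (x i)) (fun=> 0) (fun=> 0).
  rewrite !big_ord0 h => /(_ (@closed_point R 'F_p YN (e v0)) erefl) E; apply: (etrans _ E).
  apply: eq_bigr => i _; rewrite vclass_point.
  have r1 : reach (e v0) (fidele_one F).
    split; first exact: hecke_idele1.
    rewrite (_ : idele_mul _ _ = x0); first exact: drel_refl.
    exact: idele_mul1.
  rewrite (valueE _ r1); congr (_ * iota (evaluation (sing _) _)).
  by apply/continuousEP => t; rewrite /= Y_mul1.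
- move=> b hb; rewrite tensor_map_sum; last exact: translate_linear.
  rewrite tensor_sumZ.
  apply: (@tensor_eq_detect _ _ iota H (@cohomology_deg R 'F_p YN 0) YN (fun y u => evpt y u)).
  + by move=> m u w; exact: cohomology_degZ.
  + by move=> z m u w; rewrite evaluation_linear.
  + by move=> u hu h; exact: deg0_detect.
  + by move=> i; apply: cohomology_pullback_deg.
  + by [].
  move=> y.
  transitivity (\sum_i a i * iota (value (x i) (Y_mul R N b y))).
    apply: eq_bigr => i _; rewrite /translate evaluation_pullback //.
    rewrite (_ : sing_push _ _ = sing (const_simplex R 0 (Y_mul R N b y))) ?vclass_point //.
    by congr (sing _); apply/continuousEP => t.
  under [RHS]eq_bigr do rewrite vclass_point.
  have up b' y' d : hecke_idele R N p d -> reach y' b' -> reach (Y_mul R N d y') (fidele_mul d b').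
    move=> hd [hb' rb']; split; first exact: hecke_idele_mul.
    have := Y_drel_mul d rb'; rewrite idele_mulA.
    rewrite (_ : idele_mul (idele_fin R d) (idele_fin R b') = idele_fin R (fidele_mul d b')) //.
    by apply: idele_ext => // t; exact: mulr1.
  have [[b' rb']|no] := pselect (exists b', reach y b'); last first.
    rewrite !big1 // => i _; rewrite value0 ?rmorph0 ?mulr0 // => -[b' rb'].
    (* Hecke ideles are closed under inverses, so a component carried by b to a reachable one is
       itself reachable. *)
    apply: no; exists (fidele_mul (fidele_inv b) b').
    have := up _ _ _ (hecke_idele_inv hb) rb'; rewrite Y_mulM.
    rewrite (_ : fidele_mul (fidele_inv b) b = fidele_one F) ?Y_mul1 //.
    by apply: finite_idele_ext => v; rewrite /= mulVf ?fidele_neq0.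
  have lb' : (Y_mul R N b' \o e) v0 = (Y_mul R N b' \o e) v1 by rewrite /= le.
  have := @eigen_evaluation (sing (Y_mul R N b' \o e)) n a x b (chi b)
    (fun c => closed_loop c lb') (hc b hb).
  have -> : sing_push (Y_mul R N b) (sing (Y_mul R N b' \o e)) = sing (Y_mul R N (fidele_mul b b') \o e).
    by congr (sing _); apply/continuousEP => t; rewrite /= Y_mulM.
  move=> E; transitivity (\sum_i a i * iota (evaluation (sing (Y_mul R N (fidele_mul b b') \o e)) (x i))).
    by apply: eq_bigr => i _; rewrite (valueE _ (up _ _ _ hb rb')).
  rewrite [LHS]E mulr_sumr; apply: eq_bigr => i _.
  by rewrite (valueE _ rb') mulrA.
Qed.
End Spread.

Lemma transfer10 (chi : finite_idele F -> k) (c : tensor iota H) :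
  cohomology_ext 1 c -> c != 0 ->
  (forall b, hecke_idele R N p b -> tensor_map (trans b) c = chi b *: c) ->
  exists c' : tensor iota H, [/\ cohomology_ext 0 c', c' != 0 &
    forall b, hecke_idele R N p b -> tensor_map (trans b) c' = chi b *: c'].
Proof.
move=> [n [a [x [hx ->]]]] c0 hc.
have [[e le] he] : exists e : {f : path | f v0 = f v1},
    \sum_i a i * iota (evaluation (sing (sval e)) (x i)) != 0.
  apply: contrapT => no; move/eqP: c0; apply.
  apply: (@tensor_detect _ _ iota H (@cohomology_deg R 'F_p YN 1) {f : path | f v0 = f v1}
     (fun f u => evaluation (sing (sval f)) u)) => //.
  - by move=> m u w; exact: cohomology_degZ.
  - by move=> [f lf] m u w; rewrite evaluation_linear // => b'; exact: closed_loop.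
  - by move=> u hu h; apply: deg1_detect => // f lf; exact: (h (exist _ f lf)).
  - by move=> f; apply: contrapT => /eqP hf; apply: no; exists f.
exact: (transfer_loop le he hc).
Qed.
End Transfer.

Theorem theoremB (R : realType) (F : fieldExtType rat) (N : set F) (p d : nat)
    (k : closedFieldType) (iota : {rmorphism 'F_p -> k})
    (lambda : (cohomology R 'F_p (Y R N) -> cohomology R 'F_p (Y R N)) -> k)
    (F_not_Q : \dim {:F} <> 1%N)
    (F_not_imaginary_quadratic : ~ imaginary_quadratic R F)
    (N_ideal : nonzero_ideal N)
    (p_prime : prime p)
    (unit_index : (unit_quotient R N #= `I_d)%card)
    (p_index : ~~ (p %| d)%N)
    (k_algebraic : integralRange iota)
    (lambda_eigensystem : hecke_eigensystem lambda) :
  occurs_in iota lambda 1 <-> occurs_in iota lambda 0.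
Proof.
split; apply: occurs_transfer => chi c; first exact: transfer10.
have [lam [lamM lam_abs lam_cont lam_unit lam_one]] :=
  unit_functional F_not_Q F_not_imaginary_quadratic unit_index.
exact: (transfer01 N_ideal lamM lam_abs lam_cont lam_unit lam_one).
Qed.
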